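(* In the scaled framework described in the context, assume (A1)–(A11), (H1)–(H3), that $F(u) = 0$ and $G(u) > 0$ for all $u \in W\setminus\{0\}$, and that (for every $c\in\mathbb{R}$) $h(u)\neq 0$ for all $u\in\mathcal{N}_c$. Let $I^+ = (0,\infty)$. Then: (i) For each $c \in I^+$, $\lambda_{c,k} \nearrow \infty$ ($k\ge1$) is a sequence of critical values of $\lambda_c$. Moreover, $\Phi_{\lambda_{c,k}}$ has a nontrivial critical point $u_{c,k}$ with $\Phi_{\lambda_{c,k}}(u_{c,k}) = c$. (ii) For each $k \ge 1$, the mapping $I^+ \to \mathbb{R}$, $c \mapsto \lambda_{c,k}$ is continuous, decreasing, and satisfies $\lim_{c \to 0^+} \lambda_{c,k} = \lambda_k$ and $\lim_{c \to \infty} \lambda_{c,k} = -\infty$. (iii) For each $\lambda \in \mathbb{R}$, $\Phi_\lambda$ has a sequence of nontrivial critical points $(v_{\lambda,k})$ such that $\Phi_\lambda(v_{\lambda,k}) \nearrow \infty$ and $\|v_{\lambda,k}\| \to \infty$. Moreover, $\Phi_\lambda$ has no nontrivial critical point with critical value in $\mathbb{R}\setminus I^+$.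
   Context: Scaled framework. $W$ is a reflexive (real) Banach space with dual $W^*$; $\rightharpoonup$ is weak convergence. $W$ carries a scaling: a continuous map $W\times[0,\infty)\to W$, $(u,t)\mapsto u_t$, with (A1) $(u_{t_1})_{t_2}=u_{t_1t_2}$ for all $u\in W$, $t_1,t_2\ge0$; (A2) $(\tau u)_t=\tau u_t$ for all $u\in W$, $\tau\in\mathbb{R}$, $t\ge0$; (A3) $u_0=0$, $u_1=u$; (A4) $u_t$ is bounded on bounded sets in $W\times[0,\infty)$; (A5) for some (fixed) $s>0$, $\|u_t\|=O(t^s)$ as $t\to\infty$ uniformly in $u$ on bounded sets. A potential operator is $p\in C(W,W^* )$ that is the Fréchet derivative of some $P\in C^1(W,\mathbb{R})$ (its potential, normalized by $P(0)=0$). A scaled operator is an odd potential operator $A_s$ that maps bounded sets into bounded sets and satisfies $A_s(u_t)v_t=t^sA_s(u)v$ for all $u,v\in W$, $t\ge0$. Given are scaled operators $A_s,B_s$ with potentials $I_s(u)=\int_0^1A_s(\tau u)u\,d\tau$, $J_s(u)=\int_0^1B_s(\tau u)u\,d\tau$, and odd potential operators $f,g\in C(W,W^* )$ with potentials $F(u)=\int_0^1f(\tau u)u\,d\tau$, $G(u)=\int_0^1g(\tau u)u\,d\tau$, satisfying: (A6) $A_s(u)u>0$ for $u\ne0$; (A7) every sequence with $u_j\rightharpoonup u$ and $A_s(u_j)(u_j-u)\to0$ has a subsequence converging strongly to $u$; (A8) $B_s(u)u>0$ for $u\neq0$; (A9) $u_j\rightharpoonup u$ implies $B_s(u_j)\to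 B_s(u)$ in $W^*$; (A10) $I_s(u)\to\infty$ as $\|u\|\to\infty$; (A11) every solution of $A_s(u)=\lambda B_s(u)$ ($\lambda\in\mathbb{R}$) satisfies $I_s(u)=\lambda J_s(u)$; (H1) for some $r>s>q>0$, $f(u_t)v_t=t^qf(u)v$ and $g(u_t)v_t=t^rg(u)v$ for all $u,v\in W$, $t\ge0$; (H2) $u_j\rightharpoonup u$ implies $f(u_j)\to f(u)$ and $g(u_j)\to g(u)$ in $W^*$ (in particular $f,g$ map bounded sets into bounded sets); (H3) for all $\alpha,\beta,\gamma,\delta\in\mathbb{R}$, every solution of $\alpha A_s(u)=\beta B_s(u)+\gamma f(u)+\delta g(u)$ satisfies $s\alpha I_s(u)=s\beta J_s(u)+q\gamma F(u)+r\delta G(u)$. Notation. $\Phi_\lambda(u)=I_s(u)-\lambda J_s(u)-F(u)-G(u)$ on $W$. For $c\in\mathbb{R}$, $\lambda_c(u)=\dfrac{I_s(u)-F(u)-G(u)-c}{J_s(u)}$ on $W\setminus\{0\}$ (note $J_s>0$ there). $\mathcal{M}_s=\{u\in W:I_s(u)=1\}$. The scaled Nehari set is $\mathcal{N}_c=\{u_t:u\in\mathcal{M}_s,\ t>0,\ \varphi_{c,u}'(t)=0\}$ with $\varphi_{c,u}(t)=\lambda_c(u_t)$; equivalently $\mathcal{N}_c=\{u\in W\setminus\{0\}:(s-q)F(u)-(r-s)G(u)+cs=0\}$. $h(u)=(s-q)f(u)-(r-s)g(u)$. $\Lambda_c=\lambda_c|_{\mathcal{N}_c}$. $i(M)$ is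 the Fadell–Rabinowitz $\mathbb{Z}_2$-cohomological index of a symmetric ($M=-M$) set $M\subset W\setminus\{0\}$: $i(\emptyset)=0$, and for $M\neq\emptyset$, with $\overline M=M/\{u\sim-u\}$, classifying map $\theta:\overline M\to\mathbb{RP}^\infty$ of $M\to\overline M$, and $\omega$ the generator of $H^1(\mathbb{RP}^\infty;\mathbb{Z}_2)$, $i(M)=\sup\{m\ge1:\theta^*(\omega^{m-1})\neq0\}$ (Alexander–Spanier cohomology, $\mathbb{Z}_2$ coefficients). For $k\ge1$, $$\lambda_k=\inf\Big\{\sup_{u\in M}\tfrac{1}{J_s(u)}: M\subset\mathcal{M}_s\text{ symmetric},\ i(M)\ge k\Big\},\qquad \lambda_{c,k}=\inf\Big\{\sup_{u\in M}\Lambda_c(u): M\subset\mathcal{N}_c\text{ symmetric},\ i(M)\ge k\Big\}.$$ $a_k\nearrow a$ means $(a_k)$ is nondecreasing with limit $a$ (possibly $\infty$). ''Decreasing'' means strictly decreasing.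
   Formalization: The space W is additionally assumed infinite-dimensional; in finite dimension n no symmetric set in W∖{0} has index above n, so λ_{c,k} is not a real number for k > n and the claim fails. *)

(* Defs.v *)
From HB Require Import structures.
From mathcomp Require Import all_boot all_order all_algebra.
From mathcomp Require Import all_classical all_reals all_analysis.
Import Order.TTheory GRing.Theory Num.Theory.
Import numFieldNormedType.Exports.

Set Implicit Arguments.
Unset Strict Implicit.
Unset Printing Implicit Defensive.

Local Open Scope classical_set_scope.
Local Open Scope ring_scope.
Local Open Scope quotient_scope.

Section dual.
Context {R : realType} {V : normedModType R}.

Definition cont_linear : {pred V -> R^o} :=
  fun f => `[< linear f /\ continuous f >].

Lemma cont_linearP (f : V -> R^o) :
  reflect (linear f /\ continuous f) (f \in cont_linear).
Proof. exact: asboolP. Qed.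

Lemma cont_linear_submod : submod_closed cont_linear.
Proof.
split.
  apply/cont_linearP; split; first by move=> a x y; rewrite /= scaler0 addr0.
  exact: cst_continuous.
move=> a f g /cont_linearP[lf cf] /cont_linearP[lg cg]; apply/cont_linearP.
split.
  move=> b x y /=; rewrite !fctE /= lf lg !scalerDr !scalerA (mulrC a b).
  by rewrite addrACA.
by move=> x; apply: cvgD; [apply: cvgZl_tmp; exact: cf | exact: cg].
Qed.

HB.instance Definition _ :=
  GRing.isSubmodClosed.Build R (V -> R^o) cont_linear cont_linear_submod.

End dual.
Arguments cont_linear {R} V.

Record dual (R : realType) (V : normedModType R) := Dual {
  dual_fun :> V -> R^o;
  dual_funP : dual_fun \in cont_linear V }.

Section dual_norm.
Context {R : realType} {V : normedModType R}.

HB.instance Definition _ := [isSub of dual V for @dual_fun R V].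
HB.instance Definition _ := [Choice of dual V by <:].
HB.instance Definition _ := [SubChoice_isSubLmodule of dual V by <:].

Implicit Types f g : dual V.

Definition dual_norm f : R := sup [set `|f x| | x in [set x | `|x| <= 1]].

Lemma dual_linear f : linear f.
Proof. by case/cont_linearP: (dual_funP f). Qed.

Lemma dual_continuous f : continuous f.
Proof. by case/cont_linearP: (dual_funP f). Qed.

Let lin f : {linear V -> R^o} :=
  HB.pack (f : V -> R^o) (GRing.isLinear.Build _ _ _ _ _ (dual_linear f)).

Let dual0 f : f 0 = 0. Proof. exact: (linear0 (lin f)). Qed.

Let dualZ f a x : f (a *: x) = a * f x.
Proof. by have := dual_linear f a x 0; rewrite !addr0 dual0 addr0. Qed.

Lemma dual_norm_has_sup f : has_sup [set `|f x| | x in [set x | `|x| <= 1]].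
Proof.
split; first by exists `|f 0|, 0 => //=; rewrite normr0 ler01.
have /bounded_funP/(_ 1)[M fM] : bounded_near (lin f) (nbhs (0 : V)).
  by apply: continuous_linear_bounded; exact: dual_continuous.
by exists M => _ [x /= x1 <-]; exact: fM.
Qed.

Lemma dual_norm_ub f x : `|x| <= 1 -> `|f x| <= dual_norm f.
Proof.
move=> x1; apply: ub_le_sup; first by case: (dual_norm_has_sup f).
by exists x.
Qed.

Lemma dual_norm_le f M :
  (forall x, `|x| <= 1 -> `|f x| <= M) -> dual_norm f <= M.
Proof.
move=> fM; apply: ge_sup; first by case: (dual_norm_has_sup f).
by move=> _ [x /= x1 <-]; exact: fM.
Qed.

Lemma dual_normD f g : dual_norm (f + g) <= dual_norm f + dual_norm g.
Proof.
apply: dual_norm_le => x x1; rewrite (le_trans (ler_normD _ _))//.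
by apply: lerD; exact: dual_norm_ub.
Qed.

Let dual_normZ_le (a : R) f : dual_norm (a *: f) <= `|a| * dual_norm f.
Proof.
apply: dual_norm_le => x x1; rewrite [X in `|X|](_ : _ = a * f x)// normrM.
by rewrite ler_wpM2l// dual_norm_ub.
Qed.

Let dual_norm0 : dual_norm 0 = 0.
Proof.
apply/eqP; rewrite eq_le; apply/andP; split.
  by apply: dual_norm_le => x _; rewrite normr0.
by rewrite -(@normr0 R R^o); apply: (@dual_norm_ub 0 0); rewrite normr0.
Qed.

Lemma dual_normZ (a : R) f : dual_norm (a *: f) = `|a| * dual_norm f.
Proof.
apply/eqP; rewrite eq_le dual_normZ_le /=.
have [->|a0] := eqVneq a 0; first by rewrite normr0 mul0r scale0r dual_norm0.
rewrite -{1}(scale1r f) -(mulVf a0) -scalerA.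
apply: le_trans (ler_wpM2l (normr_ge0 _) (dual_normZ_le _ _)) _.
by rewrite mulrA -normrM mulfV// normr1 mul1r.
Qed.

Lemma dual_norm0_eq0 f : dual_norm f = 0 -> f = 0.
Proof.
move=> f0; apply/val_inj/funext => x /=.
have [->|x0] := eqVneq x 0; first exact: dual0.
have nx : `|x| != 0 by rewrite normr_eq0.
have : `|f (`|x|^-1 *: x)| <= 0.
  by rewrite -f0; apply: dual_norm_ub; rewrite normrZ normfV normr_id mulVf.
rewrite normr_le0 dualZ mulf_eq0 invr_eq0 (negbTE nx) /=.
by move/eqP.
Qed.

HB.instance Definition _ := @Lmodule_isNormed.Build R (dual V)
  dual_norm dual_normD dual_normZ dual_norm0_eq0.

End dual_norm.

Section banach.
Context {R : realType}.

Definition weak_cvg {V : normedModType R} (u_ : nat -> V) (u : V) :=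
  forall l : dual V, l (u_ j) @[j --> \oo] --> l u.

Definition reflexive_space (V : normedModType R) :=
  forall xi : dual (dual V), exists x : V, forall l : dual V, xi l = l x.

Definition infinite_dimensional (V : lmodType R) :=
  forall n (b : 'I_n -> V), exists x,
    forall a : 'I_n -> R, x != \sum_(i < n) a i *: b i.

Definition critical_point {V : normedModType R} (Phi : V -> R^o) (u : V) :=
  is_diff u Phi (cst 0).

End banach.

Section alexander_spanier.
Context {X : topologicalType}.

Definition cochain n := ('I_n.+1 -> X) -> 'F_2.

(* The Alexander-Spanier complex is the complex of all cochains modulo the
   subcomplex of the locally zero ones. *)
Definition locally_zero n (phi : cochain n) :=
  forall x : X, exists2 U : set X, nbhs x U &
    forall sigma, (forall i, U (sigma i)) -> phi sigma = 0.

Definition coboundary n (phi : cochain n) : cochain n.+1 :=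
  fun sigma => \sum_(i < n.+2) (-1) ^+ i * phi (fun j => sigma (lift i j)).

Definition cocycle n (phi : cochain n) := locally_zero (coboundary phi).

(* The class of a cocycle vanishes in the n-th (unreduced) cohomology group. *)
Definition null_class n : cochain n -> Prop :=
  match n with
  | 0 => fun phi => locally_zero phi
  | m.+1 => fun phi => exists psi : cochain m,
      locally_zero (fun sigma => phi sigma - coboundary psi sigma)
  end.

Definition cup p q (phi : cochain p) (psi : cochain q) : cochain (p + q)%N :=
  fun sigma => phi (fun i => sigma (inord i)) *
               psi (fun j => sigma (inord (p + j)%N)).

Fixpoint cup_power (w : cochain 1) m : cochain m :=
  match m with
  | 0 => fun=> 1
  | m'.+1 => cup w (@cup_power w m')
  end.

Definition generator1 (w : cochain 1) := cocycle w /\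
  forall z : cochain 1, cocycle z -> exists a : 'F_2,
    null_class (n := 1) (fun sigma => z sigma - a * w sigma).

End alexander_spanier.
Arguments cochain : clear implicits.
Arguments cup_power {X} w m.

Definition pullback (X Y : topologicalType) (theta : X -> Y) n
  (phi : cochain Y n) : cochain X n := fun sigma => phi (theta \o sigma).

Section antipodal.
Context {R : numDomainType} {E : preTopologicalLmodType R} (M : set E).

Definition antipodal : rel (set_type M) :=
  fun x y => (set_val x == set_val y) || (set_val x == - set_val y).

Lemma antipodal_refl : reflexive antipodal.
Proof. by move=> x; rewrite /antipodal eqxx. Qed.

Lemma antipodal_sym : symmetric antipodal.
Proof.
move=> x y; rewrite /antipodal (eq_sym (set_val x) (set_val y)).
by rewrite -eqr_oppLR (eq_sym (- set_val x)).
Qed.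

Lemma antipodal_trans : transitive antipodal.
Proof.
by move=> y x z; rewrite /antipodal => /orP[]/eqP-> /orP[]/eqP->;
  rewrite ?opprK eqxx ?orbT.
Qed.

Canonical antipodal_equiv :=
  EquivRel antipodal antipodal_refl antipodal_sym antipodal_trans.

Definition projectivization := quotient_topology {eq_quot antipodal_equiv}.

HB.instance Definition _ := Topological.on projectivization.
HB.instance Definition _ := Quotient.on projectivization.

End antipodal.

(* The space of finitely supported real sequences, i.e. of polynomials, with
   the colimit topology along R^0 -> R^1 -> R^2 -> ... *)
Definition Rinfty (R : realType) : Type := {poly R}.

Section Rinfty.
Context {R : realType}.

HB.instance Definition _ := GRing.Lmodule.on (Rinfty R).

Definition Rinfty_open (U : set (Rinfty R)) :=
  forall n, open [set x : 'rV[R]_n | U (rVpoly x)].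

Lemma Rinfty_openT : Rinfty_open setT.
Proof. by move=> n; exact: openT. Qed.

Lemma Rinfty_openI : setI_closed Rinfty_open.
Proof. by move=> A B oA oB n; apply: openI; [exact: oA | exact: oB]. Qed.

Lemma Rinfty_open_bigU (I : Type) (f : I -> set (Rinfty R)) :
  (forall i, Rinfty_open (f i)) -> Rinfty_open (\bigcup_i f i).
Proof.
move=> of_ n.
rewrite (_ : [set x | _] = \bigcup_i [set x : 'rV[R]_n | f i (rVpoly x)]).
  by apply: bigcup_open => i _; exact: of_.
by apply/seteqP; split=> x [i _ fi]; exists i.
Qed.

HB.instance Definition _ := @isOpenTopological.Build (Rinfty R)
  Rinfty_open Rinfty_openT Rinfty_openI Rinfty_open_bigU.

End Rinfty.

Definition Sinfty (R : realType) : set (Rinfty R) :=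
  [set p : {poly R} | \sum_(i < size p) p`_i ^+ 2 = 1].
Arguments Sinfty R : clear implicits.

Definition RPinfty (R : realType) := projectivization (Sinfty R).

Section coh_index.
Context {R : realType} {E : preTopologicalLmodType R}.

Definition symmetric_set (M : set E) := forall u, M u -> M (- u).

(* theta classifies the double cover M -> projectivization M: it is covered by
   an odd map into the universal double cover Sinfty -> RPinfty. *)
Definition classifying (M : set E) (theta : projectivization M -> RPinfty R) :=
  continuous theta /\
  exists Theta : set_type M -> set_type (Sinfty R), [/\ continuous Theta,
    (forall x y, set_val y = - set_val x ->
      set_val (Theta y) = - set_val (Theta x)) &
    forall x, theta (\pi_(projectivization M) x) = \pi_(RPinfty R) (Theta x)].

(* Classifying maps are unique up to homotopy, so that the choice of theta,
   and of a representative w of the generator, is immaterial. *)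
Definition pullback_power_neq0 (M : set E) (m : nat) :=
  exists (theta : projectivization M -> RPinfty R) (w : cochain (RPinfty R) 1),
    [/\ classifying theta, generator1 w &
        ~ null_class (pullback theta (cup_power w m))].

Definition coh_index (M : set E) : \bar R :=
  if pselect (M = set0) then 0%E else
  ereal_sup [set (m%:R)%:E | m in
    [set m | (1 <= m)%N /\ pullback_power_neq0 M m.-1]].

End coh_index.

Section framework.
Context {R : realType} {W : completeNormedModType R}.

(* The scaling u_t is sc u t; only its values at t >= 0 are meaningful. *)
Record scaling (sc : W -> R -> W) (s : R) : Prop := Scaling {
  scaling_continuous :
    {within [set ut : W * R | 0 <= ut.2], continuous (fun ut => sc ut.1 ut.2)};
  scalingM : forall u t1 t2, 0 <= t1 -> 0 <= t2 ->
    sc (sc u t1) t2 = sc u (t1 * t2);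
  scalingZ : forall u (tau t : R), 0 <= t -> sc (tau *: u) t = tau *: sc u t;
  scaling0 : forall u, sc u 0 = 0;
  scaling1 : forall u, sc u 1 = u;
  scaling_bounded : forall D : set (W * R^o)%type, bounded_set D ->
    D `<=` [set ut | 0 <= ut.2] -> bounded_set [set sc ut.1 ut.2 | ut in D];
  scaling_growth_gt0 : 0 < s;
  scaling_growth : forall B : set W, bounded_set B -> exists C : R,
    \forall t \near +oo, forall u, B u -> `|sc u t| <= C * t `^ s }.

Definition potential_operator (p : W -> dual W) := continuous p /\
  exists P : W -> R^o, forall u, is_diff u P (p u).

Definition potential (p : W -> dual W) (u : W) : R :=
  \int[lebesgue_measure]_(tau in `[0, 1]) (p (tau *: u) u : R).

Definition odd_operator (p : W -> dual W) := forall u, p (- u) = - p u.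

Definition homogeneous (sc : W -> R -> W) (d : R) (p : W -> dual W) :=
  forall u v t, 0 <= t -> p (sc u t) (sc v t) = t `^ d * p u v.

Definition scaled_operator (sc : W -> R -> W) (s : R) (p : W -> dual W) :=
  [/\ potential_operator p, odd_operator p,
      (forall B : set W, bounded_set B -> bounded_set (p @` B)) &
      homogeneous sc s p].

Definition weak_to_strong (p : W -> dual W) :=
  forall (u_ : nat -> W) u, weak_cvg u_ u -> p (u_ j) @[j --> \oo] --> p u.

Definition palais_smale_type (p : W -> dual W) :=
  forall (u_ : nat -> W) u, weak_cvg u_ u ->
    p (u_ j) (u_ j - u) @[j --> \oo] --> (0 : R) ->
    exists2 e : nat -> nat, {homo e : i j / (i < j)%N} &
      u_ (e j) @[j --> \oo] --> u.

Record scaled_pair (sc : W -> R -> W) (s : R) (A B : W -> dual W) : Prop :=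
  ScaledPair {
  pair_A : scaled_operator sc s A;
  pair_B : scaled_operator sc s B;
  pair_A_gt0 : forall u, u != 0 -> 0 < A u u;
  pair_A_compact : palais_smale_type A;
  pair_B_gt0 : forall u, u != 0 -> 0 < B u u;
  pair_B_weak : weak_to_strong B;
  pair_coercive : forall K : R, exists rho : R, forall u,
    rho <= `|u| -> K <= potential A u;
  pair_eigen : forall (lambda : R) u, A u = lambda *: B u ->
    potential A u = lambda * potential B u }.

Record perturbations (sc : W -> R -> W) (q s r : R) (A B f g : W -> dual W)
  : Prop := Perturbations {
  pert_f : potential_operator f /\ odd_operator f;
  pert_g : potential_operator g /\ odd_operator g;
  pert_degrees : [/\ 0 < q, q < s & s < r];
  pert_f_homogeneous : homogeneous sc q f;
  pert_g_homogeneous : homogeneous sc r g;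
  pert_f_weak : weak_to_strong f;
  pert_g_weak : weak_to_strong g;
  pert_identity : forall (alpha beta gamma delta : R) u,
    alpha *: A u = beta *: B u + gamma *: f u + delta *: g u ->
    s * alpha * potential A u = s * beta * potential B u +
      q * gamma * potential f u + r * delta * potential g u }.

Section functionals.
Variables (sc : W -> R -> W) (A B f g : W -> dual W).

Definition Phi (lambda : R) (u : W) : R :=
  potential A u - lambda * potential B u - potential f u - potential g u.

(* The denominator vanishes at u = 0, where the value is meaningless. *)
Definition lambda_fun (c : R) (u : W) : R :=
  (potential A u - potential f u - potential g u - c) / potential B u.

Definition Ms : set W := [set u | potential A u = 1].

Definition nehari (c : R) : set W :=
  [set v | exists (u : W) (t : R), [/\ Ms u, 0 < t,
    is_derive t 1 (fun t' : R => lambda_fun c (sc u t') : R^o) 0 &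
    v = sc u t]].

Definition minimax (S : set W) (Psi : W -> R) (k : nat) : \bar R :=
  ereal_inf [set ereal_sup [set (Psi u)%:E | u in M] | M in
    [set M : set W | [/\ M `<=` S, symmetric_set M &
                        ((k%:R)%:E <= coh_index M)%E]]].

Definition lambda_k (k : nat) : \bar R :=
  minimax Ms (fun u => (potential B u)^-1) k.

Definition lambda_ck (c : R) (k : nat) : \bar R :=
  minimax (nehari c) (lambda_fun c) k.

End functionals.

Definition h_op (q s r : R) (f g : W -> dual W) (u : W) : dual W :=
  (s - q) *: f u - (r - s) *: g u.

End framework.

(* Main.v *)
(* Since F = 0, only G perturbs the eigenvalue problem. The power Gam = G^(s/r) has the degree of
   homogeneity s of I and J, so that Psi K = (I - K Gam) / J is constant along the scaling. The Nehari
   set is {G = kap c}, on which lambda_c = Psi (Kc c), where Kc c is a multiple of c^(1 - s/r). Scaling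
   is odd and identifies the Nehari set with Ms; hence lambda_(c,k) is the minimax level of Psi (Kc c)
   on Ms, and lambda_k is the one of Psi 0. These levels are finite and unbounded in k, because the
   compactness of B maps sublevel sets of Psi K to punctured spaces R^n by odd maps; as functions of K
   they are locally Lipschitz, strictly decreasing and tend to -oo. They are critical values by a
   deformation argument, in which small steps are iterated up to the limit instead of solving a
   differential equation. A critical point of Psi (Kc c), scaled to G = kap c, is critical for lambda_c
   and for Phi. For (iii), lambda_(c,k) = lambda is solved for c by the intermediate value theorem.

   The index enters through two facts. It is at most n on a set with an odd map to R^n minus 0: the
   class of the double cover is represented by cocycles vanishing on the sets {i-th component <> 0},
   so that the product of n of them vanishes. It is at least k on odd images of the sphere of R^k: the
   power k - 1 of the class takes the value 1 on a triangulated hemisphere, whereas a coboundary takes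
   the value 0. Both need an explicit generator of H^1 of RP^oo, whose uniqueness is proved by
   computing holonomies along paths in the infinite sphere. *)
Require Import Defs.
From HB Require Import structures.
From mathcomp Require Import all_boot all_order all_algebra.
From mathcomp Require Import all_classical all_reals all_analysis.
From mathcomp Require Import ring lra.
Import Order.TTheory GRing.Theory Num.Theory.
Import numFieldNormedType.Exports.

Set Implicit Arguments.
Unset Strict Implicit.
Unset Printing Implicit Defensive.

Local Open Scope classical_set_scope.
Local Open Scope ring_scope.

(** * Cochains modulo 2 *)

(** For c > 0 the line x + c is tangent at x = [kap c] to the strictly concave graph of [Kc c]
    x^(s/r). With x = G(u) this gives lambda_c <= [Psi (Kc c)] away from 0, with equality exactly on
    the Nehari set. So [Psi (Kc c)] is the maximum of lambda_c along each fibre, and on the Nehari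
    set the two functionals have the same differential. The gain is a fixed domain: the Nehari set
    moves with c, while [Psi K] is studied on [Ms] and depends on c through one number.

    Three obstacles shape the rest. [W] has no inner product and [Ms] no tangent spaces at hand, so
    deformations run in [W] near [Ms]; scale invariance of [Psi K] allows the return to [Ms] at no
    cost. Smallness of the differential is only tested on countably many vectors in the Palais-Smale
    argument, so that, away from critical points, finitely many fixed directions suffice to descend.
    Finally, the index refers to a classifying map, so that a set can be compared with others only
    if it comes with one; competitors are therefore whole sublevel sets, which have odd maps into a
    punctured R^n. *)

Lemma addF2 (a : 'F_2) : a + a = 0.
Proof. exact: (addrr_pchar2 (pchar_Fp (isT : prime 2))). Qed.

Lemma oppF2 (a : 'F_2) : - a = a.
Proof. exact: (oppr_pchar2 (pchar_Fp (isT : prime 2))). Qed.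

Lemma addF2_eq0 (a b : 'F_2) : a + b = 0 -> a = b.
Proof. by move/eqP; rewrite addr_eq0 oppF2 => /eqP. Qed.

Lemma addF2K (a b : 'F_2) : a + (a + b) = b.
Proof. by rewrite addrA addF2 add0r. Qed.

Lemma addF2_shift (a b c : 'F_2) : a + b = c -> a = c + b.
Proof. by move=> <-; rewrite -addrA addF2 addr0. Qed.

Lemma F2_cases (a : 'F_2) : a = 0 \/ a = 1.
Proof. by case: a => [[|[|//]] ?]; [left|right]; apply/val_inj. Qed.

Ltac f2 := repeat match goal with x : _ |- _ =>
  lazymatch type of x with ?T => unify T (Equality.sort 'F_2) end;
  case: (F2_cases x) => ->; clear x end; exact/eqP.

Section list_cochains.
Context {X : Type}.
Implicit Types (phi psi : seq X -> 'F_2) (s t : seq X).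

(* The coboundary mod 2 of cochains on lists: the first summand deletes the head, the second one
   deletes entries of the tail. *)
Fixpoint dl phi s : 'F_2 :=
  if s is x :: s' then phi s' + dl (fun t => phi (x :: t)) s' else 0.

Lemma dlD phi psi s : dl (fun t => phi t + psi t) s = dl phi s + dl psi s.
Proof.
elim: s phi psi => /= [|x s IH] phi psi; first by rewrite addr0.
by rewrite IH addrACA.
Qed.

Lemma dlZ a phi s : dl (fun t => a * phi t) s = a * dl phi s.
Proof.
by elim: s phi => /= [|x s IH] phi; rewrite ?mulr0// IH mulrDr.
Qed.

Lemma dl0 s : dl (fun=> 0) s = 0.
Proof. by elim: s => //= x s ->; rewrite addr0. Qed.

Fixpoint alls (P : set X) s : Prop :=
  if s is x :: s' then P x /\ alls P s' else True.

Lemma sub_alls (P Q : set X) s : P `<=` Q -> alls P s -> alls Q s.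
Proof. by move=> PQ; elim: s => //= x s IH [/PQ ? /IH]. Qed.

Definition cup1 (a : X -> X -> 'F_2) phi s : 'F_2 :=
  if s is x :: ((y :: _) as s') then a x y * phi s' else 0.

Definition cup0 (c : X -> 'F_2) phi s : 'F_2 :=
  if s is x :: _ then c x * phi s else 0.

(** The Leibniz rule. The sum in parentheses is the coboundary of [a] on the front triangle, left
    explicit so that it drops out wherever [a] is a cocycle. *)
Lemma dl_cup1 a phi x y w s : dl (cup1 a phi) [:: x, y, w & s] =
  (a x y + a x w + a y w) * phi (w :: s) + a x y * dl phi [:: y, w & s].
Proof.
rewrite /= (dlZ (a x y) (fun t => phi (y :: w :: t))).
move: (a x y) (a x w) (a y w) (phi (w :: s)) (phi (y :: s)) (dl _ _).
move=> b c d e f g; f2.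
Qed.

Lemma dl_cup0 c phi x y s : dl (cup0 c phi) [:: x, y & s] =
  (c x + c y) * phi (y :: s) + c x * dl phi [:: x, y & s].
Proof.
rewrite /= (dlZ (c x) (fun t => phi (x :: y :: t))).
move: (c x) (c y) (phi _) (phi (x :: s)) (dl _ _) => b d e f g; f2.
Qed.

(* The factors [z x y + c x + c y] are [z + d c], all homologous to [z]. *)
Fixpoint cprod (z : X -> X -> 'F_2) (cs : seq (X -> 'F_2)) : seq X -> 'F_2 :=
  if cs is c :: cs' then cup1 (fun x y => z x y + c x + c y) (cprod z cs')
  else fun=> 1.

End list_cochains.

Section prism.
Context {X Y : Type} (H H' : X -> Y).
Implicit Types (phi : seq Y -> 'F_2).

(** The usual prism decomposition: the sum over i of [phi] on H x_0, ..., H x_i, H' x_i, ..., H'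
    x_n. *)
Fixpoint prism phi (s : seq X) : 'F_2 :=
  if s is x :: s' then
    phi (H x :: H' x :: map H' s') + prism (fun t => phi (H x :: t)) s'
  else 0.

Lemma prismD phi psi s :
  prism (fun t => phi t + psi t) s = prism phi s + prism psi s.
Proof.
elim: s phi psi => /= [|x s IH] phi psi; first by rewrite addr0.
by rewrite IH addrACA.
Qed.

Lemma dl_map (f : X -> Y) phi s : dl phi (map f s) = dl (phi \o map f) s.
Proof. by elim: s phi => //= x s IH phi; rewrite IH. Qed.

Lemma prism_dl phi s : prism (dl phi) s + dl (prism phi) s =
  phi (map H' s) + phi (map H s).
Proof.
elim: s phi => /= [|x s IH] phi; first by rewrite !addF2.
rewrite (prismD phi (fun t => dl (fun t' => phi (H x :: t')) t)).
rewrite (dlD (fun t => phi [:: H x, H' x & map H' t])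
             (prism (fun t => phi (H x :: t)))).
rewrite (dl_map H' (fun t => phi [:: H x, H' x & t])).
have /addF2_shift -> := IH (fun t => phi (H x :: t)).
rewrite [X in _ + (_ + (dl X _ + _))](_ : _ = (fun t => phi (H x :: H' x :: t)) \o map H') //.
move: (prism _ _) (dl _ s) (dl _ s)  => b c d.
move: (phi _) (phi _) (phi _) => f g h; f2.
Qed.

End prism.

Section cup_products.
Context {X : Type}.
Implicit Types (z : X -> X -> 'F_2) (U : set X).

Definition cocycle_on z U := forall a b c, U a -> U b -> U c ->
  z a b + z a c + z b c = 0.

Lemma cocycle_onD z U (c : X -> 'F_2) : cocycle_on z U ->
  cocycle_on (fun x y => z x y + c x + c y) U.
Proof.
move=> zU x y w Ux Uy Uw; rewrite -(zU x y w)//.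
by move: (z _ _) (z _ _) (z _ _) (c _) (c _) (c _) => *; f2.
Qed.

Lemma cprod_closed z U cs s : cocycle_on z U -> size s = (size cs).+2 ->
  alls U s -> dl (cprod z cs) s = 0.
Proof.
move=> zU; elim: cs s => [|c cs IH] s.
  by case: s => [|x [|y []]]//= _ _; rewrite addr0 addF2.
case: s => [|x [|y [|w s]]]// [ss] Us.
rewrite dl_cup1 (cocycle_onD c zU)/=; [|by case: Us|by case: Us=>_[]|by case: Us=>_[_[]]].
rewrite mul0r add0r; have /= -> := IH [:: y, w & s]; first by rewrite mulr0.
  by rewrite /= ss.
by case: Us.
Qed.

(** The factors are exchanged one at a time: [cup0] pays for the first one, and [cup1] passes on the
    cochain found for the others. [eta] is chosen before [U], so that a single cochain serves all
    members of a cover on which [z] is a cocycle. *)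
Lemma cprod_homologous z cs cs' : size cs = size cs' -> exists eta, forall U,
  cocycle_on z U -> forall s, size s = (size cs).+1 -> alls U s ->
  cprod z cs s + cprod z cs' s = dl eta s.
Proof.
elim: cs cs' => [|c cs IH] [|c' cs']// => [_|[ss]].
  by exists (fun=> 0) => U _ s _ _; rewrite dl0 addF2.
pose a x y := z x y + c' x + c' y; pose P := cprod z cs.
have [eta etaP] := IH _ ss.
exists (fun s => cup0 (fun x => c x + c' x) P s + cup1 a eta s) => U zU.
case=> [|x [|y s]]// [sE] Us; rewrite dlD dl_cup0.
rewrite (cprod_closed zU) ?mulr0 ?addr0//=; last by rewrite sE.
have [Ux [Uy Us']] := Us.
transitivity ((c x + c' x + (c y + c' y)) * P (y :: s) +
  a x y * (P (y :: s) + cprod z cs' (y :: s))).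
  rewrite /a /= -/P; move: (P _) (cprod _ _ _) (z _ _) (c _) (c _) (c' _) (c' _).
  by move=> *; f2.
congr (_ + _); rewrite (etaP U)//=; last by rewrite sE.
(* A list of two points is too short for [dl_cup1]. In this case [cs] is empty, and [etaP] makes
   [eta] vanish on the empty list. *)
case: s sE Us Us' => [|w s] sE Us Us'.
  rewrite /= !addr0; case: cs IH ss @P etaP sE => // _ /esym/size0nil-> _ etaP _.
  by have := etaP U zU [:: y] erefl; rewrite /= addF2 addr0 => <-//; rewrite mulr0.
rewrite -[RHS]/(dl (cup1 a eta) [:: x, y, w & s]) dl_cup1.
by rewrite (cocycle_onD c' zU) ?mul0r ?add0r//; case: Us'.
Qed.

End cup_products.

Section tuples.
Context {X : Type}.

Definition tl n (sigma : 'I_n -> X) : seq X := [seq sigma i | i <- enum 'I_n].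

Lemma tlS n (sigma : 'I_n.+1 -> X) :
  tl sigma = sigma ord0 :: tl (fun i => sigma (lift ord0 i)).
Proof. by rewrite /tl enum_ordSl /= -map_comp. Qed.

Lemma size_tl n (sigma : 'I_n -> X) : size (tl sigma) = n.
Proof. by rewrite size_map size_enum_ord. Qed.

Lemma nth_tl x0 n (sigma : 'I_n -> X) (i : 'I_n) : nth x0 (tl sigma) i = sigma i.
Proof. by rewrite (nth_map i) ?size_enum_ord// nth_ord_enum. Qed.

Lemma tl_nth x0 s n : size s = n -> tl (fun i : 'I_n => nth x0 s i) = s.
Proof.
move=> <-; apply: (@eq_from_nth _ x0); first by rewrite size_tl.
by move=> i; rewrite size_tl => ilt; rewrite (nth_tl x0 _ (Ordinal ilt)).
Qed.

Lemma alls_tl (U : set X) n (sigma : 'I_n -> X) :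
  (forall i, U (sigma i)) -> alls U (tl sigma).
Proof. by elim: n sigma => [|n IH] sigma US; rewrite ?/tl ?enum_ord0// -/(tl _) tlS /=; split => //; exact: IH. Qed.

Lemma alls_nth (U : set X) s x0 i : alls U s -> (i < size s)%N -> U (nth x0 s i).
Proof. by elim: s i => // x s IH [|i] [Ux Us]//=; exact: IH. Qed.

Lemma dl_sum (phi : seq X -> 'F_2) n (sigma : 'I_n.+1 -> X) :
  dl phi (tl sigma) = \sum_(i < n.+1) phi (tl (fun j => sigma (lift i j))).
Proof.
elim: n phi sigma => [|n IH] phi sigma.
  by rewrite tlS big_ord1 /= /tl enum_ord0 /= addr0.
rewrite tlS /= IH [RHS]big_ord_recl; apply: f_equal; apply: eq_bigr => i _.
rewrite [in RHS]tlS; congr (phi (sigma _ :: _)); first exact: val_inj.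
apply: f_equal; apply/funext => j; congr sigma; apply: val_inj.
by rewrite /= /bump !leq0n !add1n ltnS addnS.
Qed.

(** The head of the list is the default value of [nth], so that no point of [X] has to be
    supplied. *)
Definition lcochain n (phi : ('I_n -> X) -> 'F_2) : seq X -> 'F_2 :=
  fun s => if s is x0 :: _ then phi (fun i => nth x0 s i) else 0.

Lemma lcochain_tl n (phi : ('I_n.+1 -> X) -> 'F_2) sigma :
  lcochain phi (tl sigma) = phi sigma.
Proof.
have -> : tl sigma = sigma ord0 :: behead (tl sigma) by rewrite tlS.
rewrite /lcochain; congr phi; apply/funext => i.
by rewrite -[RHS](nth_tl (sigma ord0)) [in RHS]tlS [in LHS]tlS.
Qed.

End tuples.

Section cochain_lists.
Context {X : topologicalType}.

Definition cochain2 (w : cochain X 1) (x y : X) : 'F_2 :=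
  w (fun i : 'I_2 => if i == ord0 then x else y).

Lemma coboundary_lcochain n (psi : cochain X n) sigma :
  coboundary psi sigma = dl (lcochain psi) (tl sigma).
Proof.
rewrite dl_sum; apply: eq_bigr => i _; rewrite oppF2 expr1n mul1r.
by rewrite lcochain_tl.
Qed.

Lemma cup_power_cprod (w : cochain X 1) m (sigma : 'I_m.+1 -> X) :
  cup_power w m sigma = cprod (cochain2 w) (nseq m (fun=> 0)) (tl sigma).
Proof.
elim: m sigma => [|m IH] sigma; first by rewrite tlS.
rewrite tlS tlS /= !addr0 /cup IH /cochain2; congr (w _ * _).
  apply/funext => i; case: (unliftP ord0 i) => [j ->|->]; rewrite ?ord1 /=;
    by congr sigma; apply: val_inj; rewrite /= inordK.
rewrite -(tlS (fun i => sigma (lift ord0 i))).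
congr cprod; apply: f_equal; apply/funext => i; congr sigma.
by apply: val_inj; rewrite /= inordK// ltnS add1n.
Qed.

Lemma cocycle2P (w : cochain X 1) : cocycle w <->
  forall x : X, exists2 U : set X, nbhs x U & cocycle_on (cochain2 w) U.
Proof.
have wE a b c : coboundary w (tnth [tuple a; b; c]) =
    cochain2 w a b + cochain2 w a c + cochain2 w b c.
  rewrite coboundary_lcochain.
  have -> : tl (tnth [tuple a; b; c]) = [:: a; b; c].
    by rewrite /tl !enum_ordSl enum_ord0.
  rewrite /= !addr0 /cochain2.
  suff e x y : w (fun i => nth x [:: x; y] i) = w (fun i : 'I_2 => if i == ord0 then x else y).
    by rewrite !e; move: (w _) (w _) (w _) => *; f2.
  by congr w; apply/funext; case=> [[|[|//]]].
split=> + x => /(_ x)[U Ux wU]; exists U => //.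
  move=> a b c Ua Ub Uc; rewrite -wE wU//.
  by case=> [[|[|[|//]]]].
move=> sigma Us.
have -> : sigma = tnth [tuple sigma (inord 0); sigma (inord 1); sigma (inord 2)].
  apply/funext; case=> [[|[|[|//]]]] ?; rewrite (tnth_nth (sigma (inord 0))) /=;
  by congr sigma; apply/val_inj; rewrite /= inordK.
by rewrite wE wU.
Qed.

Lemma null_class2P (phi : cochain X 1) : null_class (n := 1) phi <->
  exists c : X -> 'F_2, forall x : X, exists2 U : set X, nbhs x U &
    forall a b, U a -> U b -> cochain2 phi a b = c a + c b.
Proof.
split=> -[psi psiP].
  exists (fun x => psi (fun=> x)) => x; have [U Ux UP] := psiP x; exists U => //.
  move=> a b Ua Ub.
  have := UP (fun i : 'I_2 => if i == ord0 then a else b).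
  move/(_ _)/eqP; rewrite subr_eq0 => e; apply/eqP; rewrite /cochain2.
  rewrite (eqP (e _)); last by case=> -[|[|//]] ?.
  rewrite coboundary_lcochain.
  have -> : tl (fun i : 'I_2 => if i == ord0 then a else b) = [:: a; b].
    by rewrite /tl !enum_ordSl enum_ord0.
  rewrite /= addr0 addrC; apply/eqP; congr (psi _ + psi _);
  by apply/funext; case=> -[|//].
exists (fun s => psi (s ord0)) => x; have [U Ux UP] := psiP x; exists U => //.
move=> sigma Us; apply/eqP; rewrite subr_eq0; apply/eqP.
rewrite coboundary_lcochain.
have -> : tl sigma = [:: sigma ord0; sigma (lift ord0 ord0)].
  by rewrite tlS tlS /= /tl enum_ord0.
rewrite /= addr0 addrC -UP// /cochain2; congr phi; apply/funext => i.
by case: (unliftP ord0 i) => [j ->|->]; rewrite ?ord1.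
Qed.

Lemma null_powerP (w : cochain X 1) m : null_class (cup_power w m.+1) <->
  exists eta, forall x : X, exists2 U : set X, nbhs x U &
    forall s, size s = m.+2 -> alls U s ->
    cprod (cochain2 w) (nseq m.+1 (fun=> 0)) s = dl eta s.
Proof.
split=> -[psi psiP].
  exists (lcochain psi) => x; have [U Ux UP] := psiP x; exists U => //.
  case=> // x0 s ss Us.
  have := UP (fun i => nth x0 (x0 :: s) i).
  rewrite coboundary_lcochain cup_power_cprod tl_nth// => /(_ _)/eqP.
  rewrite subr_eq0 => e; apply/eqP/e => i; apply: alls_nth => //.
  by rewrite ss.
exists (fun s => psi (tl s)) => x; have [U Ux UP] := psiP x; exists U => //.
move=> sigma Us; apply/eqP; rewrite subr_eq0 cup_power_cprod; apply/eqP.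
rewrite UP ?size_tl//; last exact: alls_tl.
rewrite dl_sum; apply: eq_bigr => i _.
by rewrite oppF2 expr1n mul1r.
Qed.

End cochain_lists.

Lemma pullback_cup_power (X Y : topologicalType) (theta : X -> Y) w m :
  pullback theta (cup_power w m) = cup_power (pullback theta w) m.
Proof. by elim: m => // m IH; rewrite /= -IH. Qed.

(** * The class of the antipodal double cover *)

Lemma continuous_at_sum (K : numFieldType) (T : topologicalType)
    (V : normedModType K) I (r : seq I) (F : I -> T -> V) (x : T) :
  (forall i, {for x, continuous (F i)}) ->
  {for x, continuous (fun y => \sum_(i <- r) F i y)}.
Proof.
move=> cF; elim: r => [|i r IH].
  rewrite (_ : (fun _ => _) = fun=> 0); first exact: cst_continuous.
  by apply/funext => y; rewrite big_nil.
rewrite (_ : (fun _ => _) = fun y => F i y + \sum_(i <- r) F i y).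
  by apply: cvgD; [exact: cF | exact: IH].
by apply/funext => y; rewrite big_cons.
Qed.

Section inner.
Context {R : realType}.
Implicit Types p q r : {poly R}.

Definition ip p q : R := \sum_(i < size p) p`_i * q`_i.

Lemma ipE n p q : (size p <= n)%N -> ip p q = \sum_(i < n) p`_i * q`_i.
Proof.
move=> pn; rewrite /ip (big_ord_widen n (fun i => p`_i * q`_i))//.
rewrite [RHS](bigID (fun i : 'I_n => (i < size p)%N)) /= [X in _ = _ + X]big1 ?addr0//.
by move=> i; rewrite -leqNgt => pi; rewrite nth_default ?mul0r.
Qed.

Lemma ipC p q : ip p q = ip q p.
Proof.
rewrite (@ipE (maxn (size p) (size q)) p) ?leq_maxl//.
rewrite (@ipE (maxn (size p) (size q)) q) ?leq_maxr//.
by apply: eq_bigr => i _; rewrite mulrC.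
Qed.

Lemma ipDr p q r : ip p (q + r) = ip p q + ip p r.
Proof. by rewrite -big_split; apply: eq_bigr => i _; rewrite coefD mulrDr. Qed.

Lemma ipZr a p q : ip p (a *: q) = a * ip p q.
Proof. by rewrite mulr_sumr; apply: eq_bigr => i _; rewrite coefZ mulrCA. Qed.

Lemma ipNr p q : ip p (- q) = - ip p q.
Proof. by rewrite -scaleN1r ipZr mulN1r. Qed.

Lemma ipNl p q : ip (- p) q = - ip p q.
Proof. by rewrite ipC ipNr ipC. Qed.

Lemma ipDl p q r : ip (p + q) r = ip p r + ip q r.
Proof. by rewrite ipC ipDr !(ipC r). Qed.

Lemma ipZl a p q : ip (a *: p) q = a * ip p q.
Proof. by rewrite ipC ipZr ipC. Qed.

Lemma ip_ge0 p : 0 <= ip p p.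
Proof. by apply: sumr_ge0 => i _; rewrite -expr2 sqr_ge0. Qed.

Lemma ip_gt0 p : p != 0 -> 0 < ip p p.
Proof.
move=> p0; rewrite lt_neqAle ip_ge0 andbT eq_sym.
apply: contra p0 => /eqP e; rewrite -lead_coef_eq0.
have sp : (size p).-1 = (size p).-1 by [].
have [->|p0] := eqVneq p 0; first by rewrite lead_coef0.
have lt : ((size p).-1 < size p)%N by rewrite prednK// lt0n size_poly_eq0.
have := e; rewrite /ip (bigD1 (Ordinal lt))//= => /eqP.
rewrite paddr_eq0 -?expr2 ?sqr_ge0//; last first.
  by apply: sumr_ge0 => i _; rewrite -expr2 sqr_ge0.
by case/andP; rewrite sqrf_eq0.
Qed.

Lemma SinftyE p : Sinfty R p <-> ip p p = 1.
Proof. by rewrite /Sinfty /ip /=; under eq_bigr do rewrite expr2. Qed.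

(** Nonnegativity of |q + r - 2p|^2 gives ip q r >= 2 (ip p q + ip p r) - 3, which is positive once
    both terms exceed 3/4. This is the meaning of 3/4 in all neighbourhoods below: lifts that close
    to a common point form acute angles. *)
Lemma ip_close p q r : ip p p = 1 -> ip q q = 1 -> ip r r = 1 ->
  3/4 < ip p q -> 3/4 < ip p r -> 0 < ip q r.
Proof.
move=> pp qq rr pq pr; have := ip_ge0 (q + r + (-2) *: p).
rewrite !(ipDl,ipDr,ipZl,ipZr) pp qq rr (ipC q p) (ipC r p) (ipC r q).
move: (ip p q) (ip p r) (ip q r) pq pr => a b c; lra.
Qed.

(** A discontinuous choice of one point in each pair p, -p; all that matters is that the two get
    different values. *)
Definition sgn2 p : 'F_2 := if lead_coef p < 0 then 1 else 0.

Lemma sgn2N p : p != 0 -> sgn2 (- p) = sgn2 p + 1.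
Proof.
rewrite -lead_coef_eq0 /sgn2 lead_coefN oppr_lt0 => p0.
by case: ltgtP p0 => // _ _; apply/eqP.
Qed.

(* The class of the double cover: [sgn2 p + sgn2 q] for the lifts [p], [q]
   which form an acute angle. *)
Definition cc p q : 'F_2 :=
  if 0 < ip p q then sgn2 p + sgn2 q else
  if ip p q < 0 then sgn2 p + sgn2 q + 1 else 0.

Lemma ccNl p q : p != 0 -> cc (- p) q = cc p q.
Proof.
move=> p0; rewrite /cc ipNl oppr_gt0 oppr_lt0 sgn2N//.
by case: ltgtP => // _; move: (sgn2 _) (sgn2 _) => *; f2.
Qed.

Lemma ccC p q : cc p q = cc q p.
Proof. by rewrite /cc ipC (addrC (sgn2 p)). Qed.

Lemma ccNr p q : q != 0 -> cc p (- q) = cc p q.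
Proof. by move=> q0; rewrite ccC ccNl// ccC. Qed.

Lemma cc_acute p q : 0 < ip p q -> cc p q = sgn2 p + sgn2 q.
Proof. by rewrite /cc => ->. Qed.

Lemma S_neq0 (x : Sinfty R) : (set_val x : {poly R}) != 0.
Proof.
have /SinftyE : Sinfty R (set_val x) by exact: set_valP.
by case: eqP => // ->; rewrite /ip size_poly0 big_ord0 => /esym/eqP; rewrite oner_eq0.
Qed.

Lemma ip_S (x : Sinfty R) : ip (set_val x) (set_val x) = 1.
Proof. exact: (iffLR (SinftyE _) (set_valP x)). Qed.

Lemma coord_continuous n (i : 'I_n) : continuous (fun x : 'rV[R]_n => x 0 i).
Proof. exact: coord_continuous. Qed.

Lemma continuous_Rinfty (T : topologicalType) (f : Rinfty R -> T) :
  (forall n, continuous (fun x : 'rV[R]_n => f (rVpoly x))) -> continuous f.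
Proof.
move=> cf; apply/continuousP => A oA; rewrite /open /= => n.
by have /continuousP := cf n; apply.
Qed.

Lemma rVpoly_continuous n : continuous (rVpoly : 'rV[R]_n -> Rinfty R).
Proof. by apply/continuousP => A; exact. Qed.

Lemma continuous_ip p : continuous (ip p : Rinfty R -> R).
Proof.
apply: continuous_Rinfty => n.
have : forall i : 'I_(size p), continuous (fun x : 'rV[R]_n => p`_i * (rVpoly x)`_i).
  move=> i x.
  apply: (@continuousM R _ (fun=> p`_i) (fun y : 'rV[R]_n => (rVpoly y)`_i)).
    exact: cst_continuous.
  have [ni|ni] := leqP n i.
    have e (y : 'rV[R]_n) : (rVpoly y)`_i = 0.
      by rewrite nth_default// (leq_trans (size_poly _ _)).
    rewrite (_ : (fun _ => _) = (fun=> 0)); last by apply/funext => y; exact: e.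
    exact: cst_continuous.
  have e (y : 'rV[R]_n) : (rVpoly y)`_i = y 0 (Ordinal ni).
    by rewrite -coef_rVpoly_ord.
  rewrite (_ : (fun _ => _) = (fun y : 'rV[R]_n => y 0 (Ordinal ni))); last by apply/funext => y; exact: e.
  exact: coord_continuous.
move=> c; rewrite /ip => x.
have := @continuous_at_sum R 'rV[R]_n R _ (index_enum 'I_(size p)) (fun i (y : 'rV[R]_n) => p`_i * (rVpoly y)`_i) x (fun i => c i x).
exact.
Qed.

End inner.

Local Open Scope quotient_scope.

Section odd_maps.
Context {R : realType} {E : preTopologicalLmodType R} (M : set E).
Hypothesis symM : symmetric_set M.

Definition negS (x : M) : M :=
  exist _ (- set_val x) (mem_set (symM (set_valP x))).

Definition odd_on {E' : zmodType} (f : M -> E') :=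
  forall x y : M, set_val y = - set_val x -> f y = - f x.

Let P := projectivization M.

Lemma pi_eq (x y : M) : (\pi_P x = \pi_P y) <->
  (set_val x = set_val y \/ set_val y = - set_val x).
Proof.
split.
  move/(eqmodP (antipodal_equiv M)); rewrite /= /antipodal => /orP[/eqP->|/eqP->].
    by left.
  by right; rewrite opprK.
move=> e; apply/(eqmodP (antipodal_equiv M)); rewrite /= /antipodal.
by case: e => ->; rewrite ?opprK eqxx ?orbT.
Qed.

Lemma pi_surj (a : P) : exists x : M, \pi_P x = a.
Proof. by exists (repr a); rewrite reprK. Qed.

(** The image of [Q] is open because its preimage is the union of [Q] and its reflection. Negation
    need not be continuous on a pre-topological module, whence the assumption on the reflected
    set. *)
Lemma nbhs_pi (Q : set M) (x : M) : open Q -> open [set y | Q (negS y)] ->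
  Q x -> exists2 U : set P, nbhs (\pi_P x) U &
  forall a, U a -> exists2 y, \pi_P y = a & Q y.
Proof.
move=> oQ oQ' Qx; pose U := [set a : P | exists2 y, \pi_P y = a & Q y].
exists U => //; apply: open_nbhs_nbhs; split; last by exists x.
rewrite /open /= /quotient_open.
rewrite (_ : _ @^-1` _ = Q `|` [set y | Q (negS y)]); first exact: openU.
apply/seteqP; split=> y /=.
  case=> z /pi_eq[e|e] Qz; [left|right].
    by rewrite (_ : y = z)//; apply: val_inj.
  by rewrite (_ : negS y = z)//; apply: val_inj; rewrite /= /negS /= e opprK.
by case=> Qy; [exists y | exists (negS y) => //; apply/pi_eq; right; rewrite opprK].
Qed.

Lemma nbhs_pi2 (f1 f2 : M -> R) t1 t2 (x : M) : continuous f1 -> continuous f2 ->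
  odd_on f1 -> odd_on f2 -> t1 < f1 x -> t2 < f2 x ->
  exists2 U : set P, nbhs (\pi_P x) U &
  forall a, U a -> exists2 y, \pi_P y = a & t1 < f1 y /\ t2 < f2 y.
Proof.
move=> c1 c2 o1 o2 x1 x2.
apply: (@nbhs_pi [set y | t1 < f1 y /\ t2 < f2 y]) => //.
  apply: openI; [apply: (open_comp (D := [set z | t1 < z])) | apply: (open_comp (D := [set z | t2 < z]))];
    do ?[by move=> y _; apply: c1 | by move=> y _; apply: c2]; exact: open_gt.
rewrite (_ : [set _ | _] = [set y | f1 y < - t1] `&` [set y | f2 y < - t2]).
  apply: openI; [apply: (open_comp (D := [set z | z < - t1])) | apply: (open_comp (D := [set z | z < - t2]))];
    do ?[by move=> y _; apply: c1 | by move=> y _; apply: c2]; exact: open_lt.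
have e1 y : f1 (negS y) = - f1 y by exact: o1.
have e2 y : f2 (negS y) = - f2 y by exact: o2.
by apply/seteqP; split=> y /=; rewrite e1 e2 (ltrNr t1) (ltrNr t2).
Qed.

End odd_maps.

Section odd_to_sphere.
Context {R : realType} {E : preTopologicalLmodType R} (M : set E).
Hypothesis symM : symmetric_set M.
Let P := projectivization M.

Definition odd_sphere (Th : M -> Sinfty R) := continuous Th /\
  odd_on (fun x => set_val (Th x) : {poly R}).

Lemma odd_sphere_ip (Th : M -> Sinfty R) (p : {poly R}) : odd_sphere Th ->
  continuous (fun x => ip p (set_val (Th x)) : R) /\
  odd_on (fun x => ip p (set_val (Th x))).
Proof.
move=> [cT oT]; split.
  move=> x; apply: (@continuous_comp M (Sinfty R) R Th (fun y => ip p (set_val y))); first exact: cT.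
  apply: (@continuous_comp (Sinfty R) (Rinfty R) R set_val (ip p)); last exact: continuous_ip.
  exact: initial_continuous.
by move=> x y xy; rewrite (oT x y xy) ipNr.
Qed.

Definition ccP (Th : M -> Sinfty R) (a b : P) : 'F_2 :=
  cc (set_val (Th (repr a))) (set_val (Th (repr b))).

Lemma ccP_pi Th (x y : M) : odd_sphere Th ->
  ccP Th (\pi_P x) (\pi_P y) = cc (set_val (Th x)) (set_val (Th y)).
Proof.
move=> [_ oT]; rewrite /ccP.
have rE z : set_val (Th (repr (\pi_P z))) = set_val (Th z) \/
            set_val (Th (repr (\pi_P z))) = - set_val (Th z) :> {poly R}.
  have /pi_eq[e|e] : \pi_P z = \pi_P (repr (\pi_P z)) by rewrite reprK.
    by left; congr (set_val (Th _)); apply: val_inj.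
  by right; exact: oT.
by case: (rE x) => ->; case: (rE y) => ->; rewrite ?(ccNl,ccNr) ?S_neq0 // ?oppr_eq0 ?S_neq0.
Qed.

(** The signs of two odd maps change together under the antipode, so that their sum descends to the
    projectivization; it is the cochain [c]. With [Th1 = Th2] the lemma still provides the local
    cocycle property. *)
Lemma ccP_homologous Th1 Th2 : odd_sphere Th1 -> odd_sphere Th2 ->
  exists c : P -> 'F_2, forall x : P, exists2 U : set P, nbhs x U &
    (cocycle_on (ccP Th1) U) /\
    forall a b, U a -> U b -> ccP Th1 a b + ccP Th2 a b = c a + c b.
Proof.
move=> o1 o2; exists (fun a => sgn2 (set_val (Th1 (repr a))) + sgn2 (set_val (Th2 (repr a)))) => a.
have [x <-] := pi_surj a.
have [c1 d1] := odd_sphere_ip (set_val (Th1 x)) o1.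
have [c2 d2] := odd_sphere_ip (set_val (Th2 x)) o2.
have [||U Ux UP] := @nbhs_pi2 R E M symM _ _ (3/4) (3/4) x c1 c2 d1 d2; rewrite ?ip_S; [lra..|].
exists U => //; split.
  move=> u v w /UP[{}u <- [u1 _]] /UP[{}v <- [v1 _]] /UP[{}w <- [w1 _]].
  rewrite !ccP_pi// !cc_acute; do ?by apply: ip_close u1 v1 || apply: ip_close u1 w1 || apply: ip_close v1 w1; exact: ip_S.
  by move: (sgn2 _) (sgn2 _) (sgn2 _) => *; f2.
have sE z : sgn2 (set_val (Th1 (repr (\pi_P z)))) + sgn2 (set_val (Th2 (repr (\pi_P z)))) =
            sgn2 (set_val (Th1 z)) + sgn2 (set_val (Th2 z)).
  have /pi_eq[e|e] : \pi_P z = \pi_P (repr (\pi_P z)) by rewrite reprK.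
    by rewrite (_ : repr _ = z)//; apply: val_inj.
  rewrite (o1.2 _ _ e) (o2.2 _ _ e) !sgn2N ?S_neq0//.
  by move: (sgn2 _) (sgn2 _) => *; f2.
move=> u v /UP[{}u <- [u1 u2]] /UP[{}v <- [v1 v2]].
rewrite !sE !ccP_pi// !cc_acute; last 2 first.
- by apply: ip_close u2 v2; exact: ip_S.
- by apply: ip_close u1 v1; exact: ip_S.
by move: (sgn2 _) (sgn2 _) (sgn2 _) (sgn2 _) => *; f2.
Qed.

End odd_to_sphere.

Section power_null.
Context {X : topologicalType}.
Implicit Types (z : X -> X -> 'F_2) (m : nat).

(** As in the Alexander-Spanier complex, [eta] is global and the equality local. In degree 0 there
    are no coboundaries, so that only an empty space has a null power. *)
Definition power_null z m := exists eta, forall x : X, exists2 U : set X, nbhs x U &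
  forall s, size s = m.+1 -> alls U s ->
  cprod z (nseq m (fun=> 0)) s = if m is 0 then 0 else dl eta s.

Lemma null_class_power (w : cochain X 1) m :
  null_class (cup_power w m) <-> power_null (cochain2 w) m.
Proof.
case: m => [|m]; last exact: null_powerP.
split=> [w0|[eta w0]].
  exists (fun=> 0) => x; have [U Ux U0] := w0 x.
  have := U0 (fun=> x) (fun=> nbhs_singleton Ux).
  by move=> /eqP; rewrite oner_eq0.
move=> x; have [U Ux U0] := w0 x.
have := U0 [:: x] erefl (conj (nbhs_singleton Ux) I).
by move=> /eqP; rewrite oner_eq0.
Qed.

Lemma eq_cprod z z' c (U : set X) m s :
  (forall a b, U a -> U b -> z a b + z' a b = c a + c b) -> alls U s ->
  cprod z' (nseq m (fun=> 0)) s = cprod z (nseq m c) s.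
Proof.
move=> zz; elim: m s => //= m IH [|x [|y s]]//= [Ux [Uy Us]].
rewrite (IH (y :: s))//=; congr (_ * _).
have := zz _ _ Ux Uy; move: (z _ _) (z' _ _) (c _) (c _) => a b d e h.
by rewrite !addr0 -addrA -h addF2K.
Qed.

Lemma power_null_homologous z z' m :
  (exists c : X -> 'F_2, forall x : X, exists2 U : set X, nbhs x U &
    cocycle_on z U /\ forall a b, U a -> U b -> z a b + z' a b = c a + c b) ->
  power_null z' m -> power_null z m.
Proof.
move=> [c cP] [eta etaP]; case: m etaP => [|m] etaP; first by exists eta.
have [eta0 eta0P] := @cprod_homologous X z (nseq m.+1 (fun=> 0)) (nseq m.+1 c) ltac:(by rewrite !size_nseq).
exists (fun s => eta0 s + eta s) => x.
have [U Ux [zU zz]] := cP x; have [V Vx VP] := etaP x.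
exists (U `&` V); first exact: filterI.
move=> s ss UVs.
have Us : alls U s by apply: sub_alls UVs => ? [].
have Vs : alls V s by apply: sub_alls UVs => ? [].
have := eta0P U zU s; rewrite size_nseq => /(_ ss Us)/addF2_shift ->.
by rewrite -(eq_cprod _ zz)// VP//= dlD addrC.
Qed.

Lemma cprod_eq0 z cs (U : set X) s (i : 'I_(size cs)) :
  (forall a b, U a -> U b -> z a b + nth (fun=> 0) cs i a + nth (fun=> 0) cs i b = 0) ->
  alls U s -> cprod z cs s = 0.
Proof.
case: i => i /= i_cs zU; elim: cs i i_cs zU s => // c cs IH [|i] i_cs zU [|x [|y s]]//= [Ux [Uy Us]].
  by rewrite zU// mul0r.
by rewrite (IH i i_cs zU (y :: s))// mulr0.
Qed.

End power_null.

Section index_power.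
Context {R : realType} {E : preTopologicalLmodType R} (M : set E).
Hypothesis symM : symmetric_set M.
Let P := projectivization M.

Lemma power_null_indep Th1 Th2 m : odd_sphere Th1 -> odd_sphere Th2 ->
  power_null (@ccP R E M Th1) m -> power_null (@ccP R E M Th2) m.
Proof.
by move=> o1 o2; apply: power_null_homologous; exact: ccP_homologous.
Qed.

Lemma power_null_cover Th (n : nat) (Xi : 'I_n -> M -> R) m : odd_sphere Th ->
  (forall i, continuous (Xi i)) -> (forall i, odd_on (Xi i)) ->
  (forall x, exists i, Xi i x != 0) -> (n <= m)%N -> power_null (@ccP R E M Th) m.
Proof.
move=> oT cXi oXi Xi0 nm.
(* [c i] trivializes the double cover where the component [i] is nonzero: it is the sign of the lift
   on which this component is positive. The surplus factors, of index at least [n], are left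
   alone. *)
pose c (i : 'I_m) (a : P) : 'F_2 := if insub (i : nat) is Some j then
  sgn2 (set_val (Th (repr a))) + (if 0 < Xi j (repr a) then 0 else 1) else 0.
pose cs := [seq c i | i <- enum 'I_m].
have scs : size cs = m by rewrite size_map size_enum_ord.
have [eta0 eta0P] := @cprod_homologous P (ccP Th) (nseq m (fun=> 0)) cs ltac:(by rewrite size_nseq scs).
have [c0 c0P] := ccP_homologous symM oT oT.
exists eta0 => a.
have [x0 ax0] := pi_surj a; have [i ix0] := Xi0 x0.
have [x ax ix] : exists2 x, \pi_P x = a & 0 < Xi i x.
  have [ix|ix] := ltP 0 (Xi i x0); first by exists x0.
  exists (negS symM x0); last by rewrite (oXi i x0)// oppr_gt0 lt_neqAle ix0.
  by rewrite -ax0; apply/pi_eq; right; rewrite opprK.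
have [d1 d2] := odd_sphere_ip (set_val (Th x)) oT.
(* Two conditions on the lift: it is close to [x], so that lifts form acute angles, and its
   component [i] is positive. *)
have [||U Ux UP] := @nbhs_pi2 R E M symM _ _ (3/4) 0 x d1 (cXi i) d2 (oXi i); rewrite ?ip_S//; first by lra.
have [V Vx [zV _]] := c0P a.
exists (U `&` V); first by apply: filterI => //; rewrite -ax.
move=> s ss UVs.
have Us : alls U s by apply: sub_alls UVs => ? [].
have Vs : alls V s by apply: sub_alls UVs => ? [].
have im : (i < size cs)%N by rewrite scs (leq_trans (ltn_ord i)).
have cE y : 0 < Xi i y -> nth (fun=> 0) cs i (\pi_P y) = sgn2 (set_val (Th y)).
  move=> iy; have im' : (i < m)%N by rewrite -scs.
  rewrite (nth_map (Ordinal im')) ?size_enum_ord//= (nth_ord_enum (Ordinal im') (Ordinal im')).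
  rewrite /c /= valK.
  have /pi_eq[e|e] : \pi_P y = \pi_P (repr (\pi_P y)) by rewrite reprK.
    by rewrite (_ : repr _ = y) ?iy ?addr0//; apply: val_inj.
  rewrite (oT.2 _ _ e) (oXi i _ _ e) oppr_gt0 ltNge (ltW iy) /= sgn2N ?S_neq0//.
  by rewrite -addrA addF2 addr0.
have cs0 : cprod (ccP Th) cs s = 0.
  apply: (@cprod_eq0 _ _ _ U _ (Ordinal im)) => // u v /UP[y <- [y1 y2]] /UP[w <- [w1 w2]].
  rewrite !cE//= ccP_pi// cc_acute; last by apply: ip_close y1 w1; exact: ip_S.
  by move: (sgn2 _) (sgn2 _) => *; f2.
have := eta0P V zV s; rewrite size_nseq cs0 addr0 => /(_ ss Vs) ->.
by case: (m) nm i {eta0P UP cE ix ix0 im d1 d2} => [|//]; rewrite leqn0 => /eqP -> [].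
Qed.

End index_power.

Section index.
Context {R : realType} {E E' : preTopologicalLmodType R} (M : set E) (N : set E').
Hypotheses (symM : symmetric_set M) (symN : symmetric_set N).

Lemma power_null_image (h : M -> N) (Th : N -> Sinfty R) m : continuous h ->
  odd_on (fun x => set_val (h x)) -> odd_sphere Th ->
  power_null (@ccP R E' N Th) m -> power_null (@ccP R E M (Th \o h)) m.
Proof.
move=> ch oh oT [eta etaP].
pose hb (a : projectivization M) : projectivization N := \pi_(projectivization N) (h (repr a)).
have hbE x : hb (\pi_(projectivization M) x) = \pi_(projectivization N) (h x).
  rewrite /hb; apply/pi_eq.
  have /pi_eq[e|e] : \pi_(projectivization M) x = \pi_(projectivization M) (repr (\pi_(projectivization M) x)).
    by rewrite reprK.
  - by left; congr (set_val (h _)); apply: val_inj.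
  - by right; rewrite (oh _ _ e) opprK.
have chb : continuous hb.
  apply/quotient_continuous => x.
  rewrite (_ : hb \o _ = \pi_(projectivization N) \o h); last by apply/funext => y /=; exact: hbE.
  by apply: continuous_comp; [exact: ch | exact: pi_continuous].
exists (fun s => eta (map hb s)) => x.
have [U Ux UP] := etaP (hb x).
exists (hb @^-1` U); first exact: chb.
move=> s ss Us.
have Us' : alls U (map hb s) by elim: s {ss} Us => //= a s IH [? /IH].
have := UP (map hb s); rewrite size_map => /(_ ss Us').
have -> : cprod (ccP Th) (nseq m (fun=> 0)) (map hb s) =
          cprod (ccP (Th \o h)) (nseq m (fun=> 0)) s.
  elim: (m) (s) => //= m' IH [|a [|b s']]//=; rewrite -(IH (b :: s'))/= !addr0.
  congr (_ * _); rewrite -[a]reprK -[b]reprK !hbE !ccP_pi//.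
  split; first by move=> y; apply: continuous_comp; [exact: ch | exact: oT.1].
  by move=> u v uv; apply: oT.2; exact: oh.
by move=> ->; case: (m) => // m'; rewrite dl_map.
Qed.

End index.

(** * The generator of the first cohomology group *)

Section fine_subdivision.
Context {R : realType} {X T : topologicalType}.
Variables (Q : set (set X)) (H : T -> R -> X) (t0 : T).
Hypothesis QX : forall x : X, exists2 U : set X, nbhs x U & Q U.
Hypothesis cH : forall s, {for (t0, s), continuous (fun p => H p.1 p.2)}.

(** A Lebesgue number of [0, 1], by compactness, uniform in the parameter near [t0]. Two parameters
    occur because neighbouring paths will be compared inside one member of [Q]. *)
Lemma fine_subdivision : exists M : nat, exists2 V : set T, nbhs t0 V &
  forall t t' s, V t -> V t' -> 0 <= s <= 1 -> exists2 U, Q U &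
    forall s', `|s' - s| <= 2 ^- M -> U (H t s') /\ U (H t' s').
Proof.
pose G t t' m s := exists2 U, Q U &
  forall s', `|s' - s| <= 2 ^- m -> U (H t s') /\ U (H t' s').
have /compact_near_coveringP cov := @segment_compact R 0 1.
have [] := cov _ (filter_prod (filter_prod (nbhs t0) (nbhs t0)) \oo)
  (fun i => G i.1.1 i.1.2 i.2); last first.
  move=> [A B] [/= [[V1 V2] [/= V1t V2t] VA] [M _ MB]] AB.
  exists M, (V1 `&` V2); first exact: filterI.
  move=> t t' s [Vt _] [_ Vt'] s01; apply: (AB (t, t', M)) => //=.
  by split; [exact: (VA (t, t')) | apply: MB; exact: leqnn].
move=> s _; have [U Us QU] := QX (H t0 s).
have [[V I] /= [Vt0 Is] VI] := @cH s U Us.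
have [/= e e0 eI] := Is.
have e2 : 0 < e / 2 by rewrite divr_gt0.
exists ([set s1 | `|s - s1| < e / 2], [set i | [/\ V i.1.1, V i.1.2 & 2 ^- i.2 <= e / 2]]).
  split=> /=; first exact: (@nbhsx_ballx R R s (e / 2)).
  exists (V `*` V, [set m | (2 : R) ^- m <= e / 2]).
    split; first by exists (V, V) => //.
    have := near_infty_natSinv_expn_lt (PosNum e2); apply: filterS => m /= /ltW.
    by rewrite div1r.
  by move=> [[x y] m] /= [[? ?] ?].
move=> [s1 [[x y] m]] /= [ss1 [Vx Vy me]]; exists U => // s' ss.
have h : I s'.
  apply: eI; rewrite /= (_ : s - s' = (s - s1) - (s' - s1)); last by ring.
  apply: le_lt_trans (ler_normB _ _) _; rewrite [ltRHS](splitr e).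
  by apply: ltr_leD => //; exact: le_trans me.
by split; [apply: (VI (x, s')) | apply: (VI (y, s'))].
Qed.

End fine_subdivision.

Section holonomy.
Context {R : realType} {X : topologicalType}.
Variables (z : X -> X -> 'F_2).
Implicit Types g : R -> X.

Definition hol_sum g m : 'F_2 :=
  \sum_(i < 2 ^ m) z (g (i%:R / 2 ^+ m)) (g (i.+1%:R / 2 ^+ m)).

(* The sums of a locally defined cocycle [z] along dyadic subdivisions of a path are eventually
   constant; [hol] is their common value (0 if there is none). *)
Definition hol g : 'F_2 :=
  xget 0 [set v | exists M, forall m, (M <= m)%N -> hol_sum g m = v].

Lemma sum_split2 (V : nmodType) (a : nat -> V) n :
  \sum_(i < n.*2) a i = \sum_(i < n) (a i.*2 + a i.*2.+1).
Proof.
elim: n => [|n IH]; first by rewrite !big_ord0.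
by rewrite doubleS !big_ord_recr /= IH addrA.
Qed.

Lemma telescope2 (a : nat -> 'F_2) n : \sum_(i < n) (a i + a i.+1) = a 0%N + a n.
Proof.
elim: n => [|n IH]; first by rewrite big_ord0 addF2.
by rewrite big_ord_recr /= IH -addrA addF2K.
Qed.

Definition small_steps g M := forall s : R, 0 <= s <= 1 -> exists2 U, cocycle_on z U &
    forall s', `|s' - s| <= 2 ^- M -> U (g s').

(** A midpoint replaces an edge by two, and the cocycle identity on these three points leaves the
    sum unchanged. *)
Lemma hol_sumS g M m : small_steps g M -> (M <= m)%N -> hol_sum g m.+1 = hol_sum g m.
Proof.
move=> fg Mm; rewrite /hol_sum expnS mul2n.
rewrite (sum_split2 (fun i => z (g (i%:R / 2 ^+ m.+1)) (g (i.+1%:R / 2 ^+ m.+1)))).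
apply: eq_bigr => i _.
have e1 : (i.*2)%:R / 2 ^+ m.+1 = i%:R / 2 ^+ m :> R.
  by rewrite -muln2 natrM exprS; field; rewrite expf_eq0 pnatr_eq0 andbF.
have e2 : (i.*2.+2)%:R / 2 ^+ m.+1 = i.+1%:R / 2 ^+ m :> R.
  by rewrite -doubleS -muln2 natrM exprS; field; rewrite expf_eq0 pnatr_eq0 andbF.
rewrite e1 e2.
have m0 : 0 < (2 : R) ^+ m by rewrite exprn_gt0.
have [|U zU Us] := fg (i%:R / 2 ^+ m).
  apply/andP; split; first by rewrite divr_ge0 ?ler0n// ltW.
  by rewrite ler_pdivrMr// mul1r -natrX ler_nat ltnW.
have le2 : (2 : R) ^- m <= 2 ^- M.
  by rewrite lef_pV2 ?posrE ?exprn_gt0// ler_eXn2l// ltr1n.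
have d1 : (i.*2.+1)%:R / 2 ^+ m.+1 - i%:R / 2 ^+ m = 2^-1 * 2 ^- m :> R.
  by rewrite -natr1 -muln2 natrM exprS; field; rewrite expf_eq0 pnatr_eq0 andbF.
have d2 : i.+1%:R / 2 ^+ m - i%:R / 2 ^+ m = 2 ^- m :> R.
  by rewrite -natr1; field; rewrite expf_eq0 pnatr_eq0 andbF.
have p0 : 0 < (2 : R) ^- m by rewrite invr_gt0.
have := zU (g (i%:R / 2 ^+ m)) (g ((i.*2.+1)%:R / 2 ^+ m.+1)) (g (i.+1%:R / 2 ^+ m)).
move=> /(_ (Us _ _) (Us _ _) (Us _ _)); rewrite subrr normr0 d1 d2 !gtr0_norm ?mulr_gt0//.
have -> : 2^-1 * 2 ^- m <= (2 : R) ^- M by move: le2 p0; set a := 2 ^- m; set b := 2 ^- M; lra.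
rewrite le2 ltW ?invr_gt0 ?exprn_gt0// => /(_ isT isT isT) e.
by apply/addF2_eq0; rewrite addrAC.
Qed.

Lemma hol_sumE g M : small_steps g M -> hol g = hol_sum g M.
Proof.
move=> fg.
have e m : (M <= m)%N -> hol_sum g m = hol_sum g M.
  move=> /subnK <-; elim: (m - M)%N => // k IH.
  by rewrite addSn (hol_sumS fg) ?leq_addl.
have [M' M'P] : [set v | exists M, forall m, (M <= m)%N -> hol_sum g m = v] (hol g).
  by apply: (@xgetPex _ 0); exists (hol_sum g M), M => m; exact: e.
by rewrite -(M'P (maxn M M')) ?leq_maxr// e// leq_maxl.
Qed.

Lemma cocycle_on_refl U a : cocycle_on z U -> U a -> z a a = 0.
Proof. by move=> zU Ua; have := zU a a a Ua Ua Ua; rewrite addF2 add0r. Qed.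

(** Two neighbouring paths bound a ladder of small squares. The diagonal cuts each square into two
    triangles on which the cocycle identity holds, and the rungs telescope to the two end terms. *)
Lemma hol_near (T : topologicalType) (H : T -> R -> X) (t0 : T) :
  (forall x : X, exists2 U : set X, nbhs x U & cocycle_on z U) ->
  (forall s, {for (t0, s), continuous (fun p => H p.1 p.2)}) ->
  exists2 V : set T, nbhs t0 V & forall t t', V t -> V t' ->
    hol (H t) + hol (H t') = z (H t 0) (H t' 0) + z (H t 1) (H t' 1).
Proof.
move=> zX cH; have [M [V Vt0 VP]] := fine_subdivision zX cH.
have fV t : V t -> small_steps (H t) M.
  by move=> Vt s s01; have [U zU Us] := VP t t s Vt Vt s01; exists U => // s' /Us[].
exists V => // t t' Vt Vt'; rewrite !(hol_sumE (fV _ _))// /hol_sum -big_split /=.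
pose a i := z (H t (i%:R / 2 ^+ M)) (H t' (i%:R / 2 ^+ M)).
rewrite (eq_bigr (fun i : 'I_(2 ^ M) => a i + a i.+1)) => [|i _].
  by rewrite telescope2 /a natrX mul0r divff// expf_neq0// pnatr_eq0.
have m0 : 0 < (2 : R) ^+ M by rewrite exprn_gt0.
have [|U zU Us] := VP t t' (i%:R / 2 ^+ M) Vt Vt'.
  apply/andP; split; first by rewrite divr_ge0 ?ler0n// ltW.
  by rewrite ler_pdivrMr// mul1r -natrX ler_nat ltnW.
have d2 : i.+1%:R / 2 ^+ M - i%:R / 2 ^+ M = 2 ^- M :> R.
  by rewrite -natr1; field; rewrite expf_eq0 pnatr_eq0 andbF.
have p0 : 0 < (2 : R) ^- M by rewrite invr_gt0.
have [|U1 U2] := Us (i%:R / 2 ^+ M); first by rewrite subrr normr0 ltW.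
have [|U3 U4] := Us (i.+1%:R / 2 ^+ M); first by rewrite d2 gtr0_norm.
rewrite /a.
have := zU _ _ _ U1 U3 U4; have := zU _ _ _ U1 U2 U4.
move: (z _ _) (z _ _) (z _ _) (z _ _) (z _ _) => b c d e h.
by move=> /addF2_eq0 <- /addF2_eq0 <-; f2.
Qed.

End holonomy.

Lemma locally_constant_path {R : realType} {X : topologicalType} (a : X -> 'F_2) (g : R -> X) :
  (forall x : X, exists2 U : set X, nbhs x U & forall y y', U y -> U y' -> a y = a y') ->
  continuous g -> a (g 0) = a (g 1).
Proof.
move=> aX cg.
have cH (s : R) : {for ((0 : R), s), continuous (fun p : R * R => g p.2)}.
  by apply: (@continuous_comp (R * R)%type R X snd g); [exact: cvg_snd | exact: cg].
have [M [V V0 VP]] := @fine_subdivision R X R [set U | forall y y', U y -> U y' -> a y = a y'] (fun=> g) 0 aX cH.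
have m0 : 0 < (2 : R) ^+ M by rewrite exprn_gt0.
apply/addF2_eq0; have := telescope2 (fun i => a (g (i%:R / 2 ^+ M))) (2 ^ M).
rewrite natrX mul0r divff ?gt_eqF// => <-; rewrite big1// => i _.
have V00 := nbhs_singleton V0.
have [|U aU Us] := VP 0 0 (i%:R / 2 ^+ M) V00 V00.
  apply/andP; split; first by rewrite divr_ge0 ?ler0n// ltW.
  by rewrite ler_pdivrMr// mul1r -natrX ler_nat ltnW.
have d2 : i.+1%:R / 2 ^+ M - i%:R / 2 ^+ M = 2 ^- M :> R.
  by rewrite -natr1; field; rewrite expf_eq0 pnatr_eq0 andbF.
have p0 : 0 < (2 : R) ^- M by rewrite invr_gt0.
have [|U1 _] := Us (i%:R / 2 ^+ M); first by rewrite subrr normr0 ltW.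
have [|U3 _] := Us (i.+1%:R / 2 ^+ M); first by rewrite d2 gtr0_norm.
by rewrite (aU _ _ U1 U3) addF2.
Qed.


Lemma cvg_rowP {R : realType} (T : topologicalType) n (f : T -> 'rV[R]_n) (x : T) :
  (forall i, {for x, continuous (fun t => f t 0 i)}) -> {for x, continuous f}.
Proof.
move=> cf U [P Pn PU].
have : \forall t \near x, forall i, P 0 i (f t 0 i).
  by apply: filter_forall => i; exact: (cf i) (Pn 0 i).
by apply: filterS => t ft; apply: PU => i j; rewrite ord1.
Qed.

(** * Contraction of the infinite sphere to the point 1 *)

Section sphere_paths.
Context {R : realType}.
Implicit Types p : {poly R}.

Lemma ip1 : ip (1 : {poly R}) 1 = 1.
Proof. by rewrite /ip size_poly1 big_ord1 coef1 mulr1. Qed.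

Definition nrm p : R := Num.sqrt (ip p p).

Lemma nrm_gt0 p : p != 0 -> 0 < nrm p.
Proof. by move=> p0; rewrite sqrtr_gt0 ip_gt0. Qed.

Lemma nrm_S p : p != 0 -> Sinfty R ((nrm p)^-1 *: p).
Proof.
move=> p0; apply/SinftyE; rewrite ipZl ipZr mulrA -invfM -expr2.
by rewrite sqr_sqrtr ?ip_ge0// mulVf// gt_eqF// ip_gt0.
Qed.

Definition toS p : Sinfty R :=
  if pselect (p != 0) is left p0 then exist (fun x : Rinfty R => x \in Sinfty R) _ (mem_set (nrm_S p0))
  else exist (fun x : Rinfty R => x \in Sinfty R) 1 (mem_set (iffRL (SinftyE 1) ip1)).

Lemma toSE p : p != 0 -> set_val (toS p) = (nrm p)^-1 *: p.
Proof. by move=> p0; rewrite /toS; case: pselect. Qed.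

Lemma toS_val (x : Sinfty R) : toS (set_val x) = x.
Proof.
apply: val_inj; rewrite /= -[LHS]/(set_val _) toSE ?S_neq0// /nrm ip_S sqrtr1 invr1.
by rewrite scale1r.
Qed.

Lemma toSN p : p != 0 -> set_val (toS (- p)) = - set_val (toS p) :> {poly R}.
Proof. by move=> p0; rewrite !toSE ?oppr_eq0// /nrm ipNl ipNr opprK scalerN. Qed.

Lemma continuous_coef_rVpoly n k : continuous (fun x : 'rV[R]_n => (rVpoly x)`_k).
Proof.
have [ni|ni] := leqP n k.
  rewrite (_ : (fun _ => _) = (fun=> 0)); first exact: cst_continuous.
  by apply/funext => y; rewrite nth_default// (leq_trans (size_poly _ _)).
rewrite (_ : (fun _ => _) = (fun y : 'rV[R]_n => y 0 (Ordinal ni))).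
  exact: coord_continuous.
by apply/funext => y; rewrite -coef_rVpoly_ord.
Qed.

Lemma continuous_nrm n : continuous (fun x : 'rV[R]_n => nrm (rVpoly x)).
Proof.
move=> x; rewrite /nrm.
apply: (@continuous_comp 'rV[R]_n R R (fun x => ip (rVpoly x) (rVpoly x))); last exact: sqrt_continuous.
rewrite (_ : (fun _ => _) = (fun y : 'rV[R]_n => \sum_(i < n) y 0 i * y 0 i)); last first.
  apply/funext => y; rewrite (@ipE _ n) ?size_poly//.
  by apply: eq_bigr => i _; rewrite !coef_rVpoly_ord.
have := @continuous_at_sum R 'rV[R]_n R _ (index_enum 'I_n) (fun i (y : 'rV[R]_n) => y 0 i * y 0 i) x.
apply => i; apply: (@continuousM R _ (fun y : 'rV[R]_n => y 0 i) (fun y : 'rV[R]_n => y 0 i)); exact: coord_continuous.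
Qed.

Lemma rVpoly_neq0 n (x : 'rV[R]_n) : (rVpoly x != 0) = (x != 0).
Proof.
congr (~~ _); apply/eqP/eqP => [e|->]; last exact: raddf0.
by rewrite -[x]rVpolyK e; apply/rowP => i; rewrite !mxE coef0.
Qed.

Lemma open_rVpoly_neq0 n : open [set x : 'rV[R]_n | rVpoly x != 0].
Proof.
rewrite (_ : [set _ | _] = (fun x => nrm (rVpoly x)) @^-1` [set r | 0 < r]).
  by apply: open_comp; [move=> ? _; exact: continuous_nrm|exact: open_gt].
apply/seteqP; split=> x /=; first exact: nrm_gt0.
by apply: contraTneq => ->; rewrite /nrm /ip size_poly0 big_ord0 sqrtr0 ltxx.
Qed.

Lemma continuous_toS n (x : 'rV[R]_n) : rVpoly x != 0 ->
  {for x, continuous (fun y : 'rV[R]_n => toS (rVpoly y))}.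
Proof.
move=> x0 U [_ /= [[W oW <-]] Wx WU].
have : \forall y \near x, W ((nrm (rVpoly y))^-1 *: rVpoly y : Rinfty R).
  have c : {for x, continuous (fun y : 'rV[R]_n => (nrm (rVpoly y))^-1 *: y)}.
    apply: (@continuousZ _ _ _ (fun y : 'rV[R]_n => (nrm (rVpoly y))^-1) id) => //.
    apply: (@continuousV _ _ (fun y : 'rV[R]_n => nrm (rVpoly y))); last exact: continuous_nrm.
    by rewrite gt_eqF// nrm_gt0.
  have := @continuous_comp 'rV[R]_n 'rV[R]_n (Rinfty R) _ _ _ c (@rVpoly_continuous R n _).
  move=> /(_ W); rewrite /= => h.
  have : nbhs x (fun y : 'rV[R]_n => W (rVpoly ((nrm (rVpoly y))^-1 *: y))).
    by apply: h; rewrite linearZ /= -toSE//; apply: open_nbhs_nbhs; split.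
  by apply: filterS => y; rewrite linearZ.
have : \forall y \near x, rVpoly y != 0.
  by apply: (open_nbhs_nbhs (conj (@open_rVpoly_neq0 n) x0)).
by apply: filterS2 => y y0 Wy; apply: WU; rewrite /= toSE.
Qed.

(* The two segments [p, X p] and [X p, 1] avoid the origin. *)
Definition path1 p (s : R) : Sinfty R := toS ((1 - s) *: p + s *: (p * 'X)).
Definition path2 p (s : R) : Sinfty R := toS ((1 - s) *: (p * 'X) + s *: 1).

(** The segment is [p] times (1 - s) + s X, a nonzero element of a domain. *)
Lemma path1_neq0 p (s : R) : p != 0 -> (1 - s) *: p + s *: (p * 'X) != 0.
Proof.
move=> p0; have -> : (1 - s) *: p + s *: (p * 'X) = p * ((1 - s)%:P + s *: 'X).
  by rewrite mulrDr -scalerAr -mul_polyC mulrC.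
rewrite mulf_neq0//; apply/eqP => e.
have := congr1 (fun q : {poly R} => q`_0) e; have := congr1 (fun q : {poly R} => q`_1) e.
rewrite !(coefD, coefC, coefZ, coefX, coef0)/=; lra.
Qed.

Lemma path2_neq0 p (s : R) : p != 0 -> (1 - s) *: (p * 'X) + s *: 1 != 0.
Proof.
move=> p0; have [->|s0] := eqVneq s 0.
  by rewrite subr0 scale1r scale0r addr0 mulf_neq0// polyX_eq0.
apply/eqP => e; have := congr1 (fun q : {poly R} => q`_0) e.
rewrite !(coefD, coefC, coefZ, coefMX, coef0, coef1)/= mulr0 mulr1 add0r => /eqP.
by rewrite (negbTE s0).
Qed.

(** Joint continuity is stated on R^n x R, not on the product of the colimit with R. Since [q]
    raises the size by at most one, the map factors through R^(n+1), where coefficientwise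
    continuity is enough. *)
Lemma continuous_path (q : {poly R} -> R -> {poly R}) n (x : 'rV[R]_n) (s : R) :
  (forall (y : 'rV[R]_n) s, size (q (rVpoly y) s) <= n.+1)%N ->
  (forall k, {for (x, s), continuous (fun p : 'rV[R]_n * R => (q (rVpoly p.1) p.2)`_k)}) ->
  q (rVpoly x) s != 0 ->
  {for (x, s), continuous (fun p : 'rV[R]_n * R => toS (q (rVpoly p.1) p.2))}.
Proof.
move=> sq cq q0.
pose f (p : 'rV[R]_n * R) : 'rV[R]_n.+1 := poly_rV (q (rVpoly p.1) p.2).
have fE u : rVpoly (f u) = q (rVpoly u.1) u.2 by rewrite poly_rV_K.
rewrite (_ : (fun _ => _) = (fun y : 'rV[R]_n.+1 => toS (rVpoly y)) \o f); last by apply/funext => p /=; rewrite fE.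
apply: continuous_comp; last by apply: continuous_toS; rewrite fE.
apply: cvg_rowP => i; rewrite (_ : (fun _ => _) = (fun p : 'rV[R]_n * R => (q (rVpoly p.1) p.2)`_i)).
  exact: cq.
by apply/funext => p; rewrite mxE.
Qed.

Lemma continuous_coef_fst n k (x : 'rV[R]_n * R) :
  {for x, continuous (fun p : 'rV[R]_n * R => (rVpoly p.1)`_k)}.
Proof.
apply: (@continuous_comp ('rV[R]_n * R)%type 'rV[R]_n R fst (fun x => (rVpoly x)`_k)); first exact: cvg_fst.
exact: continuous_coef_rVpoly.
Qed.

Lemma continuous_path1 n (x : 'rV[R]_n) (s : R) : rVpoly x != 0 ->
  {for (x, s), continuous (fun p : 'rV[R]_n * R => path1 (rVpoly p.1) p.2)}.
Proof.
move=> x0; apply: (@continuous_path (fun p s => (1 - s) *: p + s *: (p * 'X))); last exact: path1_neq0.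
  move=> y t; rewrite (leq_trans (size_polyD _ _))// geq_max; apply/andP; split.
    by rewrite (leq_trans (size_scale_leq _ _))// (leq_trans (size_poly _ _)).
  rewrite (leq_trans (size_scale_leq _ _))// (leq_trans (size_polyMleq _ _))// size_polyX addn2 /= ltnS.
  exact: size_poly.
move=> k; rewrite (_ : (fun _ => _) = (fun p : 'rV[R]_n * R => (1 - p.2) * (rVpoly p.1)`_k +
   p.2 * (if k == 0%N then 0 else (rVpoly p.1)`_k.-1))); last first.
  by apply/funext => p; rewrite coefD !coefZ coefMX.
have c2 : {for (x, s), continuous (fun p : 'rV[R]_n * R => p.2)} by exact: cvg_snd.
apply: (@continuousD _ R^o ('rV[R]_n * R)%type (fun p : 'rV[R]_n * R => (1 - p.2) * (rVpoly p.1)`_k)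
   (fun p : 'rV[R]_n * R => p.2 * (if k == 0%N then 0 else (rVpoly p.1)`_k.-1))).
  apply: (@continuousM R ('rV[R]_n * R)%type (fun p : 'rV[R]_n * R => 1 - p.2) (fun p : 'rV[R]_n * R => (rVpoly p.1)`_k)).
    by apply: (@continuousB _ R^o _ (fun=> 1)); first exact: cst_continuous.
  exact: continuous_coef_fst.
apply: (@continuousM R ('rV[R]_n * R)%type (fun p : 'rV[R]_n * R => p.2)) => //.
by case: eqP => _; [exact: cst_continuous | exact: continuous_coef_fst].
Qed.

Lemma continuous_path2 n (x : 'rV[R]_n) (s : R) : rVpoly x != 0 ->
  {for (x, s), continuous (fun p : 'rV[R]_n * R => path2 (rVpoly p.1) p.2)}.
Proof.
move=> x0; apply: (@continuous_path (fun p s => (1 - s) *: (p * 'X) + s *: 1)); last exact: path2_neq0.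
  move=> y t; rewrite (leq_trans (size_polyD _ _))// geq_max; apply/andP; split.
    rewrite (leq_trans (size_scale_leq _ _))// (leq_trans (size_polyMleq _ _))// size_polyX addn2 /= ltnS.
    exact: size_poly.
  by rewrite (leq_trans (size_scale_leq _ _))// size_poly1.
move=> k; rewrite (_ : (fun _ => _) = (fun p : 'rV[R]_n * R =>
   (1 - p.2) * (if k == 0%N then 0 else (rVpoly p.1)`_k.-1) + p.2 * (k == 0%N)%:R)); last first.
  by apply/funext => p; rewrite coefD !coefZ coefMX coef1.
have c2 : {for (x, s), continuous (fun p : 'rV[R]_n * R => p.2)} by exact: cvg_snd.
apply: (@continuousD _ R^o ('rV[R]_n * R)%type (fun p : 'rV[R]_n * R => (1 - p.2) * (if k == 0%N then 0 else (rVpoly p.1)`_k.-1))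
   (fun p : 'rV[R]_n * R => p.2 * (k == 0%N)%:R)).
  apply: (@continuousM R ('rV[R]_n * R)%type (fun p : 'rV[R]_n * R => 1 - p.2)).
    by apply: (@continuousB _ R^o _ (fun=> 1)); first exact: cst_continuous.
  by case: eqP => _; [exact: cst_continuous | exact: continuous_coef_fst].
by apply: (@continuousM R ('rV[R]_n * R)%type (fun p : 'rV[R]_n * R => p.2)) => //; exact: cst_continuous.
Qed.

End sphere_paths.

Section sphere_cohomology.
Context {R : realType}.
Let S := set_type (Sinfty R).

Lemma path1_0 (p : {poly R}) : path1 p 0 = toS p.
Proof. by rewrite /path1 subr0 scale1r scale0r addr0. Qed.
Lemma path1_1 (p : {poly R}) : path1 p 1 = toS (p * 'X).
Proof. by rewrite /path1 subrr scale0r add0r scale1r. Qed.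
Lemma path2_0 (p : {poly R}) : path2 p 0 = toS (p * 'X).
Proof. by rewrite /path2 subr0 scale1r scale0r addr0. Qed.
Lemma path2_1 (p : {poly R}) : path2 p 1 = toS 1.
Proof. by rewrite /path2 subrr scale0r add0r scale1r. Qed.

Lemma rVpoly_surj (p : {poly R}) : exists n (x : 'rV[R]_n), p = rVpoly x.
Proof. by exists (size p), (poly_rV p); rewrite poly_rV_K. Qed.

Lemma sphere_connected (a : S -> 'F_2) :
  (forall x : S, exists2 U : set S, nbhs x U & forall y y', U y -> U y' -> a y = a y') ->
  forall x y, a x = a y.
Proof.
move=> aS; suff h x : a x = a (toS 1) by move=> x y; rewrite !h.
rewrite -(toS_val x); have := S_neq0 x; have [n [v ->]] := rVpoly_surj (set_val x) => v0.
have cp (g : {poly R} -> R -> S) : (forall s, {for (v, s), continuous (fun p : 'rV[R]_n * R => g (rVpoly p.1) p.2)}) ->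
    continuous (g (rVpoly v)).
  move=> cg s; apply: (@continuous_comp R ('rV[R]_n * R)%type S (fun s => (v, s)) (fun p => g (rVpoly p.1) p.2)); last exact: cg.
  move=> U [[A B] /= [vA sB] AB]; apply: filterS sB => t Bt.
  by apply: AB; split=> //=; exact: nbhs_singleton.
have := @locally_constant_path R S a (path1 (rVpoly v)) aS (cp _ (fun s => @continuous_path1 R n v s v0)).
have := @locally_constant_path R S a (path2 (rVpoly v)) aS (cp _ (fun s => @continuous_path2 R n v s v0)).
by rewrite path1_0 path1_1 path2_0 path2_1 => -> ->.
Qed.

(** [psi] is the holonomy of [z] from [p] to 1 along the two segments. By [hol_near], moving [p]
    changes it by the value of [z] at the starting points: the terms at [p * 'X] occur twice, and
    the one at the fixed end point 1 vanishes. *)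
Lemma sphere_H1 (z : S -> S -> 'F_2) :
  (forall x : S, exists2 U : set S, nbhs x U & cocycle_on z U) ->
  exists psi : S -> 'F_2, forall x : S, exists2 U : set S, nbhs x U &
    forall y y', U y -> U y' -> z y y' = psi y + psi y'.
Proof.
move=> zS; pose psi p := hol z (path1 p) + hol z (path2 p).
have psiP n (x0 : 'rV[R]_n) : rVpoly x0 != 0 -> \forall x \near x0,
    psi (rVpoly x) + psi (rVpoly x0) = z (toS (rVpoly x)) (toS (rVpoly x0)).
  move=> x00.
  have [V1 V1x V1P] := hol_near (H := fun x : 'rV[R]_n => path1 (rVpoly x)) zS (fun s => @continuous_path1 R n x0 s x00).
  have [V2 V2x V2P] := hol_near (H := fun x : 'rV[R]_n => path2 (rVpoly x)) zS (fun s => @continuous_path2 R n x0 s x00).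
  near=> x; rewrite /psi addrACA.
  rewrite V1P ?V2P ?path1_0 ?path1_1 ?path2_0 ?path2_1; last 4 first.
  - by near: x.
  - exact: nbhs_singleton.
  - by near: x.
  - exact: nbhs_singleton.
  have [U U1 zU] := zS (toS 1); rewrite (cocycle_on_refl zU (nbhs_singleton U1)) addr0.
  by rewrite -addrA addF2 addr0.
exists (fun x => psi (set_val x)) => x0; have [U Ux zU] := zS x0.
have [W [[oW Wx] WU]] : exists W, open_nbhs x0 W /\ W `<=` U.
  by move: Ux; rewrite nbhsE => -[W ? ?]; exists W.
have zW : cocycle_on z W by move=> a b c /WU ? /WU ? /WU ?; exact: zU.
(* [psiP] yields a neighbourhood in each R^n separately, and these need not fit together to one in
   the colimit. Instead the whole set of points of [W] satisfying [Q] is shown to be open, since at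
   each of its points [x1] the cocycle identity on [x0], [x], [x1] carries [Q] over to nearby
   [x]. *)
pose Q x p := z x0 x + psi p = psi (set_val x0).
exists (W `&` [set x | Q x (set_val x)]); last first.
  move=> y y' [Wy Qy] [Wy' Qy'].
  have := zW _ _ _ Wx Wy Wy'; rewrite (addF2_shift Qy) (addF2_shift Qy').
  by move: (psi _) (psi _) (psi _) (z _ _) => a b c d /eqP; rewrite addr_eq0 oppF2 => /eqP <-; f2.
apply: filterI; first by apply: open_nbhs_nbhs.
pose O := [set p : Rinfty R | (p : {poly R}) != 0 /\ (W (toS p) /\ Q (toS p) p)].
suff oO : open O.
  apply: (@filterS _ _ _ (set_val @^-1` O)).
    by move=> x [_ []]; rewrite toS_val.
  apply: initial_continuous; apply: open_nbhs_nbhs; split => //.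
  split; first exact: S_neq0.
  by rewrite /= toS_val; split => //; rewrite /Q (cocycle_on_refl zW)// add0r.
rewrite /open /= => n; rewrite openE => x1 /= [x10 [Wx1 Qx1]].
have h1 := psiP n x1 x10.
have h2 : \forall x \near x1, W (toS (rVpoly x)).
  by apply: (continuous_toS x10); exact: open_nbhs_nbhs.
have h3 : \forall x \near x1, rVpoly x != 0 := open_nbhs_nbhs (conj (@open_rVpoly_neq0 R n) x10).
near=> x; split; first by near: x.
have Wtx : W (toS (rVpoly x)) by near: x.
split => //; rewrite /Q -Qx1.
have /addF2_shift -> : psi (rVpoly x) + psi (rVpoly x1) = z (toS (rVpoly x)) (toS (rVpoly x1)) by near: x.
have := zW _ _ _ Wx Wtx Wx1; rewrite -addrA => /addF2_eq0 ->.
by move: (psi _) (z _ _) (z _ _) => a b c; f2.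
Unshelve. all: by end_near. Qed.

End sphere_cohomology.

(** * The generator for the infinite projective space *)

Section generator.
Context {R : realType}.
Let S := Sinfty R.
Let P := RPinfty R.

Lemma symS : symmetric_set S.
Proof. by move=> p /SinftyE pp; apply/SinftyE; rewrite ipNl ipNr opprK. Qed.

Lemma odd_id : odd_sphere (id : S -> S).
Proof. by split=> // x y. Qed.

Lemma pi_continuousS : continuous (\pi_P : S -> P).
Proof. exact: pi_continuous. Qed.

Definition w0 : cochain P 1 := fun s => ccP (id : S -> S) (s ord0) (s (lift ord0 ord0)).

Lemma cochain2_w0 : cochain2 w0 = ccP (id : S -> S).
Proof. by []. Qed.

Lemma w0_pi (x y : S) : cochain2 w0 (\pi_P x) (\pi_P y) = cc (set_val x) (set_val y).
Proof. by rewrite cochain2_w0 (ccP_pi x y odd_id). Qed.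

Lemma w0_cocycle : cocycle w0.
Proof.
apply/cocycle2P => a; have [c cP] := ccP_homologous symS odd_id odd_id.
by have [U Ua [zU _]] := cP a; exists U.
Qed.

(* Near [x], the double cover has the section given by the lifts close to [x]. *)
Lemma w0_local (x : S) : exists2 U : set S, nbhs x U &
  forall y y', U y -> U y' -> cochain2 w0 (\pi_P y) (\pi_P y') =
    sgn2 (set_val y) + sgn2 (set_val y').
Proof.
have [c _] := odd_sphere_ip (set_val x) odd_id.
exists [set y : S | 3/4 < ip (set_val x) (set_val y)].
  apply: open_nbhs_nbhs; split; last by rewrite /= ip_S; lra.
  by apply: (open_comp (f := fun y : S => ip (set_val x) (set_val y)) (D := [set z | 3/4 < z])); [move=> y _; apply: c | exact: open_gt].
move=> y y' /= xy xy'; rewrite w0_pi cc_acute//.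
by apply: ip_close xy xy'; exact: ip_S.
Qed.

(** If [w0] were locally the coboundary of [c], then [sgn2] plus the lift of [c] would be locally
    constant on the connected sphere; but it changes under the antipode. *)
Lemma w0_not_null : ~ null_class (n := 1) w0.
Proof.
move=> /null_class2P[c cP].
pose a (x : S) := sgn2 (set_val x) + c (\pi_P x).
have x0 : S := toS 1.
have : a (negS symS x0) = a x0.
  apply: sphere_connected => x; have [U Ux UP] := w0_local x.
  have [V Vx VP] := cP (\pi_P x).
  exists (U `&` \pi_P @^-1` V); first by apply: filterI => //; exact: pi_continuousS.
  move=> y y' [Uy Vy] [Uy' Vy'] /=.
  apply/addF2_eq0; have := VP _ _ Vy Vy'; rewrite UP// /a => e.
  by rewrite addrACA e addF2.
rewrite /a (_ : \pi_P (negS symS x0) = \pi_P x0); last first.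
  by apply/pi_eq; right; rewrite opprK.
move/addIr; rewrite [set_val (negS _ _)]/= sgn2N ?S_neq0// => /eqP.
by rewrite -subr_eq0 addrAC subrr add0r oner_eq0.
Qed.

(** On the sphere, [z] becomes the coboundary of some [psi]. The sum of [psi] and its reflection is
    locally constant, hence a constant [a], so that [psi + a * sgn2] is even and descends to a
    cochain whose coboundary is [z - a * w0]. *)
Lemma generator_w0 : generator1 w0.
Proof.
split; first exact: w0_cocycle.
move=> z /cocycle2P zP.
pose zS (x y : S) := cochain2 z (\pi_P x) (\pi_P y).
have [|psi psiP] := @sphere_H1 R zS.
  move=> x; have [U Ux zU] := zP (\pi_P x); exists (\pi_P @^-1` U); first exact: pi_continuousS.
  by move=> a b c; exact: zU.
pose d x := psi x + psi (negS symS x).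
have piN x : \pi_P (negS symS x) = \pi_P x by apply/pi_eq; right; rewrite opprK.
have cN : continuous (negS symS).
  move=> x U [_ /= [[W oW <-]] Wx WU].
  have : nbhs x (set_val @^-1` (fun p : Rinfty R => W (- p))).
    apply: initial_continuous; apply: open_nbhs_nbhs; split => //.
    rewrite /open /= => n.
    rewrite (_ : [set _ | _] = -%R @^-1` [set v : 'rV[R]_n | W (rVpoly v)]).
      by apply: open_comp; [move=> v _; exact: opp_continuous | exact: oW].
    by apply/seteqP; split=> v /=; rewrite linearN.
  by apply: filterS => y Wy; exact: WU.
have dconst x y : d x = d y.
  move: x y; apply: sphere_connected => x.
  have [U Ux UP] := psiP x; have [V Vx VP] := psiP (negS symS x).
  exists (U `&` negS symS @^-1` V); first by apply: filterI => //; exact: cN.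
  move=> y y' [Uy Vy] [Uy' Vy']; apply/addF2_eq0.
  by rewrite /d addrACA -UP// -VP// /zS !piN addF2.
pose a := d (toS 1).
exists a; apply/null_class2P.
pose c (b : P) := psi (repr b) + a * sgn2 (set_val (repr b)).
have cE (x : S) : c (\pi_P x) = psi x + a * sgn2 (set_val x).
  have /pi_eq[e|e] : \pi_P x = \pi_P (repr (\pi_P x)) by rewrite reprK.
    by rewrite /c (_ : repr _ = x)//; apply: val_inj.
  have -> : c (\pi_P x) = c (\pi_P (negS symS x)) by rewrite piN.
  rewrite /c piN (_ : repr _ = negS symS x); last by apply: val_inj.
  rewrite [set_val (negS _ _)]/= sgn2N ?S_neq0// mulrDr mulr1 /a (dconst _ x) /d.
  by move: (psi _) (psi _) (sgn2 _) => *; f2.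
exists c => b; have [x <-] := pi_surj b.
have [U Ux UP] := psiP x; have [V Vx VP] := w0_local x.
have [UV [oUV UVx] UVP] : exists2 Q, open Q /\ Q x & Q `<=` U `&` V.
  have : nbhs x (U `&` V) by exact: filterI.
  by rewrite nbhsE => -[Q [? ?] ?]; exists Q.
have [|B Bx BP] := @nbhs_pi R _ S symS UV x oUV _ UVx.
  by apply: (open_comp (f := negS symS)) => // y _; exact: cN.
exists B => // _ _ /BP[y <- /UVP[Uy Vy]] /BP[y' <- /UVP[Uy' Vy']].
rewrite !cE [LHS](_ : _ = zS y y' - a * cochain2 w0 (\pi_P y) (\pi_P y'))//.
rewrite UP// VP// oppF2.
by move: (a) (psi _) (psi _) (sgn2 _) (sgn2 _) => *; f2.
Qed.

(** [w0] is a multiple of the class of [w], and not the zero multiple since it is not null; over a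
    field of two elements the factor is 1. *)
Lemma generator_homologous w : generator1 w -> exists c : P -> 'F_2,
  forall a : P, exists2 U : set P, nbhs a U & cocycle_on (cochain2 w) U /\
    forall b b', U b -> U b' -> cochain2 w b b' + cochain2 w0 b b' = c b + c b'.
Proof.
move=> [/cocycle2P cw /(_ _ w0_cocycle)[a]].
have [->|->] := F2_cases a.
  move=> h; exfalso; apply: w0_not_null; move: h.
  by under eq_fun do rewrite mul0r subr0.
move=> /null_class2P[c cP]; exists c => b.
have [U Ub wU] := cw b; have [V Vb VP] := cP b.
exists (U `&` V); first exact: filterI.
split; first by move=> x y t [? _] [? _] [? _]; exact: wU.
by move=> x y [_ Vx] [_ Vy]; rewrite -VP// /cochain2 mul1r oppF2 addrC.
Qed.

End generator.

(** * Bounds on the index *)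

Section index_bounds.
Context {R : realType} {E : preTopologicalLmodType R} (M : set E).
Hypothesis symM : symmetric_set M.
Let P := projectivization M.

Lemma cochain2_pullback (X Y : topologicalType) (theta : X -> Y) w a b :
  cochain2 (pullback theta w) a b = cochain2 w (theta a) (theta b).
Proof. by rewrite /cochain2 /pullback; congr w; apply/funext => i /=; case: eqP. Qed.

(** Trades the classifying map and the generator for an odd map into the sphere; by
    [power_null_indep] the choice of this map is then immaterial. *)
Lemma pullback_power_neq0P m : pullback_power_neq0 M m <->
  exists2 Th : M -> Sinfty R, odd_sphere Th & ~ power_null (@ccP R E M Th) m.
Proof.
have thE (theta : P -> RPinfty R) (Th : M -> Sinfty R) : odd_sphere Th ->
    (forall x, theta (\pi_P x) = \pi_(RPinfty R) (Th x)) ->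
    forall a b, cochain2 (pullback theta w0) a b = ccP Th a b.
  move=> oT tT a b; have [x <-] := pi_surj a; have [y <-] := pi_surj b.
  by rewrite cochain2_pullback !tT w0_pi ccP_pi.
split=> [[theta [w [[ct [Th [cT oT tT]]] gw]]]|[Th oT nT]].
  rewrite pullback_cup_power null_class_power => nw.
  have odT : odd_sphere Th by split.
  exists Th => // nT; apply: nw; apply: power_null_homologous nT.
  have [c cP] := generator_homologous gw.
  exists (c \o theta) => a; have [U Ua [wU wc]] := cP (theta a).
  exists (theta @^-1` U); first exact: ct.
  split; first by move=> x y z Ux Uy Uz; rewrite !cochain2_pullback wU.
  by move=> x y Ux Uy; rewrite -(thE theta _ odT tT) !cochain2_pullback wc.
pose theta (a : P) : RPinfty R := \pi_(RPinfty R) (Th (repr a)).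
have tT x : theta (\pi_P x) = \pi_(RPinfty R) (Th x).
  rewrite /theta; apply/pi_eq.
  have /pi_eq[e|e] : \pi_P x = \pi_P (repr (\pi_P x)) by rewrite reprK.
    by left; congr (set_val (Th _)); apply: val_inj.
  by right; rewrite (oT.2 _ _ e) opprK.
exists theta, w0; split.
- split; last by exists Th; split; [exact: oT.1 | exact: oT.2 |].
  apply/quotient_continuous => x.
  rewrite (_ : theta \o _ = \pi_(RPinfty R) \o Th); last by apply/funext => y /=; exact: tT.
  by apply: continuous_comp; [exact: oT.1 | exact: pi_continuous].
- exact: generator_w0.
- rewrite pullback_cup_power null_class_power (_ : cochain2 _ = ccP Th)//.
  by apply/funext => a; apply/funext => b; exact: thE.
Qed.

Lemma coh_index_ge m : M !=set0 -> pullback_power_neq0 M m ->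
  ((m.+1%:R)%:E <= coh_index M)%E.
Proof.
move=> /set0P/eqP M0 nM; rewrite /coh_index; case: pselect => // ?.
by apply: ereal_sup_ubound; exists m.+1.
Qed.

(** The exponent [m] may exceed [k]: a supremum is all that is given, and the passage to lower
    powers is avoided. *)
Lemma coh_index_geP k : ((k.+1%:R)%:E <= coh_index M)%E ->
  M !=set0 /\ exists2 m, (k <= m)%N & pullback_power_neq0 M m.
Proof.
rewrite /coh_index; case: pselect => [e|M0].
  by rewrite lee_fin lern0.
move=> kM; split; first by apply/set0P/eqP.
apply: contrapT => nk.
suff : (ereal_sup [set m%:R%:E | m in [set m | (1 <= m)%N /\ pullback_power_neq0 M m.-1]]
        <= k%:R%:E :> \bar R)%E.
  by move=> /(le_trans kM); rewrite lee_fin ler_nat ltnn.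
apply: ge_ereal_sup => _ [m [m1 mM] <-]; rewrite lee_fin ler_nat leqNgt.
apply/negP => km; apply: nk; exists m.-1 => //.
by rewrite -ltnS prednK.
Qed.

Lemma coh_index_cover n (Xi : 'I_n -> M -> R) : (forall i, continuous (Xi i)) ->
  (forall i, odd_on (Xi i)) -> (forall x, exists i, Xi i x != 0) ->
  ((n.+1%:R)%:E <= coh_index M)%E -> False.
Proof.
move=> cX oX X0 /coh_index_geP[_ [m nm /pullback_power_neq0P[Th oT]]]; apply.
exact: power_null_cover oT cX oX X0 nm.
Qed.

(* Normalizing the values of an odd map into a punctured R^n. *)
Lemma odd_sphere_of_cover n (Xi : 'I_n -> M -> R) : (forall i, continuous (Xi i)) ->
  (forall i, odd_on (Xi i)) -> (forall x, exists i, Xi i x != 0) ->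
  exists Th : M -> Sinfty R, odd_sphere Th.
Proof.
move=> cX oX X0; pose f x : 'rV[R]_n := \row_i Xi i x.
have f0 x : rVpoly (f x) != 0.
  rewrite rVpoly_neq0; apply/eqP => /rowP fx; have [i] := X0 x.
  by have := fx i; rewrite !mxE => ->; rewrite eqxx.
exists (fun x => toS (rVpoly (f x))); split.
  move=> x; apply: (@continuous_comp M 'rV[R]_n _ f (fun y => toS (rVpoly y))).
    apply: cvg_rowP => i; rewrite (_ : (fun _ => _) = Xi i); first exact: cX.
    by apply/funext => y; rewrite mxE.
  exact: continuous_toS.
move=> x y xy; rewrite (_ : f y = - f x); first by rewrite linearN (toSN (f0 x)).
by apply/rowP => i; rewrite !mxE (oX i _ _ xy).
Qed.

End index_bounds.

Section index_image.
Context {R : realType} {E E' : preTopologicalLmodType R} (M : set E) (N : set E').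
Hypotheses (symM : symmetric_set M) (symN : symmetric_set N).

(** The functions [Xi] provide an odd map from [N] to the sphere, in place of a general existence
    theorem for classifying maps. Composed with [h] it classifies [M], and a null power on [N] pulls
    back to a null power on [M]. *)
Lemma coh_index_map k (h : M -> N) n (Xi : 'I_n -> N -> R) : continuous h ->
  odd_on (fun x => set_val (h x)) -> (forall i, continuous (Xi i)) ->
  (forall i, odd_on (Xi i)) -> (forall x, exists i, Xi i x != 0) ->
  ((k.+1%:R)%:E <= coh_index M)%E -> ((k.+1%:R)%:E <= coh_index N)%E.
Proof.
move=> ch oh cX oX X0 /coh_index_geP[[x Mx] [m km nM]].
have [Th oT nT] := iffLR (@pullback_power_neq0P R E M m) nM.
have [Xh oX'] := odd_sphere_of_cover cX oX X0.
apply: (@le_trans _ _ (m.+1%:R)%:E); first by rewrite lee_fin ler_nat.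
apply: coh_index_ge.
  by exists (set_val (h (exist _ x (mem_set Mx)))); exact: set_valP.
apply/(@pullback_power_neq0P R E' N m); exists Xh => // nX; apply: nT.
have ohX : odd_sphere (Xh \o h).
  split; first by move=> y; apply: continuous_comp; [exact: ch | exact: oX'.1].
  by move=> u v uv; apply: oX'.2; exact: oh.
by apply: power_null_indep ohX oT _ => //; exact: power_null_image nX.
Qed.

End index_image.

(** * Evaluation of cochains on triangulated hemispheres *)

Section join_functional.
Context {R : realType}.
Variables (k N : nat).
Let V := 'rV[R]_k.+1.

(** Lets an equality of cochains that is known on small simplices only pass through [prism]. *)
Lemma eq_prism (X : eqType) (Y : Type) (H H' : X -> Y) (phi psi : seq Y -> 'F_2) (s : seq X) :
  (forall t, size t = (size s).+1 ->
    alls (fun w => exists2 x, x \in s & w = H x \/ w = H' x) t -> phi t = psi t) ->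
  prism H H' phi s = prism H H' psi s.
Proof.
elim: s phi psi => //= x s IH phi psi e; congr (_ + _).
  apply: e => /=; first by rewrite size_map.
  split; first by exists x; [exact: mem_head | left].
  split; first by exists x; [exact: mem_head | right].
  suff : forall s', {subset s' <= s} -> alls (fun w => exists2 y, y \in x :: s & w = H y \/ w = H' y) (map H' s').
    exact.
  elim=> //= y s' IH' ss; split.
    by exists y; [rewrite inE ss ?orbT// mem_head | right].
  by apply: IH' => w ws; apply: ss; rewrite inE ws orbT.
apply: IH => t ts At; apply: e => /=; first by rewrite ts.
split; first by exists x; [exact: mem_head | left].
by apply: sub_alls At => w [y ys yw]; exists y => //; rewrite inE ys orbT.
Qed.

Definition vertex (j : nat) : V := \row_i (i == j :> nat)%:R.

Definition cone j (i : nat) (x : V) : V :=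
  (1 - i%:R / N%:R) *: x + (i%:R / N%:R) *: vertex j.

(* Evaluation on a hemisphere of dimension [j], triangulated by coning the sphere of dimension
   [j - 1], i.e. a hemisphere and its antipode, to [vertex j] in [N] steps. *)
Fixpoint chain (j : nat) : (seq V -> 'F_2) -> 'F_2 :=
  match j with
  | 0 => fun phi => phi [:: vertex 0]
  | j'.+1 => fun phi => \sum_(i < N)
     (chain j' (prism (cone j'.+1 i) (cone j'.+1 i.+1) phi) +
      chain j' (prism (cone j'.+1 i) (cone j'.+1 i.+1) phi \o map -%R))
  end.

(** In the l1 norm, coning a face to a new coordinate vertex stays on the unit sphere, so that no
    normalization enters the triangulation. *)
Definition l1 (x : V) : R := \sum_i `|x 0 i|.
Definition face j : set V := [set x | l1 x = 1 /\ forall i : 'I_k.+1, (j < i)%N -> x 0 i = 0].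

Lemma faceN j x : face j x -> face j (- x).
Proof.
move=> [x1 xj]; split; last by move=> i ji; rewrite mxE xj// oppr0.
by rewrite -x1; apply: eq_bigr => i _; rewrite mxE normrN.
Qed.

Lemma l1_vertex j : (j <= k)%N -> l1 (vertex j) = 1.
Proof.
rewrite -ltnS => jk; rewrite /l1 (bigD1 (Ordinal jk))//= mxE eqxx normr1 big1 ?addr0// => i ij.
rewrite mxE; suff -> : (i == j :> nat) = false by rewrite normr0.
by apply/negbTE; apply: contraNneq ij => e; apply/eqP/val_inj.
Qed.

Lemma face_vertex j : (j <= k)%N -> face j (vertex j).
Proof.
move=> jk; split; first exact: l1_vertex.
by move=> i ji; rewrite mxE gtn_eqF.
Qed.

Lemma face_norm_le1 x : l1 x = 1 -> `|x| <= 1.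
Proof.
move=> x1; rewrite [leLHS]/Num.norm /= mx_normrE; apply: bigmax_le => // -[a i] _ /=.
by rewrite -x1 /l1 (bigD1 i)//= !ord1 lerDl sumr_ge0.
Qed.

Hypothesis N0 : (0 < N)%N.

Let NR : (0 : R) < N%:R. Proof. by rewrite ltr0n. Qed.

Lemma cone_time i : (i <= N)%N -> 0 <= (i%:R / N%:R : R) <= 1.
Proof.
by move=> iN; rewrite divr_ge0//= ler_pdivrMr// mul1r ler_nat.
Qed.

Lemma face_cone j i x : (j < k)%N -> (i <= N)%N -> face j x -> face j.+1 (cone j.+1 i x).
Proof.
move=> jk /cone_time; rewrite /cone; set t := _ / _ => /andP[t0 t1] [x1 xj]; split; last first.
  move=> l jl; rewrite !mxE xj ?(ltn_trans _ jl)// mulr0 gtn_eqF//.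
  by rewrite mulr0 addr0.
rewrite /l1; under eq_bigr => l _.
  rewrite !mxE (_ : `|_| = (1 - t) * `|x 0 l| + t * `|(vertex j.+1) 0 l|).
    over.
  rewrite mxE; case: eqP => lj.
    by rewrite xj ?lj// normr0 !mulr0 !add0r normrM normr1 ger0_norm.
  by rewrite normr0 !mulr0 !addr0 normrM ger0_norm// subr_ge0.
by rewrite big_split /= -!mulr_sumr -/(l1 _) x1 -/(l1 _) l1_vertex// !mulr1 subrK.
Qed.

Lemma cone_dist j i i' x y : (j <= k)%N -> (i <= N)%N -> (i' <= N)%N ->
  (i <= i'.+1)%N -> (i' <= i.+1)%N -> l1 x = 1 -> l1 y = 1 ->
  `|cone j i x - cone j i' y| <= `|x - y| + 2 / N%:R.
Proof.
move=> jk iN iN' ii' i'i x1 y1; rewrite /cone.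
have /andP[t0 t1] := cone_time iN.
have tt : `|i%:R / N%:R - i'%:R / N%:R| <= 1 / N%:R :> R.
  rewrite -mulrBl normrM (ger0_norm (x := N%:R^-1)) ?invr_ge0 ?ler0n//.
  rewrite ler_pM2r ?invr_gt0// ler_norml.
  have : (i%:R : R) <= i'.+1%:R by rewrite ler_nat.
  have : (i'%:R : R) <= i.+1%:R by rewrite ler_nat.
  by rewrite -!natr1; move: (i%:R) (i'%:R) => a b; lra.
move: t0 t1 tt; set t := _ / _; set t' := i'%:R / _ => t0 t1 tt.
have -> : (1 - t) *: x + t *: vertex j - ((1 - t') *: y + t' *: vertex j) =
  (1 - t) *: (x - y) + (t - t') *: (vertex j - y).
  by apply/rowP => l; rewrite !mxE; ring.
apply: le_trans (ler_normD _ _) _; rewrite !normrZ; apply: lerD.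
  by rewrite ler_piMl// ger0_norm ?subr_ge0// gerBl.
rewrite mulrC [leRHS](_ : _ = 2 * (1 / N%:R)); last by rewrite mulrA mulr1.
apply: ler_pM => //; apply: le_trans (ler_normB _ _) _.
by rewrite (_ : 2 = 1 + 1) //; apply: lerD; apply: face_norm_le1 => //; exact: l1_vertex.
Qed.

(** The simplices on which [chain j] evaluates its cochain. Each coning step adds at most 2/N to the
    diameter. *)
Definition good j (s : seq V) := [/\ size s = j.+1, {in s, forall x, face j x} &
  {in s &, forall x y, `|x - y| <= j%:R * (2 / N%:R)}].

Lemma allsP (P : set V) s : alls P s <-> {in s, forall x, P x}.
Proof.
split=> [|Ps]; first by elim: s => //= x s IH [Px Ps] y; rewrite inE => /predU1P[->//|]; exact: IH.
elim: s Ps => //= x s IH Ps; split; first by apply: Ps; exact: mem_head.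
by apply: IH => y ys; apply: Ps; rewrite inE ys orbT.
Qed.

Lemma good_cone j i s t : (j < k)%N -> (i < N)%N -> good j s -> size t = (size s).+1 ->
  alls (fun w => exists2 x, x \in s & w = cone j.+1 i x \/ w = cone j.+1 i.+1 x) t ->
  good j.+1 t.
Proof.
move=> jk iN [ss fs ds] ts /allsP At; split; first by rewrite ts ss.
  move=> w /At[x /fs fx [->|->]]; apply: face_cone => //; exact: ltnW.
move=> w w' /At[x xs wx] /At[x' xs' wx'].
have h i1 i2 : (i1 <= N)%N -> (i2 <= N)%N -> (i1 <= i2.+1)%N -> (i2 <= i1.+1)%N ->
    `|cone j.+1 i1 x - cone j.+1 i2 x'| <= j.+1%:R * (2 / N%:R).
  move=> *; apply: le_trans (cone_dist jk _ _ _ _ _ _) _ => //; [by case: (fs x xs)|by case: (fs x' xs')|].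
  by rewrite -(natr1 j) [leRHS]mulrDl mul1r lerD2r ds.
by case: wx => ->; case: wx' => ->; apply: h => //; exact: ltnW.
Qed.

Lemma good_opp j s : good j s -> good j (map -%R s).
Proof.
move=> [ss fs ds]; split; first by rewrite size_map.
  by move=> _ /mapP[x xs ->]; apply: faceN; exact: fs.
by move=> _ _ /mapP[x xs ->] /mapP[y ys ->]; rewrite -opprD normrN; exact: ds.
Qed.

Lemma eq_chain j phi psi : (j <= k)%N -> (forall s, good j s -> phi s = psi s) ->
  chain j phi = chain j psi.
Proof.
elim: j phi psi => [|j IH] phi psi jk e /=.
  apply: e; split=> //.
    by move=> x; rewrite inE => /eqP->; exact: face_vertex.
  by move=> x y; rewrite !inE => /eqP-> /eqP->; rewrite subrr normr0 mul0r.
have h (i : 'I_N) s : good j s ->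
    prism (cone j.+1 i) (cone j.+1 i.+1) phi s = prism (cone j.+1 i) (cone j.+1 i.+1) psi s.
  by move=> gs; apply: eq_prism => t ts At; apply: e; exact: good_cone At.
apply: eq_bigr => i _; congr (_ + _); apply: IH; do ?exact: ltnW; move=> s gs /=.
  exact: h.
by apply: h; exact: good_opp.
Qed.

Lemma chainD j phi psi : chain j (fun s => phi s + psi s) = chain j phi + chain j psi.
Proof.
elim: j phi psi => //= j IH phi psi; rewrite -big_split; apply: eq_bigr => i _ /=.
have -> : prism (cone j.+1 i) (cone j.+1 i.+1) (fun s => phi s + psi s) =
    fun s => prism (cone j.+1 i) (cone j.+1 i.+1) phi s + prism (cone j.+1 i) (cone j.+1 i.+1) psi s.
  by apply/funext => s; exact: prismD.
by rewrite IH (IH (prism _ _ phi \o map -%R) (prism _ _ psi \o map -%R)) addrACA.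
Qed.

Definition cycl j phi := chain j phi + chain j (phi \o map -%R).

Lemma cyclD j phi psi : cycl j (fun s => phi s + psi s) = cycl j phi + cycl j psi.
Proof. by rewrite /cycl (chainD j (phi \o map -%R) (psi \o map -%R)) chainD addrACA. Qed.

Lemma map_oppK (phi : seq V -> 'F_2) : (phi \o map -%R) \o map -%R = phi.
Proof. by apply/funext => s /=; rewrite -map_comp (eq_map opprK) map_id. Qed.

Lemma cycl_opp j phi : cycl j (phi \o map -%R) = cycl j phi.
Proof. by rewrite /cycl map_oppK addrC. Qed.

(** The boundary of a hemisphere is the sphere one dimension lower. The N layers telescope between
    [cone 0], the identity, and [cone N], which is constant; on the constant end the two antipodal
    halves cancel modulo 2. *)
Lemma chain_dl_aux j phi : (forall psi, cycl j (dl psi) = 0) ->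
  chain j.+1 (dl phi) = cycl j phi.
Proof.
move=> Z; pose a i := cycl j (phi \o map (cone j.+1 i)).
transitivity (\sum_(i < N) (a i + a i.+1)).
  apply: eq_bigr => i _.
  have -> : prism (cone j.+1 i) (cone j.+1 i.+1) (dl phi) =
    fun s => dl (prism (cone j.+1 i) (cone j.+1 i.+1) phi) s +
      ((phi \o map (cone j.+1 i)) s + (phi \o map (cone j.+1 i.+1)) s).
    apply/funext => s; have /addF2_shift -> := prism_dl (cone j.+1 i) (cone j.+1 i.+1) phi s.
    by rewrite addrC (addrC (phi _)).
  rewrite -/(cycl _ _) cyclD Z add0r.
  exact: cyclD.
rewrite telescope2 /a.
have -> : phi \o map (cone j.+1 0) = phi.
  apply/funext => s /=; congr phi; rewrite -[RHS]map_id; apply: eq_map => x.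
  by rewrite /cone mul0r subr0 scale1r scale0r addr0.
suff -> : cycl j (phi \o map (cone j.+1 N)) = 0 by rewrite addr0.
rewrite /cycl (_ : (phi \o map (cone j.+1 N)) \o map -%R = phi \o map (cone j.+1 N)) ?addF2//.
apply/funext => s /=; congr phi; rewrite -map_comp; apply: eq_map => x /=.
by rewrite /cone divff ?gt_eqF// subrr !scale0r.
Qed.

(** A sphere is made of two hemispheres with a common boundary, which cancels modulo 2. This and
    [chain_dl_aux] support each other in the induction on dimension. *)
Lemma cycl_dl j phi : cycl j (dl phi) = 0.
Proof.
elim: j phi => [|j IH] phi; first by rewrite /cycl /= !addr0 addF2.
rewrite /cycl (_ : dl phi \o map -%R = dl (phi \o map -%R)); last first.
  by apply/funext => s /=; exact: dl_map.
by rewrite !chain_dl_aux// cycl_opp addF2.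
Qed.

Lemma chain_dl j phi : chain j.+1 (dl phi) = cycl j phi.
Proof. by apply: chain_dl_aux => psi; exact: cycl_dl. Qed.

(** Upstairs the class is the coboundary of [sg], hence its power is the coboundary of [sg] times
    the lower power [C]. On the boundary sphere [C] is even and [sg] changes by 1 under the
    antipode, so that the two halves add up to [C] on one hemisphere. *)
Lemma chain_cup (sg : V -> 'F_2) j : (j <= k)%N ->
  (forall x, l1 x = 1 -> sg (- x) = sg x + 1) ->
  chain j (cprod (fun x y => sg x + sg y) (nseq j (fun=> 0))) = 1.
Proof.
move=> jk sgN; elim: j jk => // j IH jk.
set z := fun x y => _; set C := cprod z _ in IH.
have zT : cocycle_on z setT.
  by move=> x y w _ _ _; rewrite /z; move: (sg _) (sg _) (sg _) => a b c; f2.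
have CN t : alls (fun x => l1 x = 1) t -> C (map -%R t) = C t.
  rewrite /C; elim: (j) t => // m IHm [|x [|y t]]//= [x1 [y1 t1]].
  have /= -> := IHm (y :: t) (conj y1 t1).
  rewrite /z !sgN//; congr (_ * _).
  by move: (sg _) (sg _) => a b; f2.
have dC : forall s, good j.+1 s -> cprod z (nseq j.+1 (fun=> 0)) s = dl (cup0 sg C) s.
  move=> [|x [|y s]] [// [] // ss _ _].
  rewrite dl_cup0 (cprod_closed zT) ?size_nseq /= ?ss ?mulr0 ?addr0//.
  by do 2 split => //; apply/allsP => ? _.
rewrite (eq_chain _ dC)// chain_dl /cycl -chainD -(IH (ltnW jk)).
apply: eq_chain; first exact: ltnW.
move=> [|x s] [// _ fs _] /=.
have fa : alls (fun x => l1 x = 1) (x :: s) by apply/allsP => y /fs[].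
rewrite sgN; last by have [] := fs x (mem_head _ _).
have /= -> := CN _ fa.
by move: (sg _) (C _) => a b; f2.
Qed.

End join_functional.

Section sphere_index.
Context {R : realType} (k : nat).
Local Notation V := 'rV[R]_k.+1.
Local Notation VP := (('rV[R]_k.+1 : normedModType R) : preTopologicalLmodType R).

Definition l1_sphere : set V := [set x | l1 x = 1].

Lemma l1_sphere_sym : @symmetric_set R VP l1_sphere.
Proof. by move=> x x1; rewrite /l1_sphere /= -x1; apply: eq_bigr => i _; rewrite mxE normrN. Qed.

Lemma continuous_l1 : continuous (@l1 R k).
Proof.
move=> x; have := @continuous_at_sum R V R _ (index_enum 'I_k.+1) (fun i (y : V) => `|y 0 i|) x.
apply => i; apply: (@continuous_comp V R R (fun y : V => y 0 i) Num.norm); first exact: coord_continuous.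
exact: norm_continuous.
Qed.

Lemma l1_sphere_compact : compact l1_sphere.
Proof.
apply: bounded_closed_compact.
  exists 1; split; first exact: real1.
  by move=> r r1 x x1; apply: le_trans (face_norm_le1 x1) _; exact: ltW.
rewrite (_ : l1_sphere = @l1 R k @^-1` [set 1])//.
by apply: preimage_closed; [move=> x _; exact: continuous_l1 | exact: closed_eq].
Qed.

Let K := set_type l1_sphere.
Let P := @projectivization R VP l1_sphere.

Lemma sphere_power_not_null (Th : K -> Sinfty R) : @odd_sphere R VP l1_sphere Th ->
  ~ power_null (@ccP R VP l1_sphere Th) k.
Proof.
move=> oT [eta etaP].
have v01 : l1_sphere (vertex k 0) by exact: l1_vertex.
pose v0 : K := exist (fun x => x \in l1_sphere) _ (mem_set v01).
pose kap (x : V) : K := insubd v0 x.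
have kapE x : l1 x = 1 -> set_val (kap x) = x.
  by move=> x1; rewrite /kap; exact: (insubdK v0 (mem_set x1)).
have valkap (x : K) : kap (set_val x) = x by exact: valKd.
have kapN x : l1 x = 1 -> set_val (kap (- x)) = - set_val (kap x).
  by move=> x1; rewrite !kapE//; exact: l1_sphere_sym.
pose p x : P := \pi_P (kap x).
have pN x : l1 x = 1 -> p (- x) = p x.
  by move=> x1; apply/pi_eq; right; rewrite kapN// opprK.
pose sg x := sgn2 (set_val (Th (kap x))).
have sgN x : l1 x = 1 -> sg (- x) = sg x + 1.
  by move=> x1; rewrite /sg (oT.2 _ _ (kapN x x1)) sgn2N ?S_neq0.
pose A s := cprod (fun x y => sg x + sg y) (nseq k (fun=> 0)) s =
  (if k is 0 then fun=> 0 else dl (eta \o map p)) s.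
(* A null power agrees with the coboundary on small simplices only; compactness of the sphere gives
   an [N] for which all [good] simplices are small enough. *)
have [N N0 NP] : exists2 N, (0 < N)%N & forall s, good N k s -> A s.
  have /compact_near_coveringP cov := l1_sphere_compact.
  have [] := cov nat \oo (fun n x => forall s, size s = k.+1 ->
      {in s, forall y, l1 y = 1} -> {in s, forall y, `|x - y| <= k%:R * (2 / n.+1%:R)} -> A s);
      last first.
    move=> n _ nP; exists n.+1 => // s [ss fs ds].
    case: s ss fs ds => // x s ss fs ds; apply: (nP n _ x) => //=.
    - by case: (fs x (mem_head _ _)).
    - by move=> y /fs[].
    - by move=> y ys; apply: ds => //; exact: mem_head.
  move=> x0 x01; have [U Ux UP] := etaP (p x0).
  have [c1 _] := @odd_sphere_ip R VP l1_sphere Th (set_val (Th (kap x0))) oT.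
  have : nbhs (kap x0) [set y : K | U (\pi_P y) /\ 3/4 < ip (set_val (Th (kap x0))) (set_val (Th y))].
    have piC : continuous (\pi_P : K -> P) by exact: pi_continuous.
    apply: (@filterI _ (nbhs (kap x0)) _ [set y : K | U (\pi_P y)]); first exact: (piC (kap x0) _ Ux).
    apply: open_nbhs_nbhs; split; last by rewrite /= ip_S; lra.
    by apply: (open_comp (f := fun y : K => ip (set_val (Th (kap x0))) (set_val (Th y)))
       (D := [set z | 3/4 < z])); [move=> y _; apply: c1 | exact: open_gt].
  move=> [_ /= [[D oD <-] Dx DU]].
  have /nbhs_ballP[e /= e0 eD] : nbhs x0 D.
    by apply: open_nbhs_nbhs; split => //; move: Dx; rewrite /= kapE.
  have e2 : 0 < e / 2 by rewrite divr_gt0.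
  exists (ball x0 (e / 2), [set n | k%:R * (2 / n.+1%:R) <= e / 2 :> R]).
    split; first exact: nbhsx_ballx.
    have : (k%:R * 2 * (n.+1%:R^-1 : R)) @[n --> \oo] --> (k%:R * 2 * 0 : R).
      by apply: cvgMr; exact: cvg_harmonic.
    rewrite mulr0 => /(@cvgr_dist_le R _ _ _ _) /(_ _ e2); apply: filterS => n /=.
    by rewrite sub0r normrN mulrA; apply: le_trans; exact: ler_norm.
  move=> [x n] /= [xx0 ne] s ss s1 sx.
  have sD : {in s, forall y, D y}.
    move=> y ys; apply: eD; rewrite -ball_normE /=.
    rewrite (_ : x0 - y = (x0 - x) + (x - y)); last by rewrite addrA subrK.
    apply: le_lt_trans (ler_normD _ _) _; rewrite [ltRHS](splitr e) ltr_leD//.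
      by move: xx0; rewrite -ball_normE.
    exact: le_trans (sx y ys) ne.
  have sU y : y \in s -> U (p y) /\ 3/4 < ip (set_val (Th (kap x0))) (set_val (Th (kap y))).
    by move=> ys; apply: DU; rewrite /= kapE ?s1//; exact: sD.
  rewrite /A; transitivity (cprod (@ccP R VP l1_sphere Th) (nseq k (fun=> 0)) (map p s)).
    suff h m s' : (forall y, y \in s' -> U (p y) /\ 3/4 < ip (set_val (Th (kap x0))) (set_val (Th (kap y)))) ->
        cprod (fun x y => sg x + sg y) (nseq m (fun=> 0)) s' =
        cprod (@ccP R VP l1_sphere Th) (nseq m (fun=> 0)) (map p s') by exact: h.
    elim: m s' => // m IH [|x' [|y s']]// sU'; rewrite /= (IH (y :: s'))/=; last first.
      by move=> w ws; apply: sU'; rewrite inE ws orbT.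
    congr (_ * _); rewrite !addr0 ccP_pi// cc_acute//.
    have [_ h1] := sU' x' (mem_head _ _).
    have [_ h2] : U (p y) /\ 3/4 < ip (set_val (Th (kap x0))) (set_val (Th (kap y))).
      by apply: sU'; rewrite !inE eqxx orbT.
    by apply: ip_close h1 h2; exact: ip_S.
  rewrite UP ?size_map//; last first.
    suff h s' : {subset s' <= s} -> alls U (map p s') by exact: h.
    elim: s' => //= y s' IH ss'; split; first by case: (sU y (ss' _ (mem_head _ _))).
    by apply: IH => w ws; apply: ss'; rewrite inE ws orbT.
  suff h j : (if j is 0 then 0 else dl eta (map p s)) = (if j is 0 then fun=> 0 else dl (eta \o map p)) s by exact: h.
  by case: j => // m; rewrite dl_map.
have := @chain_cup R k N N0 sg k (leqnn k) sgN.
rewrite (eq_chain N0 (leqnn k) NP).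
have c0 j : @chain R k N j (fun=> 0) = 0.
  have := @chainD R k N j (fun=> 0) (fun=> 0); by rewrite !addF2.
(* The cochain comes from the projectivization, so it takes equal values on the two halves of the
   boundary sphere. *)
have -> : @chain R k N k (if k is 0 then fun=> 0 else dl (eta \o map p)) = 0.
  suff h j : (j <= k)%N -> @chain R k N j (if j is 0 then fun=> 0 else dl (eta \o map p)) = 0.
    exact: h.
  case: j => // j jk; rewrite chain_dl// /cycl -chainD -[RHS](c0 j).
  apply: eq_chain => //; first exact: ltnW.
  move=> s [_ fs _] /=; rewrite -map_comp.
  suff -> : map (p \o -%R) s = map p s by rewrite addF2.
  by apply/eq_in_map => x /fs[x1 _] /=; exact: pN.
by move/eqP; rewrite eq_sym oner_eq0.
Qed.

End sphere_index.

Local Close Scope quotient_scope.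

Section finite_type.
Context {R : realType} {W : completeNormedModType R}.
Implicit Types (M N X : set W).

(** An odd map into a punctured R^n, by components. It serves twice: to bound the index from above
    and to provide the classifying map that [coh_index_map] asks for. *)
Definition finite_type X := exists n, exists Xi : 'I_n -> W -> R,
  [/\ forall i, continuous (fun x : set_type X => Xi i (set_val x)),
      forall i u, X u -> Xi i (- u) = - Xi i u &
      forall u, X u -> exists i, Xi i u != 0].

Definition restrict (V : Type) (M : set V) N (h : V -> W) (hN : forall u, M u -> N (h u))
  (x : set_type M) : set_type N := exist _ (h (set_val x)) (mem_set (hN _ (set_valP x))).

Lemma continuous_restrict (V : topologicalType) (M : set V) N (h : V -> W)
    (hN : forall u, M u -> N (h u)) :
  continuous (fun x : set_type M => h (set_val x)) -> continuous (restrict hN).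
Proof.
move=> ch z U [_ /= [[D oD <-] Dz] DU].
have : nbhs z [set x | D (h (set_val x))] by apply: (ch z D); exact: open_nbhs_nbhs.
by apply: filterS => x Dx; exact: (DU (restrict hN x)).
Qed.

Lemma finite_type_preimage M N (h : W -> W) : (forall u, M u -> N (h u)) ->
  continuous (fun x : set_type M => h (set_val x)) ->
  (forall u, M u -> h (- u) = - h u) -> finite_type N -> finite_type M.
Proof.
move=> hN ch oh [n [Xi [cX oX X0]]]; exists n, (fun i u => Xi i (h u)); split.
- move=> i x; apply: (@continuous_comp _ _ _ (restrict hN) (fun y => Xi i (set_val y))).
    exact: continuous_restrict.
  exact: cX.
- by move=> i u Mu; rewrite oh// oX//; exact: hN.
- by move=> u /hN/X0.
Qed.

Lemma finite_typeS X Y : X `<=` Y -> finite_type Y -> finite_type X.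
Proof.
by move=> XY; apply: (@finite_type_preimage _ _ id) => //; exact: initial_continuous.
Qed.

Lemma finite_type_index X : finite_type X -> exists n : nat, forall M, symmetric_set M ->
  M `<=` X -> ((n.+1%:R)%:E <= coh_index M)%E -> False.
Proof.
move=> [n [Xi [cX oX X0]]]; exists n => M symM MX.
pose inc : set_type M -> set_type X := @restrict W M X id MX.
apply: (coh_index_cover symM (Xi := fun i x => Xi i (set_val x))).
- move=> i x; apply: (@continuous_comp _ _ _ inc (fun y => Xi i (set_val y))); last exact: cX.
  by apply: continuous_restrict; exact: initial_continuous.
- by move=> i x y /= ->; apply: oX; apply: (MX _ _); exact: set_valP.
- by move=> x; apply: X0; apply: (MX _ _); exact: set_valP.
Qed.

Lemma coh_index_image (V : preTopologicalLmodType R) (M : set V) N (h : V -> W) k :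
  @symmetric_set R V M -> finite_type N ->
  continuous (fun x : set_type M => h (set_val x)) ->
  (forall u, M u -> h (- u) = - h u) -> (forall u, M u -> N (h u)) ->
  ((k.+1%:R)%:E <= coh_index M)%E -> ((k.+1%:R)%:E <= coh_index N)%E.
Proof.
move=> symM [n [Xi [cX oX X0]]] ch oh hN.
apply: (@coh_index_map R V W M N symM k (restrict hN) n (fun i x => Xi i (set_val x))).
- exact: continuous_restrict.
- move=> x y xy; rewrite -[LHS]/(h (set_val y)) -[set_val (restrict _ x)]/(h (set_val x)) xy.
  exact/oh/set_valP.
- exact: cX.
- by move=> i x y /= ->; apply: oX; exact: set_valP.
- by move=> x; apply: X0; exact: set_valP.
Qed.

End finite_type.

Section l1_sphere_index.
Context {R : realType}.
Variable k : nat.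
Let VP := (('rV[R]_k.+1 : normedModType R) : preTopologicalLmodType R).

Lemma l1_sphere_nonempty : @l1_sphere R k !=set0.
Proof. by exists (vertex k 0); exact: l1_vertex. Qed.

Lemma coh_index_l1_sphere : ((k.+1%:R)%:E <= @coh_index R VP (@l1_sphere R k))%E.
Proof.
apply: (@coh_index_ge R VP); first exact: l1_sphere_nonempty.
have [||| Th oT] := @odd_sphere_of_cover R VP (@l1_sphere R k) k.+1 (fun i x => (set_val x : 'rV[R]_k.+1) 0 i).
- move=> i x; apply: (@continuous_comp (set_type (@l1_sphere R k)) 'rV[R]_k.+1 R set_val (fun y => y 0 i)).
    exact: initial_continuous.
  exact: coord_continuous.
- by move=> i x y ->; rewrite mxE.
- move=> x; apply: contrapT => /forallNP h.
  have /eqP := set_valP x; rewrite /l1 big1 ?(eq_sym 0) ?oner_eq0// => i _.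
  by have /negP/negPn/eqP -> := h i; rewrite normr0.
apply/(@pullback_power_neq0P R VP (@l1_sphere R k) k); exists Th => //.
exact: sphere_power_not_null.
Qed.

End l1_sphere_index.

(** * Weak compactness *)

Section duals.
Context {R : realType} {V : normedModType R}.
Implicit Types (l : dual V) (x y : V) (a : R).

Lemma dualD l x y : l (x + y) = l x + l y.
Proof. by have := dual_linear l 1 x y; rewrite !scale1r. Qed.

Lemma dual0 l : l 0 = 0.
Proof. by apply: (addrI (l 0)); rewrite -dualD !addr0. Qed.

Lemma dualZ l a x : l (a *: x) = a * l x.
Proof. by have := dual_linear l a x 0; rewrite !addr0 dual0 addr0. Qed.

Lemma dualN l x : l (- x) = - l x.
Proof. by rewrite -scaleN1r dualZ mulN1r. Qed.

Lemma dualB l x y : l (x - y) = l x - l y.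
Proof. by rewrite dualD dualN. Qed.

Lemma oppd l x : (- l) x = - l x. Proof. by []. Qed.
Lemma subd l l' x : (l - l') x = l x - l' x. Proof. by []. Qed.
Lemma scaled a l x : (a *: l) x = a * l x. Proof. by []. Qed.
Lemma zerod x : (0 : dual V) x = 0. Proof. by []. Qed.

Lemma dual_le l x : `|l x| <= `|l| * `|x|.
Proof.
have [->|x0] := eqVneq x 0; first by rewrite dual0 !normr0 mulr0.
have nx : 0 < `|x| by rewrite normr_gt0.
rewrite -ler_pdivrMr//.
have := @dual_norm_ub R V l (`|x|^-1 *: x).
rewrite normrZ normfV normr_id mulVf ?gt_eqF// lexx => /(_ isT).
by rewrite dualZ normrM normfV normr_id mulrC.
Qed.

Lemma dual_norming l e : 0 < e -> exists2 x, `|x| <= 1 & `|l| - e < l x.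
Proof.
move=> e0.
have := sup_adherent e0 (dual_norm_has_sup l); rewrite -/(dual_norm l).
move=> [_ [x /= x1 <-]] lx.
have [l0|l0] := leP 0 (l x); first by exists x => //; rewrite ger0_norm// in lx.
by exists (- x); rewrite ?normrN// dualN; rewrite ltr0_norm// in lx.
Qed.

Lemma exists_dual (f : V -> R) (C : R) : (forall a x y, f (a *: x + y) = a * f x + f y) ->
  (forall x, `|f x| <= C * `|x|) -> exists l : dual V, forall x, l x = f x.
Proof.
move=> lf fC; pose F : V -> R^o := f.
have linF : linear F by exact: lf.
have cF : continuous F.
  move=> x; apply/cvgrPdist_lt => e e0.
  have fB y : f x - f y = f (x - y).
    by have := lf (-1) y x; rewrite scaleN1r mulN1r addrC => ->; rewrite addrC.
  have C1 : 0 < `|C| + 1 by rewrite ltr_wpDl.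
  near=> y; rewrite /F fB; apply: le_lt_trans (fC _) _.
  apply: (@le_lt_trans _ _ ((`|C| + 1) * `|x - y|)).
    by rewrite ler_wpM2r// (le_trans (ler_norm C))// lerDl.
  rewrite -ltr_pdivlMl// mulrC; near: y.
  by apply: cvgr_dist_lt; [exact: cvg_id | rewrite divr_gt0].
by exists (Dual (introT (cont_linearP F) (conj linF cF))).
Unshelve. all: by end_near. Qed.

End duals.

(** * The Hahn-Banach theorem by minimal sublinear functions *)

Section hahn_banach.
Context {R : realType} {V : lmodType R}.
Implicit Types (p q : V -> R) (u x y : V).

Definition sublinear p := (forall x y, p (x + y) <= p x + p y) /\
  (forall t x, 0 <= t -> p (t *: x) = t * p x).

Lemma sublinear0 p : sublinear p -> p 0 = 0.
Proof. by move=> [_ pZ]; rewrite -(scale0r 0) pZ// mul0r. Qed.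

Lemma sublinearN p x : sublinear p -> - p (- x) <= p x.
Proof.
move=> sp; rewrite -subr_ge0 opprK -(sublinear0 sp) -(subrr x).
exact: sp.1.
Qed.

(* The largest sublinear function below [p] which is at most [- p u] at [- u]. *)
Definition flatten_at p u x := inf [set p (x + t *: u) - t * p u | t in [set t | 0 <= t]].

Lemma flatten_at_lb p u x : sublinear p ->
  has_lbound [set p (x + t *: u) - t * p u | t in [set t | 0 <= t]].
Proof.
move=> sp; exists (- p (- x)) => _ [t /= t0 <-].
rewrite -(sp.2 t u t0) lerBrDl -lerBrDr opprK.
by have := sp.1 (x + t *: u) (- x); rewrite addrAC subrr add0r.
Qed.

Lemma flatten_at_le p u x t : sublinear p -> 0 <= t ->
  flatten_at p u x <= p (x + t *: u) - t * p u.
Proof. by move=> sp t0; apply: ge_inf; [exact: flatten_at_lb | exists t]. Qed.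

Lemma flatten_at_ge p u x c : (forall t, 0 <= t -> c <= p (x + t *: u) - t * p u) ->
  c <= flatten_at p u x.
Proof.
move=> h; apply: lb_le_inf; first by exists (p (x + 0 *: u) - 0 * p u), 0 => /=.
by move=> _ [t /= t0 <-]; exact: h.
Qed.

Lemma flatten_at_sublinear p u : sublinear p -> sublinear (flatten_at p u).
Proof.
move=> sp; split=> [x y|t x].
  rewrite -lerBlDr; apply: flatten_at_ge => t t0.
  rewrite lerBlDr -lerBlDl; apply: flatten_at_ge => t' t'0.
  rewrite lerBlDl; apply: le_trans (flatten_at_le u (x + y) sp (addr_ge0 t0 t'0)) _.
  rewrite scalerDl addrACA mulrDl; have := sp.1 (x + t *: u) (y + t' *: u); lra.
rewrite le_eqVlt => /predU1P[<-|t0].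
  rewrite scale0r mul0r; apply/eqP; rewrite eq_le; apply/andP; split.
    have := flatten_at_le u 0 sp (lexx 0).
    by rewrite scale0r mul0r addr0 subr0 (sublinear0 sp).
  by apply: flatten_at_ge => t' t'0; rewrite add0r sp.2// subrr.
apply/eqP; rewrite eq_le; apply/andP; split.
  rewrite mulrC -ler_pdivrMr//; apply: flatten_at_ge => t' t'0.
  rewrite ler_pdivrMr//; apply: le_trans (flatten_at_le u (t *: x) sp (mulr_ge0 (ltW t0) t'0)) _.
  by rewrite -scalerA -scalerDr (sp.2 _ _ (ltW t0)) -mulrA -mulrBr mulrC.
apply: flatten_at_ge => t' t'0.
have tt : 0 <= t' / t by rewrite divr_ge0// ltW.
apply: le_trans (ler_wpM2l (ltW t0) (flatten_at_le u x sp tt)) _.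
rewrite mulrBr -(sp.2 t (x + (t' / t) *: u) (ltW t0)) scalerDr scalerA.
by rewrite !mulrA (mulrC t t') mulfK ?gt_eqF.
Qed.

Lemma minimal_sublinear p : sublinear p -> exists2 f, sublinear f /\ (forall x, f x <= p x) &
  forall q, sublinear q -> (forall x, q x <= f x) -> q = f.
Proof.
move=> sp.
pose T := {q : V -> R | sublinear q /\ forall x, q x <= p x}.
pose r (q q' : T) := `[< forall x, sval q' x <= sval q x >].
have [||||[f [sf fp]] fmin] := @Zorn T r.
- by move=> q; apply/asboolP.
- by move=> q q' q'' /asboolP h /asboolP h'; apply/asboolP => x; exact: le_trans (h x).
- move=> [q hq] [q' hq'] /asboolP/= h /asboolP/= h'.
  have e : q = q' by apply/funext => x; apply/eqP; rewrite eq_le h h'.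
  by move: hq hq' {h h'}; rewrite e => hq hq'; congr exist; exact: Prop_irrelevance.
- move=> A totA; have [[q0 Aq0]|A0] := pselect (A !=set0); last first.
    have hp : sublinear p /\ forall x, p x <= p x by [].
    by exists (exist _ p hp) => q Aq; exfalso; apply: A0; exists q.
  pose m x := inf [set sval q x | q in A].
  have lb x : has_lbound [set sval q x | q in A].
    exists (- p (- x)) => _ [q Aq <-]; case: q Aq => q [sq qp] _ /=.
    by apply: le_trans (sublinearN x sq); rewrite lerN2.
  have mle (q : T) x : A q -> m x <= sval q x by move=> Aq; apply: ge_inf => //; exists q.
  have mge x c : (forall q : T, A q -> c <= sval q x) -> c <= m x.
    move=> h; apply: lb_le_inf; first by exists (sval q0 x), q0.
    by move=> _ [q Aq <-]; exact: h.
  have sm : sublinear m.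
    split=> [x y|t x t0].
      rewrite -lerBlDr; apply: (mge _ _) => q Aq; rewrite lerBlDr -lerBlDl; apply: (mge _ _) => q' Aq'.
      rewrite lerBlDl; have [/asboolP h|/asboolP h] := totA _ _ Aq Aq'.
        apply: le_trans (mle _ _ Aq') _; apply: le_trans ((proj2_sig q').1.1 _ _) _.
        by rewrite lerD2r.
      apply: le_trans (mle _ _ Aq) _; apply: le_trans ((proj2_sig q).1.1 _ _) _.
      by rewrite lerD2l.
    have mZ s y : 0 <= s -> m (s *: y) <= s * m y.
      rewrite le_eqVlt => /predU1P[<-|s0].
        by rewrite scale0r mul0r; apply: le_trans (mle _ 0 Aq0) _; rewrite (sublinear0 (proj2_sig q0).1).
      rewrite mulrC -ler_pdivrMr//; apply: (mge _ _) => q Aq; rewrite ler_pdivrMr// mulrC.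
      by apply: le_trans (mle _ _ Aq) _; rewrite (proj2_sig q).1.2// ltW.
    apply/eqP; rewrite eq_le mZ//=.
    have := t0; rewrite [0 <= t]le_eqVlt => /predU1P[<-|{}t0].
      rewrite scale0r mul0r; apply: (mge _ _) => q Aq; by rewrite (sublinear0 (proj2_sig q).1).
    rewrite mulrC -ler_pdivlMr//.
    have := mZ t^-1 (t *: x); rewrite scalerA mulVf ?gt_eqF// scale1r invr_ge0 mulrC.
    by apply; exact: ltW.
  have mp x : m x <= p x by apply: le_trans (mle _ x Aq0) _; exact: (proj2_sig q0).2.
  exists (exist _ m (conj sm mp)) => q Aq; apply/asboolP => x /=; exact: mle.
exists f => // q sq qf.
have qp x : q x <= p x by exact: le_trans (qf x) _.
have := fmin (exist _ q (conj sq qp)) => /(_ _)/(congr1 sval)/= -> //.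
by apply/asboolP.
Qed.

(** A minimal sublinear [f] is not lowered by flattening at any [y], which says that it is additive.
    Looking for [f] below [flatten_at p u] rather than below [p] forces f(-u) <= -p(u), hence
    equality at [u]. *)
Theorem hahn_banach p u : sublinear p -> exists f : V -> R,
  [/\ forall a x y, f (a *: x + y) = a * f x + f y, forall x, f x <= p x & f u = p u].
Proof.
move=> sp; have [f [sf fp] fmin] := minimal_sublinear (flatten_at_sublinear u sp).
have fle0 x t : sublinear f -> flatten_at f t x <= f x.
  by move=> _; have := flatten_at_le t x sf (lexx 0); rewrite scale0r mul0r addr0 subr0.
have fD x y : f (x + y) = f x + f y.
  apply/eqP; rewrite eq_le sf.1 /=.
  have e : flatten_at f y = f by apply: fmin; [exact: flatten_at_sublinear | move=> z; exact: fle0].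
  have := flatten_at_le y x sf ler01; rewrite scale1r mul1r e; lra.
have fN x : f (- x) = - f x.
  by apply/eqP; rewrite -addr_eq0 -fD addrC subrr (sublinear0 sf).
have fZ a x : f (a *: x) = a * f x.
  have [a0|a0] := leP 0 a; first exact: sf.2.
  by rewrite -{1}[a]opprK scaleNr fN sf.2 ?oppr_ge0 ?ltW// mulNr opprK.
have fq x : f x <= p x.
  apply: le_trans (fp x) _.
  by have := flatten_at_le u x sp (lexx 0); rewrite scale0r mul0r addr0 subr0.
exists f; split=> //; first by move=> a x y; rewrite fD fZ.
apply/eqP; rewrite eq_le fq /=.
have := fp (- u); rewrite fN => /le_trans/(_ (flatten_at_le u (- u) sp ler01)).
by rewrite scale1r mul1r addNr (sublinear0 sp) sub0r lerN2.
Qed.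

End hahn_banach.

Section weak_compactness.
Context {R : realType} {W : normedModType R}.
Implicit Types (u v z : W) (l : dual W).

Lemma norming u : exists2 l : dual W, (forall x, `|l x| <= `|x|) & l u = `|u|.
Proof.
have sn : sublinear (fun x : W => `|x|).
  by split=> [x y|t x t0]; [exact: ler_normD | rewrite normrZ ger0_norm].
have [f [lf fn fu]] := hahn_banach u sn.
have fN x : f (- x) = - f x.
  have f0 : f 0 = 0 by have := lf 1 0 0; rewrite scale1r mul1r addr0; lra.
  by have := lf (-1) x 0; rewrite addr0 f0 addr0 scaleN1r mulN1r.
have fle x : `|f x| <= `|x|.
  by rewrite ler_norml fn andbT lerNl -fN -normrN fn.
have [l lE] := exists_dual lf (C := 1) ltac:(by move=> x; rewrite mul1r).
by exists l => [x|]; rewrite lE.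
Qed.

Variable u_ : nat -> W.

(** Polynomials serve as finitely supported coefficient sequences, and rational ones as a countable
    dense family of them. *)
Definition comb (q : {poly R}) : W := \sum_(i < size q) q`_i *: u_ i.

Lemma combE n (q : {poly R}) : (size q <= n)%N -> comb q = \sum_(i < n) q`_i *: u_ i.
Proof.
move=> qn; rewrite /comb (big_ord_widen n (fun i => q`_i *: u_ i))//.
rewrite [RHS](bigID (fun i : 'I_n => (i < size q)%N)) /= [X in _ = _ + X]big1 ?addr0//.
by move=> i; rewrite -leqNgt => qi; rewrite nth_default ?scale0r.
Qed.

Lemma combD (q q' : {poly R}) : comb (q + q') = comb q + comb q'.
Proof.
rewrite (@combE (maxn (size q) (size q')) q) ?leq_maxl//.
rewrite (@combE (maxn (size q) (size q')) q') ?leq_maxr//.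
rewrite (@combE (maxn (size q) (size q')) (q + q')) ?size_polyD//.
by rewrite -big_split; apply: eq_bigr => i _; rewrite coefD scalerDl.
Qed.

Lemma combZ a (q : {poly R}) : comb (a *: q) = a *: comb q.
Proof.
rewrite (@combE (size q)) ?size_scale_leq// scaler_sumr.
by apply: eq_bigr => i _; rewrite coefZ scalerA.
Qed.

Lemma combX i : comb 'X^i = u_ i.
Proof.
rewrite /comb size_polyXn (bigD1 ord_max)//= coefXn eqxx scale1r big1 ?addr0// => j ji.
by rewrite coefXn -[i]/(nat_of_ord (@ord_max i)) (inj_eq val_inj) (negbTE ji) scale0r.
Qed.

Lemma comb0 : comb 0 = 0.
Proof. by rewrite /comb size_poly0 big_ord0. Qed.

(** The distance to the span is sublinear, and a linear functional below it that agrees with it at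
    [z] is continuous and vanishes on the span. *)
Lemma comb_dense z e : 0 < e ->
  (forall l, (forall j, l (u_ j) = 0) -> l z = 0) -> exists q, `|z - comb q| < e.
Proof.
move=> e0 zl; pose p x := inf [set `|x - comb q| | q in [set: {poly R}]].
have lb x : has_lbound [set `|x - comb q| | q in [set: {poly R}]].
  by exists 0 => _ [q _ <-].
have ple x q : p x <= `|x - comb q| by apply: ge_inf => //; exists q.
have pge x c : (forall q, c <= `|x - comb q|) -> c <= p x.
  move=> h; apply: lb_le_inf; first by exists `|x - comb 0|, 0.
  by move=> _ [q _ <-].
have pZ t x : 0 < t -> t * p x <= p (t *: x).
  move=> t0; apply: (pge _ _) => q; rewrite mulrC -ler_pdivlMr//.
  apply: le_trans (ple x (t^-1 *: q)) _; rewrite combZ ler_pdivlMr//.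
  rewrite -[X in _ * X](ger0_norm (ltW t0)) mulrC -normrZ scalerBr scalerA divff ?gt_eqF//.
  by rewrite scale1r.
have sp : sublinear p.
  split=> [x y|t x].
    rewrite -lerBlDr; apply: (pge _ _) => q; rewrite lerBlDr -lerBlDl; apply: (pge _ _) => q'.
    rewrite lerBlDl; apply: le_trans (ple _ (q + q')) _.
    rewrite combD opprD addrACA; exact: ler_normD.
  rewrite le_eqVlt => /predU1P[<-|t0].
    rewrite scale0r mul0r; apply/eqP; rewrite eq_le pge ?andbT//.
    by have := ple 0 0; rewrite comb0 subrr normr0.
  apply/eqP; rewrite eq_le pZ// andbT.
  rewrite mulrC -ler_pdivrMr// mulrC.
  by have := pZ t^-1 (t *: x); rewrite scalerA mulVf ?gt_eqF// scale1r invr_gt0; apply.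
have [f [lf fp fz]] := hahn_banach z sp.
have pn x : p x <= `|x|.
  by have := ple x 0; rewrite comb0 subr0.
have f0 : f 0 = 0 by have := lf 1 0 0; rewrite scale1r mul1r addr0; lra.
have fN x : f (- x) = - f x.
  by have := lf (-1) x 0; rewrite addr0 f0 addr0 scaleN1r mulN1r.
have fle x : `|f x| <= 1 * `|x|.
  rewrite mul1r ler_norml (le_trans (fp x))// andbT lerNl -fN -normrN.
  exact: le_trans (fp _) (pn _).
have [l lE] := exists_dual lf fle.
have p0 : p z = 0.
  rewrite -fz -lE; apply: zl => j; rewrite lE.
  have pu x q : x = comb q -> p x <= 0 by move=> ->; have := ple (comb q) q; rewrite subrr normr0.
  apply/eqP; rewrite eq_le (le_trans (fp _)) ?(pu _ 'X^j) ?combX//= -oppr_le0 -fN.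
  by apply: le_trans (fp _) _; apply: (pu _ (-1 *: 'X^j)); rewrite combZ combX scaleN1r.
apply: contrapT => /forallNP nq; have : e <= p z.
  by apply: (pge _ _) => q; rewrite leNgt; apply/negP; exact: nq.
by rewrite p0 leNgt e0.
Qed.

Lemma comb_rat q e : 0 < e ->
  exists r : {poly rat}, `|comb q - comb (map_poly ratr r)| <= e.
Proof.
move=> e0; pose n := size q; pose C := \sum_(i < n) `|u_ i|.
have C0 : 0 <= C by apply: sumr_ge0.
have C1 : 0 < C + 1 by rewrite ltr_wpDl.
have d0 : 0 < e / (C + 1) by rewrite divr_gt0.
have /choice[a aP] : forall i : nat, exists a : rat, `|q`_i - ratr a| <= e / (C + 1).
  move=> i; have : q`_i - e / (C + 1) < q`_i + e / (C + 1) by rewrite ltrD2l gtrN.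
  move=> /rat_in_itvoo[a]; rewrite in_itv /= => /andP[a1 a2]; exists a.
  by rewrite ler_norml; apply/andP; split; lra.
exists (\poly_(i < n) a i).
have sr : (size (map_poly (ratr : rat -> R) (\poly_(i < n) a i)) <= n)%N.
  by rewrite size_map_poly size_poly.
rewrite (@combE n q)// (@combE n _ sr) -sumrB.
apply: le_trans (ler_norm_sum _ _ _) _.
apply: (@le_trans _ _ (\sum_(i < n) e / (C + 1) * `|u_ i|)).
  apply: ler_sum => i _; rewrite -scalerBl normrZ ler_wpM2r//.
  by rewrite coef_map coef_poly ltn_ord.
rewrite -mulr_sumr -/C mulrAC ler_pdivrMr// ler_pM2l//.
by rewrite lerDl.
Qed.

(** [D] consists of norming functionals of the rational combinations x_n. If all of them vanish at
    [z], then |x_n| is at most |z - x_n|, and [z] is approximated by the x_n. This replaces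
    separability of the dual of [W]. *)
Lemma countable_separating : exists D : nat -> dual W, forall z,
  (forall l, (forall j, l (u_ j) = 0) -> l z = 0) -> (forall n, D n z = 0) -> z = 0.
Proof.
pose x n := comb (map_poly ratr (odflt 0 (unpickle n : option {poly rat}))).
have /choice[D DP] : forall n, exists l : dual W, (forall y, `|l y| <= `|y|) /\ l (x n) = `|x n|.
  by move=> n; have [l] := norming (x n); exists l.
exists D => z zl zD; apply/eqP; rewrite -normr_le0; apply/ler_addgt0Pr => e e0.
have e4 : 0 < e / 4 by rewrite divr_gt0.
have [q zq] := comb_dense e4 zl; have [r qr] := comb_rat q e4.
have [n xn] : exists n, x n = comb (map_poly ratr r) by exists (pickle r); rewrite /x pickleK.
rewrite -xn in qr.
have zx : `|z - x n| <= e / 2.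
  rewrite (_ : z - x n = (z - comb q) + (comb q - x n)); last by rewrite addrA subrK.
  apply: le_trans (ler_normD _ _) _; move: zq qr; lra.
have xz : `|x n| <= e / 2.
  rewrite -(DP n).2 (_ : D n (x n) = - D n (z - x n)); last by rewrite dualB zD sub0r opprK.
  by apply: le_trans (ler_norm _) _; rewrite normrN; exact: le_trans ((DP n).1 _) _.
rewrite add0r; have := ler_normD (z - x n) (x n); rewrite subrK.
move: zx xz; lra.
Qed.

End weak_compactness.

Section weak_subsequences.
Context {R : realType} {W : normedModType R}.
Hypothesis W_reflexive : reflexive_space W.
Implicit Types (u : W) (l : dual W).

Lemma real_cvg_unique (T : Type) (G : set_system T) (PG : ProperFilter G) (f : T -> R) (a b : R) :
  f @ G --> a -> f @ G --> b -> a = b.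
Proof. move=> fa fb; have h := @norm_hausdorff R R^o.
by rewrite -(cvg_lim h fa) -(cvg_lim h fb). Qed.

Lemma real_cvg_le (T : Type) (G : set_system T) (PG : ProperFilter G) (f : T -> R) (a b : R) :
  f @ G --> a -> (forall t, f t <= b) -> a <= b.
Proof.
move=> fa fb; rewrite leNgt; apply/negP => ba.
have ab : 0 < a - b by rewrite subr_gt0.
have /cvgrPdist_lt/(_ _ ab)/(@filter_ex _ _ _)[t] := fa.
by have := fb t; rewrite ltr_norml => ftb /andP[_]; lra.
Qed.

(** Along an ultrafilter every bounded sequence of numbers converges, so that all functionals have
    limits at once; reflexivity turns the limit functional into a vector. *)
Lemma ultra_weak_limit (G : set_system nat) (v : nat -> W) C : UltraFilter G ->
  (forall j, `|v j| <= C) -> exists u, forall l, l (v j) @[j --> G] --> (l u : R).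
Proof.
move=> UG vC.
have C0 : 0 <= C by exact: le_trans (vC 0%N).
have lC l j : `|l (v j)| <= C * `|l|.
  by apply: le_trans (dual_le _ _) _; rewrite mulrC ler_wpM2r.
have /choice[xi xiP] : forall l : dual W, exists y : R, l (v j) @[j --> G] --> y.
  move=> l; have := @segment_compact R (- (C * `|l|)) (C * `|l|).
  have lG : (l (v j) @[j --> G]) `[- (C * `|l|), C * `|l|]%classic.
    by apply: (@filterE _ G) => j /=; rewrite in_itv /=; have := lC l j; rewrite ler_norml.
  move=> /(_ (l (v j) @[j --> G]) _ lG)[y [_ ly]]; exists y => U Uy.
  have [//|nU] := in_ultra_setVsetC ((fun j => l (v j)) @^-1` U) UG.
  by have [z []] := ly (~` U) U nU Uy.
have xilin a l l' : xi (a *: l + l') = a * xi l + xi l'.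
  apply: real_cvg_unique (xiP _) _; apply: (@cvgD _ R^o); last exact: xiP.
  by apply: (@cvgM R _ G _ (fun=> a)); [exact: cvg_cst | exact: xiP].
have xile l : `|xi l| <= C * `|l|.
  have : `|l (v j)| @[j --> G] --> `|xi l| by apply: cvg_norm; exact: xiP.
  by move=> h; apply: (real_cvg_le _ h) => j; exact: lC.
have [Xi XiE] := exists_dual xilin xile.
by have [u uP] := W_reflexive Xi; exists u => l; rewrite -uP XiE; exact: xiP.
Qed.

Lemma weak_limit_eq0 (v : nat -> W) (u : W) (G : set_system nat) : ProperFilter G ->
  (forall l, l (v j) @[j --> G] --> (l u : R)) ->
  forall l, (forall j, l (v j) = 0) -> l u = 0.
Proof.
move=> PG vu l lv; apply: (real_cvg_unique PG (vu l)).
by under eq_fun do rewrite lv; exact: cvg_cst.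
Qed.

(** The ultrafilter provides the limit; the subsequence is then chosen so that the countably many
    functionals [D] converge along it, which determines the limit among vectors of the closed
    span. *)
Lemma weakly_convergent_subsequence (v : nat -> W) C : (forall j, `|v j| <= C) ->
  exists2 e : nat -> nat, {homo e : i j / (i < j)%N} & exists u, weak_cvg (v \o e) u.
Proof.
move=> vC; have [G [UG sG]] := @ultraFilterLemma nat \oo _.
have [u uP] := ultra_weak_limit UG vC.
have [D DP] := countable_separating v.
pose good n j := forall i, (i <= n)%N -> `|D i u - D i (v j)| < n.+1%:R^-1.
have Ggood n : G (good n).
  have : \forall j \near G, forall i : 'I_n.+1, `|D i u - D i (v j)| < n.+1%:R^-1.
    apply: filter_forall => i.
    by have /cvgrPdist_lt := uP (D i); apply; rewrite invr_gt0.
  by apply: filterS => j h i; rewrite -ltnS => i_n; exact: (h (Ordinal i_n)).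
have /choice[nxt nxtP] : forall nm : nat * nat, exists j, (nm.2 < j)%N /\ good nm.1 j.
  move=> [n m]; have : G ([set j | (m < j)%N] `&` good n).
    by apply: filterI => //; apply: sG; exact: nbhs_infty_gt.
  by move=> /(@filter_ex _ _ _)[j [? ?]]; exists j.
pose e := fix e n := match n with 0 => nxt (0%N, 0%N) | n'.+1 => nxt (n, e n') end.
have einc : {homo e : i j / (i < j)%N}.
  by apply: homo_ltn => [? ? ?|n]; [exact: ltn_trans | exact: (nxtP (n.+1, e n)).1].
have egood n : good n (e n) by case: n => [|n]; [exact: (nxtP (0%N, 0%N)).2 | exact: (nxtP (n.+1, e n)).2].
exists e => //; exists u.
have Dcvg i : D i (v (e j)) @[j --> \oo] --> D i u.
  apply/cvgrPdist_lt => d d0; near=> j.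
  apply: (@lt_trans _ _ j.+1%:R^-1); first by apply: egood; near: j; exact: nbhs_infty_ge.
  near: j; have /cvgrPdist_lt/(_ _ d0) := @cvg_harmonic R.
  by apply: filterS => j; rewrite sub0r normrN; apply: le_lt_trans; exact: ler_norm.
move=> l; apply/cvgrPdist_lt => d d0; apply: contrapT => nl.
(* An ultrafilter living on the bad indices gives a second weak limit [u']. It agrees with [u] under
   all of [D], and both are killed by every functional that kills the sequence, so that they
   coincide. *)
pose B := [set j | d <= `|l u - l (v (e j))|].
have PB : ProperFilter (within B \oo).
  apply: Build_ProperFilter_ex => P [N _ NP].
  apply: contrapT => nP; apply: nl; exists N => // j Nj.
  rewrite /= ltNge; apply/negP => Bj; apply: nP; exists j; exact: NP.
have [G' [UG' sG']] := ultraFilterLemma PB.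
have oG' : \oo `<=` G' by move=> P oP; apply: sG'; apply: filterS oP.
have vC' j : `|(v \o e) j| <= C by exact: vC.
have [u' u'P] := ultra_weak_limit UG' vC'.
have : u' - u = 0.
  apply: DP => [l' l'v|i].
    rewrite dualB (weak_limit_eq0 _ uP l'v).
    by rewrite (weak_limit_eq0 _ u'P) ?subr0// => j; exact: l'v.
  rewrite dualB; apply/eqP; rewrite subr_eq0; apply/eqP.
  apply: (real_cvg_unique _ (u'P (D i))).
  by move=> P /Dcvg; exact: oG'.
move/eqP; rewrite subr_eq0 => /eqP uu.
have /cvgrPdist_lt/(_ _ d0) := u'P l; rewrite uu => h.
have /(@filter_ex _ _ _)[j [Bj]] : G' (B `&` [set j | `|l u - l (v (e j))| < d]).
  by apply: filterI => //; apply: sG'; exact: withinT.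
by rewrite /= ltNge Bj.
Unshelve. all: by end_near. Qed.

End weak_subsequences.

(** * Potentials *)

Section lines.
Context {R : realType} {W : normedModType R}.
Implicit Types (u v : W).

Lemma is_derive_line (P : W -> R^o) (l : dual W) u v (t : R) :
  is_diff (u + t *: v) P l -> is_derive t 1 (fun s : R => P (u + s *: v) : R^o) (l v).
Proof.
move=> [dP lP].
have e : (fun h : R => h^-1 *: (P (u + (h *: (1 : R) + t) *: v) - P (u + t *: v))) =
         (fun h : R => h^-1 *: (P (h *: v + (u + t *: v)) - P (u + t *: v))).
  apply/funext => h; congr (_ *: (P _ - _)).
  by rewrite -[h *: 1]/(h * 1) mulr1 scalerDl addrCA addrA.
have dv := @diff_derivable _ _ _ P (u + t *: v) v dP.
apply: DeriveDef.
  by move: dv; rewrite /derivable /= -e.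
by have := deriveE v dP; rewrite lP => <-; rewrite /derive /= -e.
Qed.

Lemma continuous_line u v : continuous (fun t : R => u + t *: v).
Proof.
move=> t; apply: cvgD; first exact: cvg_cst.
by apply: cvgZr_tmp; exact: cvg_id.
Qed.

Lemma cvg_dual_app (T : Type) (F : set_system T) (FF : Filter F) (l_ : T -> dual W) (x_ : T -> W)
    (l : dual W) (x : W) :
  l_ @ F --> l -> x_ @ F --> x -> l_ t (x_ t) @[t --> F] --> (l x : R).
Proof.
move=> cl cx; apply/cvgrPdist_lt => e e0.
pose M := `|l| + 1; pose N := `|x| + 1.
have M0 : 0 < M by rewrite ltr_wpDl.
have N0 : 0 < N by rewrite ltr_wpDl.
near=> s.
have -> : l x - l_ s (x_ s) = l (x - x_ s) + (l - l_ s) (x_ s).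
  by rewrite subd dualB addrA subrK.
apply: le_lt_trans (ler_normD _ _) _; rewrite [ltRHS](splitr e); apply: ltrD.
  apply: le_lt_trans (dual_le _ _) _; apply: (@le_lt_trans _ _ (M * `|x - x_ s|)).
    by rewrite ler_wpM2r// lerDl.
  rewrite mulrC -ltr_pdivlMr//; near: s.
  by move/cvgrPdist_lt : cx; apply; rewrite !divr_gt0.
apply: le_lt_trans (dual_le _ _) _; apply: (@le_lt_trans _ _ (`|l - l_ s| * N)).
  rewrite ler_wpM2l//; near: s.
  have /cvgrPdist_lt/(_ _ ltr01) := cx; apply: filterS => s /ltW h.
  by rewrite /N -lerBlDl; apply: le_trans h; rewrite distrC; exact: lerB_dist.
rewrite -ltr_pdivlMr//; near: s.
by move/cvgrPdist_lt : cl; apply; rewrite !divr_gt0.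
Unshelve. all: by end_near. Qed.

Lemma continuous_dual_app (p : W -> dual W) (T : topologicalType) (x y : T -> W) t :
  continuous p -> {for t, continuous x} -> {for t, continuous y} ->
  {for t, continuous (fun s => p (x s) (y s) : R)}.
Proof.
move=> cp cx cy; have cpx : {for t, continuous (p \o x)} by apply: continuous_comp => //; exact: cp.
exact: (@cvg_dual_app T (nbhs t) _ (p \o x) y).
Qed.

End lines.

Section potentials.
Context {R : realType} {W : completeNormedModType R}.
Variable p : W -> dual W.
Hypothesis pP : potential_operator p.
Implicit Types (u v : W).

Let cp : continuous p := pP.1.

Lemma potentialE (P : W -> R^o) u : (forall u, is_diff u P (p u)) ->
  potential p u = P u - P 0.
Proof.
move=> dP; have dl (t : R) : is_derive t 1 (fun s : R => P (s *: u) : R^o) (p (t *: u) u).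
  have := @is_derive_line R W P (p (0 + t *: u)) 0 u t (dP _).
  by rewrite add0r; under eq_fun do rewrite add0r.
have cl : continuous (fun s : R => P (s *: u) : R^o).
  by move=> t; apply: differentiable_continuous; apply/derivable1_diffP; have [] := dl t.
rewrite /potential /Rintegral (@continuous_FTC2 R _ (fun s : R => P (s *: u))) ?ltr01//.
- by rewrite scale1r scale0r.
- apply: continuous_subspaceT => t.
  apply: (@continuous_dual_app _ _ p R (fun s => s *: u) (fun=> u)) => //.
    by apply: cvgZr_tmp; exact: cvg_id.
  exact: cvg_cst.
- split.
  + by move=> t _; have [] := dl t.
  + by apply: cvg_at_right_filter; exact: cl.
  + by apply: cvg_at_left_filter; exact: cl.
- by move=> t _; rewrite derive1E; have [_] := dl t.
Qed.

Lemma is_diff_potential u : is_diff u (potential p : W -> R^o) (p u).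
Proof.
have [P dP] := pP.2.
rewrite (_ : potential p = P - cst (P 0) :> (W -> R^o)); last first.
  by apply/funext => v; rewrite (potentialE v dP).
have h1 := dP u; have h2 : is_diff u (cst (P 0) : W -> R^o) 0 by exact: is_diff_cst.
have h3 : is_diff u (P - cst (P 0)) ((p u : W -> R^o) - 0) by exact: is_diffB.
by apply: (is_diff_eq h3); rewrite subr0.
Qed.

Lemma continuous_potential : continuous (potential p : W -> R^o).
Proof. by move=> u; apply: differentiable_continuous; case: (is_diff_potential u). Qed.

Lemma is_derive_potential u v (t : R) :
  is_derive t 1 (fun s : R => potential p (u + s *: v) : R^o) (p (u + t *: v) v).
Proof. exact: is_derive_line (is_diff_potential _). Qed.

Lemma potential_mvt u v : exists2 t : R, 0 < t < 1 &
  potential p (u + v) - potential p u = p (u + t *: v) v.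
Proof.
have [|t] := @MVT R (fun s => potential p (u + s *: v)) (fun t => p (u + t *: v) v) 0 1 ltr01
  (fun t _ => is_derive_potential u v t).
  apply: continuous_subspaceT => t.
  apply: (@continuous_comp R W R (fun s => u + s *: v) (potential p)); first exact: continuous_line.
  exact: continuous_potential.
rewrite in_itv /= => t01; rewrite scale1r scale0r addr0 subr0 mulr1 => e.
by exists t.
Qed.

Lemma potential0 : potential p 0 = 0.
Proof. by have [P dP] := pP.2; rewrite (potentialE _ dP) subrr. Qed.

Lemma potential_even u : odd_operator p -> potential p (- u) = potential p u.
Proof.
move=> op; rewrite /potential; congr Rintegral; apply/funext => t.
by rewrite scalerN op oppd dualN opprK.
Qed.

Lemma potential_homogeneous (sc : W -> R -> W) d u t : 0 <= t ->
  (forall u (tau t : R), 0 <= t -> sc (tau *: u) t = tau *: sc u t) ->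
  homogeneous sc d p -> potential p (sc u t) = t `^ d * potential p u.
Proof.
move=> t0 scZ hp; rewrite /potential -RintegralZl//.
- congr Rintegral; apply/funext => s; by rewrite -scZ// hp.
- apply: continuous_compact_integrable; first exact: segment_compact.
  apply: continuous_subspaceT => s.
  apply: (@continuous_dual_app _ _ p R (fun s => s *: u) (fun=> u)) => //.
    by apply: cvgZr_tmp; exact: cvg_id.
  exact: cvg_cst.
Qed.

Lemma potential_gt0 u : (forall u, u != 0 -> 0 < p u u) -> u != 0 -> 0 < potential p u.
Proof.
move=> pp u0; have [t /andP[t0 _]] := potential_mvt 0 u.
rewrite add0r potential0 subr0 add0r => ->.
have := pp (t *: u); rewrite scaler_eq0 (negbTE u0) gt_eqF//= dualZ => /(_ isT).
by rewrite pmulr_rgt0.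
Qed.

Lemma potential_lipschitz K C : (forall u, `|u| <= C -> `|p u| <= K) ->
  forall u v, `|u| <= C -> `|v| <= C -> `|potential p u - potential p v| <= K * `|u - v|.
Proof.
move=> pK u v uC vC; have [t /andP[t0 t1]] := potential_mvt v (u - v).
rewrite [v + (u - v)]addrC subrK => ->; apply: le_trans (dual_le _ _) _.
rewrite ler_wpM2r//; apply: pK.
rewrite (_ : v + t *: (u - v) = (1 - t) *: v + t *: u); last first.
  by rewrite scalerBr scalerBl scale1r addrA addrAC.
have t1' : 0 <= 1 - t by rewrite subr_ge0 ltW.
apply: le_trans (ler_normD _ _) _; rewrite !normrZ (ger0_norm t1') (ger0_norm (ltW t0)).
have := ler_wpM2l (ltW t0) uC; have := ler_wpM2l t1' vC; lra.
Qed.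

Lemma potential_le K C : (forall u, `|u| <= C -> `|p u| <= K) ->
  forall u, `|u| <= C -> potential p u <= K * C.
Proof.
move=> pK u uC; have C0 : 0 <= C by exact: le_trans uC.
have := potential_lipschitz pK uC (v := 0); rewrite normr0 potential0 !subr0 => /(_ C0).
move=> /(le_trans (ler_norm _))/le_trans; apply; rewrite ler_wpM2l//.
exact: le_trans (pK u uC).
Qed.

Hypothesis wp : weak_to_strong p.

Lemma weak_dual_cvg (u_ : nat -> W) u (l_ : nat -> dual W) (l : dual W) C :
  (forall j, `|u_ j| <= C) -> weak_cvg u_ u -> l_ @ \oo --> l ->
  l_ j (u_ j) @[j --> \oo] --> (l u : R).
Proof.
move=> uC wu ll; have C1 : 0 < `|C| + 1 by rewrite ltr_wpDl.
apply/cvgrPdist_lt => e e0; near=> j.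
have -> : l u - l_ j (u_ j) = (l u - l (u_ j)) + (l - l_ j) (u_ j).
  by rewrite subd addrA subrK.
apply: le_lt_trans (ler_normD _ _) _; rewrite [ltRHS](splitr e); apply: ltrD.
  by near: j; have /cvgrPdist_lt := wu l; apply; rewrite divr_gt0.
apply: le_lt_trans (dual_le _ _) _; apply: (@le_lt_trans _ _ (`|l - l_ j| * (`|C| + 1))).
  by rewrite ler_wpM2l// (le_trans (uC j))// (le_trans (ler_norm C))// lerDl.
rewrite -ltr_pdivlMr//; near: j.
by move/cvgrPdist_lt : ll; apply; rewrite !divr_gt0.
Unshelve. all: by end_near. Qed.

(** The intermediate points of the mean value theorem still converge weakly to [u], so that [p]
    converges strongly along them and is paired with a weakly null sequence. *)
Lemma potential_weak_cvg (u_ : nat -> W) u C : (forall j, `|u_ j| <= C) ->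
  weak_cvg u_ u -> potential p (u_ j) @[j --> \oo] --> potential p u.
Proof.
move=> uC wu.
have /choice[t tP] j : exists t : R, 0 < t < 1 /\
    potential p (u_ j) - potential p u = p (u + t *: (u_ j - u)) (u_ j - u).
  have [t t01] := potential_mvt u (u_ j - u).
  by rewrite [u + (u_ j - u)]addrC subrK => e; exists t.
have wd : weak_cvg (fun j => u + t j *: (u_ j - u)) u.
  move=> l; apply/cvgrPdist_lt => e e0.
  have /cvgrPdist_lt/(_ _ e0) := wu l; apply: filterS => j.
  rewrite dualD dualZ dualB opprD addrA subrr sub0r normrN distrC; apply: le_lt_trans.
  have [/andP[/ltW t0 /ltW t1] _] := tP j.
  by rewrite normrM ger0_norm// ler_piMl.
have wd0 : weak_cvg (fun j => u_ j - u) 0.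
  move=> l; rewrite dual0 -(subrr (l u)).
  by under eq_fun do rewrite dualB; apply: (@cvgB _ R^o); [exact: wu | exact: cvg_cst].
have : p (u + t j *: (u_ j - u)) (u_ j - u) @[j --> \oo] --> (p u 0 : R).
  apply: (@weak_dual_cvg _ _ _ _ (C + `|u|)) => //; last exact: wp.
  by move=> j; apply: le_trans (ler_normB _ _) _; rewrite lerD2r.
rewrite dual0 => h; apply/cvgrPdist_lt => e e0.
have /cvgrPdist_lt/(_ _ e0) := h; apply: filterS => j.
by rewrite sub0r normrN -(tP j).2 distrC.
Qed.

Hypothesis W_reflexive : reflexive_space W.

Lemma weak_to_strong_bounded C : exists K, forall u, `|u| <= C -> `|p u| <= K.
Proof.
apply: contrapT => /forallNP h.
have /choice[v vP] n : exists v, `|v| <= C /\ n%:R < `|p v|.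
  have /existsNP[v /not_implyP[vC /negP]] := h n%:R.
  by rewrite -ltNge => nv; exists v.
have [e einc [u wu]] := weakly_convergent_subsequence W_reflexive (fun n => (vP n).1).
have := wp wu => /cvg_norm/cvgrPdist_lt/(_ _ ltr01)[N _ NP].
have [m mP] : exists m : nat, `|p u| + 1 <= m%:R.
  by exists (Num.Def.truncn (`|p u| + 1)).+1; rewrite ltW// truncnS_gt.
have := NP (maxn N m) (leq_maxl _ _) => /= hm.
have en : (maxn N m <= e (maxn N m))%N.
  by elim: (maxn N m) => // n IH; exact: leq_ltn_trans IH (einc _ _ (ltnSn n)).
have : (m%:R : R) <= (e (maxn N m))%:R by rewrite ler_nat (leq_trans _ en)// leq_maxr.
have := (vP (e (maxn N m))).2; move: hm; rewrite ltr_norml => /andP[hm1 hm2].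
move: mP hm1; set a := `|p u|; set b := `|p _|; lra.
Qed.

End potentials.

(** * Deformations *)

Section iteration.
Context {R : realType} {W : completeNormedModType R}.
Variables (T : W -> W) (a : W -> R) (Z : set W) (C : R).
Hypothesis C0 : 0 < C.
Hypothesis a0 : forall u, 0 <= a u.
Hypothesis Tca : forall u0 u, Z u0 -> `|u - u0| <= C * a u0 ->
  {for u, continuous T} /\ {for u, continuous a}.
(* The decrease of [a] pays for the displacement of [T], as along a gradient flow. *)
Hypothesis step : forall u0 u, Z u0 -> `|u - u0| <= C * (a u0 - a u) ->
  `|T u - u| <= C * (a u - a (T u)) /\ (T u = u -> a u = 0).

Let x u n := iter n T u.

Lemma iter_dist u n k : Z u -> `|x u (n + k) - x u n| <= C * (a (x u n) - a (x u (n + k))) /\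
  `|x u n - u| <= C * (a u - a (x u n)).
Proof.
move=> Zu; have near m : `|x u m - u| <= C * (a u - a (x u m)).
  elim: m => [|m IH]; first by rewrite !subrr normr0 mulr0.
  have [h _] := step (u := x u m) Zu IH.
  rewrite /x iterS -/(x u m) (_ : T (x u m) - u = (T (x u m) - x u m) + (x u m - u)).
    by apply: le_trans (ler_normD _ _) _; move: h IH; lra.
  by rewrite addrA subrK.
split=> //; elim: k => [|k IH]; first by rewrite addn0 !subrr normr0 mulr0.
have [h _] := step (u := x u (n + k)) Zu (near _).
rewrite addnS /x iterS -/(x u (n + k)) -/(x u n).
rewrite (_ : T (x u (n + k)) - x u n = (T (x u (n + k)) - x u (n + k)) + (x u (n + k) - x u n)).
  by apply: le_trans (ler_normD _ _) _; move: h IH; lra.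
by rewrite addrA subrK.
Qed.

Lemma iter_near u n : Z u -> `|x u n - u| <= C * a u.
Proof.
by move=> Zu; have [_ h] := iter_dist n 0 Zu; apply: le_trans h _; rewrite ler_pM2l// gerBl.
Qed.

Lemma iter_cvg u : Z u -> cvg (x u n @[n --> \oo]).
Proof.
move=> Zu.
have mono : nonincreasing_seq (fun n => a (x u n)).
  apply/nonincreasing_seqP => n; have [h _] := iter_dist n 1 Zu.
  rewrite addn1 in h; have := le_trans (normr_ge0 _) h.
  by rewrite pmulr_rge0// subr_ge0.
have ca : cvgn (fun n => a (x u n)).
  by apply: nonincreasing_is_cvgn => //; exists 0 => _ [n _ <-].
apply/cauchy_cvgP/cauchy_exP => e e0.
have eC : 0 < e / C by rewrite divr_gt0.
have /cvgrPdist_lt/(_ _ eC)[N _ NP] := ca.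
exists (x u N); exists N => // m /= Nm.
rewrite -ball_normE /= distrC -(subnKC Nm).
have [h _] := iter_dist N (m - N) Zu; apply: le_lt_trans h _.
rewrite mulrC -ltr_pdivlMr//.
have := NP N (leqnn N); rewrite /= ltr_norml => /andP[h1 _].
have := nonincreasing_cvgn_ge mono ca (N + (m - N)); lra.
Qed.

Definition iter_lim u := lim (x u n @[n --> \oo]).

Lemma iter_limP u n : Z u -> `|iter_lim u - x u n| <= C * a (x u n).
Proof.
move=> Zu; have cx := iter_cvg Zu.
have : `|x u (m + n) - x u n| @[m --> \oo] --> `|iter_lim u - x u n|.
  apply: cvg_norm; apply: cvgB; last exact: cvg_cst.
  by have := cx; rewrite -(cvg_shiftn n).
move=> h; apply: (real_cvg_le _ h) => m.
have [h1 _] := iter_dist n m Zu; rewrite addnC; apply: le_trans h1 _.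
by rewrite ler_pM2l// gerBl.
Qed.

(** By continuity the limit is a fixed point of [T], and fixed points have [a = 0]. The bound on the
    displacement passes to the limit, which makes [step] applicable there. *)
Lemma iter_lim_zero u : Z u -> a (iter_lim u) = 0 /\ a (x u n) @[n --> \oo] --> 0.
Proof.
move=> Zu; have cx := iter_cvg Zu.
have [cT cau] := Tca Zu (iter_limP 0 Zu).
have cax : a (x u n) @[n --> \oo] --> a (iter_lim u) by exact: (continuous_cvg _ cau cx).
have [|_ fixT] := step (u := iter_lim u) Zu.
  have h1 : C * (a u - a (x u n)) @[n --> \oo] --> C * (a u - a (iter_lim u)).
    by apply: cvgM; [exact: cvg_cst | apply: (@cvgB _ R^o) => //; exact: cvg_cst].
  have h2 : `|x u n - u| @[n --> \oo] --> `|iter_lim u - u|.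
    by apply: cvg_norm; apply: cvgB => //; exact: cvg_cst.
  apply: (ler_cvg_to h2 h1); apply: nearW => n.
  by have [] := iter_dist n 0 Zu.
have Tx : T (iter_lim u) = iter_lim u.
  have h1 : T (x u n) @[n --> \oo] --> T (iter_lim u) by exact: (continuous_cvg _ cT cx).
  have h2 : T (x u n) @[n --> \oo] --> iter_lim u.
    by have := cx; rewrite -(cvg_shiftS (x u)).
  have h := @norm_hausdorff _ W.
  by rewrite -(cvg_lim h h1) -(cvg_lim h h2).
have a00 := fixT Tx; split=> //.
by rewrite -a00.
Qed.

Lemma iter_continuous u n : Z u -> {for u, continuous (fun v => x v n)}.
Proof.
move=> Zu; elim: n => [|n IH]; first exact: cvg_id.
apply: (@continuous_comp _ _ _ (fun v => x v n) T) => //.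
by have [] := Tca Zu (iter_near n Zu).
Qed.

(** After n iterations the remaining displacement is at most C a. Once this is small at [u] it is
    small nearby, so that convergence is locally uniform. *)
Lemma iter_lim_continuous : {within Z, continuous iter_lim}.
Proof.
apply/subspace_continuousP => u Zu; apply/cvgrPdist_lt => e e0.
have e4 : 0 < e / 4 by rewrite divr_gt0.
have eC : 0 < e / 4 / C by rewrite divr_gt0.
have [_ /cvgrPdist_lt/(_ _ eC)[n _ /(_ n (leqnn n)) /= an]] := iter_lim_zero Zu.
rewrite sub0r normrN ger0_norm// in an.
have cn := @iter_continuous u n Zu.
have [_ cau] := Tca Zu (iter_near n Zu).
have can : {for u, continuous (fun v => a (x v n))} by apply: (@continuous_comp _ _ _ (fun v => x v n) a).
rewrite near_withinE; near=> v => Zv.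
have e1 : `|x u n - x v n| < e / 4 by near: v; move/cvgrPdist_lt : cn; apply.
have e2 : a (x v n) < e / 4 / C.
  near: v; have d0 : 0 < e / 4 / C - a (x u n) by rewrite subr_gt0.
  move/cvgrPdist_lt : can => /(_ _ d0); apply: filterS => v.
  by rewrite distrC => /(le_lt_trans (ler_norm _)); lra.
rewrite (_ : iter_lim u - iter_lim v =
  (iter_lim u - x u n) + (x u n - x v n) - (iter_lim v - x v n)); last first.
  by rewrite opprB !addrA !subrK.
have h1 := iter_limP n Zu; have h2 := iter_limP n Zv.
have k1 : C * a (x u n) < e / 4 by rewrite mulrC -ltr_pdivlMr.
have k2 : C * a (x v n) < e / 4 by rewrite mulrC -ltr_pdivlMr.
apply: le_lt_trans (ler_normB _ _) _; apply: le_lt_trans (lerD (ler_normD _ _) (lexx _)) _.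
move: h1 h2 k1 k2 e1; set A := `|_|; set B := `|_|; set D := `|_ - _|; lra.
Unshelve. all: by end_near. Qed.

Lemma iter_lim_odd u : (forall v, T (- v) = - T v) -> Z u -> iter_lim (- u) = - iter_lim u.
Proof.
move=> oT Zu; have cx := iter_cvg Zu.
rewrite /iter_lim (_ : (fun n => x (- u) n) = (fun n => - x u n)).
  have h := @norm_hausdorff _ W.
  by apply: (cvg_lim h); apply: cvgN.
by apply/funext; elim=> // n; rewrite /x /= => ->; rewrite oT.
Qed.

End iteration.

Section room.
Context {R : realType} {W : normedModType R}.
Variable bad : set (W * R).

(* The distance from [(u, 0)] to [bad], truncated at 1. *)
Definition room u : R :=
  inf (1 |` [set Num.max `|u - b.1| `|b.2| | b in bad]).

Let lb u : has_lbound (1 |` [set Num.max `|u - b.1| `|b.2| | b in bad]).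
Proof.
exists 0 => _ [->|[b _ <-]]; first exact: ler01.
by rewrite le_max normr_ge0.
Qed.

Lemma room_le1 u : room u <= 1.
Proof. by apply: (ge_inf (lb u)); left. Qed.

Lemma room_le u b : bad b -> room u <= Num.max `|u - b.1| `|b.2|.
Proof. by move=> bb; apply: (ge_inf (lb u)); right; exists b. Qed.

Lemma room_ge u c : c <= 1 -> (forall b, bad b -> c <= Num.max `|u - b.1| `|b.2|) ->
  c <= room u.
Proof.
move=> c1 h; apply: lb_le_inf; first by exists 1; left.
by move=> _ [->//|[b bb <-]]; exact: h.
Qed.

Lemma room_ge0 u : 0 <= room u.
Proof. by apply: room_ge; [exact: ler01 | move=> b _; rewrite le_max normr_ge0]. Qed.

Lemma room_good u t : 0 <= t < room u -> ~ bad (u, t).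
Proof.
move=> /andP[t0 tr] /(room_le u)/=; rewrite subrr normr0 ger0_norm// max_r//.
by rewrite leNgt tr.
Qed.

Lemma room_gt0 u : nbhs (u, 0) (~` bad) -> 0 < room u.
Proof.
move=> [[A B] /= [/nbhs_ballP[e1 /= e10 A1] /nbhs_ballP[e2 /= e20 B2]] AB].
apply: (@lt_le_trans _ _ (Num.min 1 (Num.min e1 e2))); first by rewrite !lt_min ltr01 e10.
apply: room_ge; first by rewrite ge_min lexx.
move=> [w t] bb /=; rewrite leNgt; apply/negP; rewrite gt_max => /andP[h1 h2].
apply: (AB (w, t)) bb; split => /=.
  by apply: A1; rewrite -ball_normE /=; apply: lt_le_trans h1 _; rewrite !ge_min lexx orbT.
apply: B2; rewrite -ball_normE /= sub0r normrN; apply: lt_le_trans h2 _.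
by rewrite !ge_min lexx !orbT.
Qed.

Lemma room_lipschitz u v : room u <= room v + `|u - v|.
Proof.
rewrite -lerBlDr; apply: room_ge; first by rewrite lerBlDr (le_trans (room_le1 u))// lerDl.
move=> b bb; rewrite lerBlDr; apply: le_trans (room_le u bb) _.
rewrite ge_max; apply/andP; split; last by rewrite ler_wpDr// le_max lexx orbT.
rewrite (_ : u - b.1 = (v - b.1) + (u - v)); last by rewrite [RHS]addrC addrA subrK.
by apply: le_trans (ler_normD _ _) _; rewrite lerD2r le_max lexx.
Qed.

Lemma continuous_room : continuous room.
Proof.
move=> u; apply/cvgrPdist_lt => e e0; near=> v.
apply: (@le_lt_trans _ _ `|u - v|); last first.
  by near: v; apply: cvgr_dist_lt; [exact: cvg_id | done].
rewrite ler_norml; have := room_lipschitz u v; have := room_lipschitz v u.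
by rewrite (distrC v); move: (room u) (room v) => a b; lra.
Unshelve. all: by end_near. Qed.

Lemma room_even u : (forall w t, bad (w, t) -> bad (- w, t)) -> room (- u) = room u.
Proof.
move=> sb; have h v : room v <= room (- v).
  apply: room_ge; first exact: room_le1.
  move=> [w t] /sb/(room_le v)/=; rewrite opprK.
  by rewrite -(normrN (- v - w)) opprD !opprK.
by apply/eqP; rewrite eq_le h andbT; have := h (- u); rewrite opprK.
Qed.

End room.

Section deformation.
Context {R : realType} {W : completeNormedModType R}.
Variables (Psi : W -> R) (Q : W -> dual W) (V : W -> W) (S Z : set W).
Variables (mu delta K : R).
Hypothesis dPsi : forall u, u != 0 -> is_diff u (Psi : W -> R^o) (Q u).
Hypothesis cQ : forall u, u != 0 -> {for u, continuous Q}.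
Hypothesis cV : forall u, u != 0 -> {for u, continuous V}.
Hypothesis oddQ : forall u, Q (- u) = - Q u.
Hypothesis oddV : forall u, V (- u) = - V u.
Hypothesis evenPsi : forall u, Psi (- u) = Psi u.
Hypothesis K0 : 0 < K.
Hypothesis delta0 : 0 < delta <= 2.
Hypothesis descent : forall u, S u -> Q u (V u) <= - delta /\ `|V u| <= K.

Let C := 2 * K / delta.
Let a u := Num.max (Psi u - mu) 0.
Hypothesis near_neq0 : forall u0 u, Z u0 -> `|u - u0| <= C * a u0 -> u != 0.
Hypothesis near_S : forall u0 u, Z u0 -> `|u - u0| <= C * a u0 -> mu < Psi u <= Psi u0 -> S u.

Let good : set (W * R) := [set b | [/\ b.1 != 0, b.1 + b.2 *: V b.1 != 0 &
  Q (b.1 + b.2 *: V b.1) (V b.1) < - (delta / 2)]].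
(* A step which is too short to leave [good] or to let [Psi] drop below [mu]. *)
Let tau u := Num.min (room (~` good) u / 2) (a u).
Let T u := u + tau u *: V u.

Let cPsi u : u != 0 -> {for u, continuous (Psi : W -> R^o)}.
Proof. by move=> u0; apply: differentiable_continuous; case: (dPsi u0). Qed.

Let a_ge0 u : 0 <= a u. Proof. by rewrite /a le_max lexx orbT. Qed.

Let ca u : u != 0 -> {for u, continuous (a : W -> R)}.
Proof.
move=> u0; apply: (@continuous_max R W (fun u => Psi u - mu) (fun=> 0) u); last exact: cvg_cst.
by apply: (@cvgB _ R^o); [exact: cPsi | exact: cvg_cst].
Qed.

Let tau_ge0 u : 0 <= tau u.
Proof. by rewrite le_min a_ge0 andbT divr_ge0// room_ge0. Qed.

Let ctau u : u != 0 -> {for u, continuous (tau : W -> R)}.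
Proof.
move=> u0; apply: (@continuous_min R W (fun u => room (~` good) u / 2) a u); last exact: ca.
by apply: cvgM; [exact: continuous_room | exact: cvg_cst].
Qed.

Let cT u : u != 0 -> {for u, continuous T}.
Proof.
move=> u0; apply: cvgD; first exact: cvg_id.
by apply: cvgZ; [exact: ctau | exact: cV].
Qed.

Let good_sym w t : (~` good) (w, t) -> (~` good) (- w, t).
Proof.
move=> h [/= h1 h2 h3]; apply: h; split => /=.
- by rewrite -oppr_eq0.
- by move: h2; rewrite oddV scalerN -opprD oppr_eq0.
- by move: h3; rewrite oddV scalerN -opprD oddQ oppd dualN opprK.
Qed.

Let oddT u : T (- u) = - T u.
Proof.
have e : tau (- u) = tau u by rewrite /tau /a evenPsi room_even.
by rewrite /T e oddV scalerN opprD.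
Qed.

Let room_pos u : u != 0 -> S u -> 0 < room (~` good) u.
Proof.
move=> u0 Su; have [Q1 _] := descent Su; have /andP[d0 _] := delta0.
apply: room_gt0; rewrite setCK.
pose w (b : W * R) := b.1 + b.2 *: V b.1.
have c1 : fst b @[b --> ((u, 0) : W * R)] --> u by exact: cvg_fst.
have c2 : snd b @[b --> ((u, 0) : W * R)] --> (0 : R) by exact: cvg_snd.
have cV1 : V b.1 @[b --> ((u, 0) : W * R)] --> V u by apply: (continuous_cvg _ (cV u0) c1).
have cw : w b @[b --> ((u, 0) : W * R)] --> u.
  by rewrite -[X in _ --> X]addr0 -(scale0r (V u)); apply: cvgD => //; apply: cvgZ.
have cQw : Q (w b) @[b --> ((u, 0) : W * R)] --> Q u by apply: (continuous_cvg _ (cQ u0) cw).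
have cf : Q (w b) (V b.1) @[b --> ((u, 0) : W * R)] --> (Q u (V u) : R).
  exact: (@cvg_dual_app _ _ _ _ _ _ _ _ _ cQw cV1).
near=> b; split.
- by near: b; exact: (cvgr_neq0 u c1 u0).
- by near: b; exact: (cvgr_neq0 u cw u0).
- by near: b; apply: (cvgr_lt _ cf); lra.
Unshelve. all: by end_near. Qed.

Let Psi_T u : u != 0 -> Psi (T u) <= Psi u - delta / 2 * tau u.
Proof.
move=> u0; have := tau_ge0 u; rewrite le_eqVlt => /predU1P[e|t0].
  by rewrite /T -e scale0r addr0 mulr0 subr0.
(* The half in [tau] keeps a step of positive length strictly inside the room. *)
have gd t : 0 <= t <= tau u -> good (u, t).
  move=> /andP[h0 h1]; apply: contrapT; apply: (@room_good _ _ (~` good)); rewrite h0/=.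
  apply: le_lt_trans h1 _; have : tau u <= room (~` good) u / 2 by rewrite ge_min lexx.
  lra.
have dl t : 0 <= t <= tau u -> is_derive t 1 (fun t => Psi (u + t *: V u) : R^o) (Q (u + t *: V u) (V u)).
  by move=> /gd[_ /= h _]; apply: is_derive_line; exact: dPsi.
have [t||t] := @MVT R (fun t => Psi (u + t *: V u)) (fun t => Q (u + t *: V u) (V u)) 0 (tau u) t0.
- by rewrite in_itv/= => /andP[/ltW h0 /ltW h1]; apply: dl; rewrite h0.
- apply: continuous_in_subspaceT => t; rewrite inE/= in_itv/= => /dl h.
  by apply: differentiable_continuous; apply/derivable1_diffP; case: h.
rewrite in_itv /= scale0r addr0 subr0 -/(T u) => /andP[/ltW h0 /ltW h1].
have [|_ _ /= h] := gd t; first by rewrite h0.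
by move: (ltW h) => {}h; move/(ler_wpM2r (ltW t0)) : h; lra.
Qed.

Let C0 : 0 < C.
Proof. by have /andP[d0 _] := delta0; rewrite divr_gt0// mulr_gt0. Qed.

Let continuous_step u0 u : Z u0 -> `|u - u0| <= C * a u0 ->
  {for u, continuous T} /\ {for u, continuous (a : W -> R)}.
Proof. by move=> Zu0 /(near_neq0 Zu0) h; split; [exact: cT | exact: ca]. Qed.

Let step u0 u : Z u0 -> `|u - u0| <= C * (a u0 - a u) ->
  `|T u - u| <= C * (a u - a (T u)) /\ (T u = u -> a u = 0).
Proof.
move=> Zu0 uu0; have /andP[d0 d2] := delta0.
have near : `|u - u0| <= C * a u0 by apply: le_trans uu0 _; rewrite ler_pM2l// gerBl.
have u_neq0 := near_neq0 Zu0 near.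
have muS : mu < Psi u -> S u.
  move=> mu_u; apply: (near_S Zu0 near); rewrite mu_u/=.
  have := le_trans (normr_ge0 _) uu0; rewrite pmulr_rge0// subr_ge0 /a.
  by rewrite le_max !ge_max subr_le0 (leNgt (Psi u) mu) mu_u orbF lerD2r => /andP[].
split.
- have [au0|] := leP (Psi u) mu.
    have e : tau u = 0 by rewrite /tau /a [Num.max _ _]max_r ?subr_le0// min_r// divr_ge0 ?room_ge0.
    by rewrite /T e scale0r addr0 !subrr normr0 mulr0.
  move=> /[dup] mP /muS /descent[_ VK].
  have h1 : tau u <= a u by rewrite ge_min lexx orbT.
  have e1 : a u = Psi u - mu by rewrite /a max_l// subr_ge0 ltW.
  have h2 : a (T u) <= a u - delta / 2 * tau u.
    have h := Psi_T u_neq0; have h3 := tau_ge0 u.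
    rewrite /a ge_max -/(a u) e1; apply/andP; split; first lra.
    (* This is the case in which the maximum defining [a (T u)] is 0: then [delta <= 2] and
       [tau u <= a u] must make up for the lost decrease. *)
    rewrite e1 in h1; apply: le_trans (_ : tau u - delta / 2 * tau u <= _); last lra.
    by rewrite -{1}(mul1r (tau u)) -mulrBl mulr_ge0//; lra.
  rewrite /T addrAC subrr add0r normrZ ger0_norm ?tau_ge0//.
  apply: le_trans (_ : C * (delta / 2 * tau u) <= _).
    rewrite (_ : C * _ = tau u * K); first by rewrite ler_wpM2l.
    by rewrite /C; field; rewrite gt_eqF.
  apply: ler_wpM2l; first by rewrite divr_ge0 ?mulr_ge0 ?(ltW K0) ?(ltW d0).
  by rewrite -/(T u); lra.
- rewrite /T => /eqP; rewrite -subr_eq0 addrAC subrr add0r scaler_eq0 => h.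
  apply/eqP; rewrite eq_le a_ge0 andbT leNgt; apply/negP => au.
  have /muS Su : mu < Psi u by move: au; rewrite lt_max ltxx orbF subr_gt0.
  have [h1 _] := descent Su; case/orP: h => [|/eqP e]; last by move: h1; rewrite e dual0; lra.
  by rewrite gt_eqF// lt_min au divr_gt0 ?room_pos.
Qed.

Lemma deformation : exists eta : W -> W, [/\ {within Z, continuous eta},
  forall u, Z u -> eta (- u) = - eta u,
  forall u, Z u -> eta u != 0,
  forall u, Z u -> Psi (eta u) <= mu &
  forall u, Z u -> `|eta u - u| <= C * a u].
Proof.
have near u : Z u -> `|iter_lim T u - u| <= C * a u.
  by move=> Zu; exact: (iter_limP C0 a_ge0 step 0).
exists (iter_lim T); split => //.
- exact: (iter_lim_continuous C0 a_ge0 continuous_step step).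
- by move=> u Zu; apply: (iter_lim_odd C0 a_ge0 step).
- by move=> u Zu; apply: near_neq0 Zu (near u Zu).
- move=> u Zu; have [] := iter_lim_zero C0 a_ge0 continuous_step step Zu.
  by rewrite /a => h _; rewrite -subr_le0 -h le_max lexx.
Qed.

End deformation.

(** * The scaled framework *)

Section ereal_order.
Context {R : realType}.

Lemma lee_of_lt_real (x y : \bar R) : (forall a : R, (x < a%:E)%E -> (y <= a%:E)%E) -> (y <= x)%E.
Proof.
move=> h; rewrite leNgt; apply/negP => xy; move: x y xy h => [x| |] [y| |]//=.
- rewrite lte_fin => xy /(_ ((x + y) / 2)); rewrite !lte_fin lee_fin => h; have := h _; lra.
- by move=> _ /(_ (x + 1)); rewrite lte_fin ltrDl ltr01 => /(_ isT); rewrite leNgt ltry.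
- by move=> _ /(_ (y - 1)); rewrite ltNyr => /(_ isT); rewrite lee_fin lerBrDl gerDr ler10.
- by move=> _ /(_ 0); rewrite ltNyr => /(_ isT); rewrite leNgt ltry.
Qed.

End ereal_order.

Section calculus.
Context {R : realType} {W : normedModType R}.
Implicit Types (u v : W) (l : dual W).

Lemma is_diff_real_comp (F : W -> R^o) (l : dual W) (phi : R -> R) (d : R) u :
  is_diff u F l -> is_derive (F u : R^o) (1 : R^o) (phi : R^o -> R^o) d ->
  is_diff u (phi \o F : W -> R^o) (d *: l : dual W).
Proof.
move=> dF [dphi dphiE].
have h : is_diff (F u) (phi : R^o -> R^o) (fun h : R^o => h *: (d : R^o)).
  have dd : differentiable (phi : R^o -> R^o) (F u) by apply/derivable1_diffP.
  apply: DiffDef => //.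
  by rewrite diff1E// derive1E dphiE.
apply: (is_diff_eq (is_diff_comp dF h)).
by apply/funext => v; rewrite scaled mulrC.
Qed.

Lemma is_diff_quotient (F H : W -> R^o) (l m : dual W) u : H u != 0 ->
  is_diff u F l -> is_diff u H m ->
  is_diff u (fun v => F v / H v : R^o) ((H u)^-1 *: (l - (F u / H u) *: m) : dual W).
Proof.
move=> H0 dF dH.
have d1 : is_derive (H u : R^o) (1 : R^o) (GRing.inv : R^o -> R^o) (- (H u) ^- 2).
  have := @is_deriveV R id (H u : R) 1 1 H0 (is_derive_id _ _).
  by rewrite /GRing.scale /= mulr1.
have d2 := is_diff_real_comp dH d1.
apply: (is_diff_eq (is_diffM dF d2)).
apply/funext => v; rewrite !scaled.
rewrite [LHS](_ : _ = F u * (- (H u ^- 2) * m v) + (H u)^-1 * l v)//.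
rewrite [RHS](_ : _ = (H u)^-1 * (l v - F u / H u * m v))//.
by field.
Qed.

Lemma is_diff_sub (F H : W -> R^o) (l m : dual W) u : is_diff u F l -> is_diff u H m ->
  is_diff u (fun v => F v - H v : R^o) (l - m : dual W).
Proof. by move=> dF dH; exact: (is_diff_eq (is_diffB dF dH)). Qed.

Lemma is_diff_scale k (F : W -> R^o) (l : dual W) u : is_diff u F l ->
  is_diff u (fun v => k * F v : R^o) (k *: l : dual W).
Proof. by move=> dF; exact: (is_diff_eq (is_diffZ k dF)). Qed.

Lemma is_diff_zero_critical (F : W -> R^o) (l : dual W) u : is_diff u F l ->
  critical_point F u <-> l = 0.
Proof.
move=> dF; split=> [[_ h]|l0].
  by apply/val_inj/funext => v; have [_ h'] := dF; rewrite /= -h' h.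
by apply: (is_diff_eq dF); rewrite l0.
Qed.

End calculus.

Section framework.
Context {R : realType} {W : completeNormedModType R}.
Variables (sc : W -> R -> W) (q s r : R) (A B f g : W -> dual W).
Hypothesis W_reflexive : reflexive_space W.
Hypothesis sc_scaling : scaling sc s.
Hypothesis AB_scaled : scaled_pair sc s A B.
Hypothesis fg_pert : perturbations sc q s r A B f g.
Hypothesis G_gt0 : forall u, u != 0 -> 0 < potential g u.

Local Notation I := (potential A).
Local Notation J := (potential B).
Local Notation G := (potential g).

Implicit Types (u v w : W) (K c t : R).

Lemma s_gt0 : 0 < s. Proof. exact: scaling_growth_gt0 sc_scaling. Qed.
Let s0 := s_gt0.

Lemma s_lt_r : s < r. Proof. by have [] := pert_degrees fg_pert. Qed.

Lemma r_gt0 : 0 < r. Proof. exact: lt_trans s0 s_lt_r. Qed.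
Let r0 := r_gt0.

Lemma potential_A : potential_operator A. Proof. by have [] := pair_A AB_scaled. Qed.
Lemma potential_B : potential_operator B. Proof. by have [] := pair_B AB_scaled. Qed.
Lemma potential_g : potential_operator g. Proof. by have [] := pert_g fg_pert. Qed.
Lemma odd_A : odd_operator A. Proof. by have [] := pair_A AB_scaled. Qed.
Lemma odd_B : odd_operator B. Proof. by have [] := pair_B AB_scaled. Qed.
Lemma odd_g : odd_operator g. Proof. by have [] := pert_g fg_pert. Qed.

Lemma I_gt0 u : u != 0 -> 0 < I u.
Proof. by apply: potential_gt0; [exact: potential_A | exact: pair_A_gt0 AB_scaled]. Qed.

Lemma J_gt0 u : u != 0 -> 0 < J u.
Proof. by apply: potential_gt0; [exact: potential_B | exact: pair_B_gt0 AB_scaled]. Qed.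

Lemma I0 : I 0 = 0. Proof. exact: potential0 potential_A. Qed.
Lemma J0 : J 0 = 0. Proof. exact: potential0 potential_B. Qed.
Lemma G0 : G 0 = 0. Proof. exact: potential0 potential_g. Qed.

Lemma J_ge0 u : 0 <= J u.
Proof. by have [->|/J_gt0/ltW//] := eqVneq u 0; rewrite J0. Qed.

Lemma G_ge0 u : 0 <= G u.
Proof. by have [->|/G_gt0/ltW//] := eqVneq u 0; rewrite G0. Qed.

Lemma scN u t : 0 <= t -> sc (- u) t = - sc u t.
Proof. by move=> t0; rewrite -(scaleN1r u) (scalingZ sc_scaling)// scaleN1r. Qed.

Lemma sc_neq0 u t : 0 < t -> u != 0 -> sc u t != 0.
Proof.
move=> t0; apply: contra => /eqP scu.
rewrite -(scaling1 sc_scaling u) -(mulfV (lt0r_neq0 t0)).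
rewrite -(scalingM sc_scaling) ?invr_ge0 ?(ltW t0)// scu -(scale0r (0 : W)).
by rewrite (scalingZ sc_scaling) ?scale0r// invr_ge0 (ltW t0).
Qed.

Lemma I_sc u t : 0 <= t -> I (sc u t) = t `^ s * I u.
Proof.
move=> t0; apply: potential_homogeneous => //; first exact: potential_A.
  exact: scalingZ sc_scaling.
by have [] := pair_A AB_scaled.
Qed.

Lemma J_sc u t : 0 <= t -> J (sc u t) = t `^ s * J u.
Proof.
move=> t0; apply: potential_homogeneous => //; first exact: potential_B.
  exact: scalingZ sc_scaling.
by have [] := pair_B AB_scaled.
Qed.

Lemma G_sc u t : 0 <= t -> G (sc u t) = t `^ r * G u.
Proof.
move=> t0; apply: potential_homogeneous => //; first exact: potential_g.
  exact: scalingZ sc_scaling.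
exact: pert_g_homogeneous fg_pert.
Qed.

Lemma continuous_sc (T : topologicalType) (x : T) (h : T -> W) (a : T -> R) :
  {for x, continuous h} -> {for x, continuous a} -> (forall y, 0 <= a y) ->
  {for x, continuous (fun y => sc (h y) (a y))}.
Proof.
move=> ch ca a_ge0.
have /subspace_continuousP/(_ (h x, a x) (a_ge0 x)) := scaling_continuous sc_scaling.
move=> c1; have c2 : (h y, a y) @[y --> x] --> (h x, a x) by exact: (cvg_pair ch ca).
move=> X /c1 /= h1; have := c2 _ h1; rewrite /nbhs /=; apply: filterS => y; apply; exact: a_ge0.
Qed.

(* The power of [G] which has the degree of homogeneity [s] of [I] and [J]. *)
Definition Gam u : R := G u `^ (s / r).
Definition gam u : dual W := (s / r * G u `^ (s / r - 1)) *: g u.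

Lemma Gam0 : Gam 0 = 0.
Proof. by rewrite /Gam G0 powR0// mulf_neq0 ?invr_neq0 ?gt_eqF. Qed.

Lemma Gam_gt0 u : u != 0 -> 0 < Gam u.
Proof. by move=> u0; rewrite powR_gt0// G_gt0. Qed.

Lemma Gam_ge0 u : 0 <= Gam u. Proof. exact: powR_ge0. Qed.

Lemma Gam_sc u t : 0 <= t -> Gam (sc u t) = t `^ s * Gam u.
Proof.
move=> t0; rewrite /Gam G_sc// powRM ?powR_ge0 ?G_ge0// -powRrM.
by rewrite mulrCA mulfV ?mulr1// gt_eqF.
Qed.

Lemma Gam_even u : Gam (- u) = Gam u.
Proof. by rewrite /Gam (potential_even _ odd_g). Qed.

Lemma gam_odd u : gam (- u) = - gam u.
Proof. by rewrite /gam (potential_even _ odd_g) odd_g scalerN. Qed.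

Lemma is_diff_Gam u : u != 0 -> is_diff u (Gam : W -> R^o) (gam u).
Proof.
move=> /G_gt0 Gu; apply: (is_diff_real_comp (phi := fun x => x `^ (s / r))).
  exact: is_diff_potential potential_g u.
exact: is_derive1_powR.
Qed.

Lemma powR_continuous (a x : R) : 0 < x -> {for x, continuous (fun y : R => y `^ a)}.
Proof.
move=> x0; apply: differentiable_continuous; apply/derivable1_diffP.
by have [] := is_derive1_powR a x0.
Qed.

Lemma cvg_gam (T : Type) (F : set_system T) (FF : Filter F) (u_ : T -> W) u : u != 0 ->
  G \o u_ @ F --> G u -> g \o u_ @ F --> g u -> gam \o u_ @ F --> gam u.
Proof.
move=> /G_gt0 Gu cG cg; apply: cvgZ => //; apply: cvgM; first exact: cvg_cst.
exact: (continuous_cvg _ (@powR_continuous _ _ Gu) cG).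
Qed.

Lemma cvg_Gam (T : Type) (F : set_system T) (FF : Filter F) (u_ : T -> W) u : u != 0 ->
  G \o u_ @ F --> G u -> Gam \o u_ @ F --> Gam u.
Proof.
move=> /G_gt0 Gu cG; exact: (continuous_cvg _ (@powR_continuous _ _ Gu) cG).
Qed.

Definition Psi K u : R := (I u - K * Gam u) / J u.
Definition Q K u : dual W :=
  (J u)^-1 *: (A u - K *: gam u - Psi K u *: B u).

Lemma Q_app K u v : Q K u v = (J u)^-1 * (A u v - K * gam u v - Psi K u * B u v).
Proof. by []. Qed.

Lemma is_diff_Psi K u : u != 0 -> is_diff u (Psi K : W -> R^o) (Q K u).
Proof.
move=> u0; apply: (@is_diff_quotient R W (fun v => I v - K * Gam v) J (A u - K *: gam u) (B u)).
- by rewrite gt_eqF// J_gt0.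
- apply: is_diff_sub; first exact: is_diff_potential potential_A u.
  by apply: is_diff_scale; exact: is_diff_Gam.
- exact: is_diff_potential potential_B u.
Qed.

Lemma continuous_Psi K u : u != 0 -> {for u, continuous (Psi K : W -> R^o)}.
Proof. by move=> u0; apply: differentiable_continuous; case: (is_diff_Psi K u0). Qed.

Lemma continuous_Q K u : u != 0 -> {for u, continuous (Q K)}.
Proof.
move=> u0; apply: cvgZ.
  apply: cvgV; first by rewrite gt_eqF// J_gt0.
  exact: (continuous_potential potential_B).
apply: cvgB; last first.
  by apply: cvgZ; [exact: continuous_Psi | exact: potential_B.1].
apply: cvgB; first exact: potential_A.1.
apply: cvgZl_tmp; apply: (@cvg_gam W _ _ id) => //; last exact: potential_g.1.
exact: (continuous_potential potential_g).
Qed.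

Lemma Psi_even K u : Psi K (- u) = Psi K u.
Proof.
by rewrite /Psi Gam_even (potential_even _ odd_A) (potential_even _ odd_B).
Qed.

Lemma Q_odd K u : Q K (- u) = - Q K u.
Proof.
rewrite /Q Psi_even gam_odd odd_A odd_B (potential_even _ odd_B) !scalerN -!opprD.
by rewrite scalerN.
Qed.

Lemma Psi_sc K u t : 0 < t -> Psi K (sc u t) = Psi K u.
Proof.
move=> t0; rewrite /Psi I_sc ?(ltW t0)// J_sc ?(ltW t0)// Gam_sc ?(ltW t0)//.
rewrite mulrCA -mulrBr -mulf_div divff ?mul1r//.
by rewrite gt_eqF// powR_gt0.
Qed.

(* Psi is 0-homogeneous, so that its differential at [sc u t] is determined by the one at [u]. *)
Lemma Q_sc K u v t : 0 < t -> Q K (sc u t) (sc v t) = Q K u v.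
Proof.
move=> t0; have t1 := ltW t0; have ts : t `^ s != 0 by rewrite gt_eqF// powR_gt0.
have hA : A (sc u t) (sc v t) = t `^ s * A u v by have [_ _ _ ->] := pair_A AB_scaled.
have hB : B (sc u t) (sc v t) = t `^ s * B u v by have [_ _ _ ->] := pair_B AB_scaled.
have hg : gam (sc u t) (sc v t) = t `^ s * gam u v.
  rewrite /gam !scaled (pert_g_homogeneous fg_pert)// G_sc//.
  have -> : (t `^ r * G u) `^ (s / r - 1) = t `^ (s - r) * G u `^ (s / r - 1).
    rewrite powRM ?powR_ge0 ?G_ge0// -powRrM.
    by congr (_ `^ _ * _); field; rewrite gt_eqF.
  have -> : t `^ s = t `^ (s - r) * t `^ r.
    by rewrite -powRD ?subrK// (gt_eqF t0) implybT.
  ring.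
rewrite !Q_app hA hB hg Psi_sc// J_sc// invfM.
have [u0|u0] := eqVneq u 0; first by rewrite u0 J0 invr0 !(mulr0,mul0r).
have Ju : J u != 0 by rewrite gt_eqF// J_gt0.
move: (J u) (t `^ s) (A u v) (gam u v) (Psi K u) (B u v) Ju ts => x1 x2 x3 x4 x5 x6 x10 x20.
by field; rewrite x10 x20.
Qed.

Definition proj u : W := sc u (I u `^ - s^-1).

Lemma proj_Ms u : u != 0 -> Ms A (proj u).
Proof.
move=> u0; rewrite /Ms /= /proj I_sc ?powR_ge0// -powRrM mulNr mulVf ?gt_eqF//.
rewrite powRN powRr1 ?mulVf ?gt_eqF ?I_gt0// ltW// I_gt0//.
Qed.

Lemma Ms_neq0 u : Ms A u -> u != 0.
Proof. by move=> Iu; apply/eqP => u0; move: Iu; rewrite /Ms /= u0 I0 => /esym/eqP; rewrite oner_eq0. Qed.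

Lemma proj_odd u : proj (- u) = - proj u.
Proof. by rewrite /proj (potential_even _ odd_A) scN// powR_ge0. Qed.

Lemma proj_Psi K u : u != 0 -> Psi K (proj u) = Psi K u.
Proof. by move=> u0; rewrite Psi_sc// powR_gt0// I_gt0. Qed.

Lemma continuous_proj u : u != 0 -> {for u, continuous proj}.
Proof.
move=> u0; apply: continuous_sc; first exact: cvg_id.
- apply: (@continuous_comp _ _ _ I (fun y => y `^ - s^-1)).
    exact: (continuous_potential potential_A).
  by apply: powR_continuous; rewrite I_gt0.
- by move=> v; exact: powR_ge0.
Qed.


(** * The Palais-Smale condition *)

Lemma A_bounded C : exists M, forall u, `|u| <= C -> `|A u| <= M.
Proof.
have [_ _ bA _] := pair_A AB_scaled.
have [M [_ MP]] : bounded_set (A @` [set u | `|u| <= C]).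
  by apply: bA; exists C; split; [exact: num_real | move=> x Cx u /= /le_trans; apply; exact: ltW].
exists (M + 1) => u uC; apply: (MP (M + 1)); first by rewrite ltrDl.
by exists u.
Qed.

Lemma I_coercive a : exists2 C, 0 < C & forall u, I u <= a -> `|u| <= C.
Proof.
have [rho rhoP] := pair_coercive AB_scaled (a + 1).
exists (`|rho| + 1); first by rewrite ltr_wpDl.
move=> u ua; rewrite leNgt; apply/negP => h.
have : rho <= `|u| by apply: le_trans (ler_norm _) _; apply: ltW; apply: le_lt_trans h; rewrite lerDl.
by move=> /rhoP; lra.
Qed.

Lemma cvg_bigsum (T : Type) (F : set_system T) (FF : Filter F) (L : Type) (l : seq L)
    (h : L -> T -> R) (a : L -> R) : (forall i, h i @ F --> a i) ->
  \sum_(i <- l) h i t @[t --> F] --> \sum_(i <- l) a i.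
Proof.
move=> ha; elim: l => [|i l IH].
  by under eq_fun do rewrite big_nil; rewrite big_nil; exact: cvg_cst.
by under eq_fun do rewrite big_cons; rewrite big_cons; exact: (@cvgD _ R^o).
Qed.

(** A weak limit lies in the closed span of its sequence, so that bounded functionals tending to 0
    on each member tend to 0 on it. *)
Lemma weak_span_limit (v_ : nat -> W) v (l_ : nat -> dual W) M : weak_cvg v_ v ->
  (forall j, `|l_ j| <= M) -> (forall i, l_ j (v_ i) @[j --> \oo] --> (0 : R)) ->
  l_ j v @[j --> \oo] --> (0 : R).
Proof.
move=> vv lM lv; apply/cvgrPdist_lt => e e0.
have M1 : 0 < `|M| + 1 by rewrite ltr_wpDl.
have [q0 qP] : exists q0, `|v - comb v_ q0| < e / 2 / (`|M| + 1).
  by apply: comb_dense; [rewrite !divr_gt0 | exact: (weak_limit_eq0 _ vv)].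
have lq : l_ j (comb v_ q0) @[j --> \oo] --> (0 : R).
  have lE j : l_ j (comb v_ q0) = \sum_(i < size q0) q0`_i * l_ j (v_ i).
    rewrite /comb; elim/big_rec2 : _ => [|i y1 y2 _ <-]; first exact: dual0.
    by rewrite dualD dualZ.
  have e00 : (0 : R) = \sum_(i < size q0) q0`_i * 0.
    by rewrite big1// => i _; rewrite mulr0.
  under eq_fun do rewrite lE.
  have /= := @cvg_bigsum nat \oo _ _ (index_enum 'I_(size q0)) (fun i j => q0`_i * l_ j (v_ i))
    (fun i => q0`_i * 0).
  rewrite -e00; apply=> i.
  by apply: cvgM; [exact: cvg_cst | exact: lv].
near=> j; rewrite sub0r normrN.
rewrite -(subrK (comb v_ q0) v) dualD; apply: le_lt_trans (ler_normD _ _) _.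
rewrite [ltRHS](splitr e); apply: ltrD.
  apply: le_lt_trans (dual_le _ _) _; apply: (@le_lt_trans _ _ ((`|M| + 1) * `|v - comb v_ q0|)).
    by rewrite ler_wpM2r// (le_trans (lM j))// (le_trans (ler_norm M))// lerDl.
  by rewrite mulrC -ltr_pdivlMr.
near: j; have e2 : 0 < e / 2 by rewrite divr_gt0.
have /cvgrPdist_lt/(_ _ e2) := lq; apply: filterS => j.
by rewrite sub0r normrN.
Unshelve. all: by end_near. Qed.

Lemma subseq_ge (e : nat -> nat) n : {homo e : i j / (i < j)%N} -> (n <= e n)%N.
Proof. by move=> he; elim: n => // n IH; exact: leq_ltn_trans IH (he _ _ (ltnSn n)). Qed.

Lemma subseq_cvg (e : nat -> nat) : {homo e : i j / (i < j)%N} -> e n @[n --> \oo] --> \oo.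
Proof.
move=> he X [N _ NX]; exists N => // n /= Nn; apply: NX => /=.
exact: leq_trans Nn (subseq_ge n he).
Qed.

Lemma weak_bounded_I (u_ : nat -> W) u C : (forall j, `|u_ j| <= C) -> weak_cvg u_ u ->
  J (u_ j) @[j --> \oo] --> J u /\ G (u_ j) @[j --> \oo] --> G u.
Proof.
move=> uC wu; split.
- exact: (potential_weak_cvg potential_B (pair_B_weak AB_scaled) uC).
- exact: (potential_weak_cvg potential_g (pert_g_weak fg_pert) uC).
Qed.

Lemma weak_cvg_Gam (u_ : nat -> W) u C : (forall j, `|u_ j| <= C) -> weak_cvg u_ u ->
  Gam (u_ j) @[j --> \oo] --> Gam u.
Proof.
move=> uC wu; have [_ cG] := weak_bounded_I uC wu.
have [u0|u0] := eqVneq u 0; last by apply: (@cvg_Gam nat \oo _ u_).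
rewrite u0 Gam0; rewrite u0 G0 in cG.
apply/cvgrPdist_lt => e e0; have e1 : 0 < e `^ (r / s) by rewrite powR_gt0.
have /cvgrPdist_lt/(_ _ e1) := cG; apply: filterS => j.
rewrite !sub0r !normrN ger0_norm ?G_ge0// ger0_norm ?Gam_ge0// => h.
have -> : e = (e `^ (r / s)) `^ (s / r).
  by rewrite -powRrM mulf_div [s * r]mulrC divff ?powRr1 ?(ltW e0)// mulf_neq0 ?gt_eqF.
by apply: gt0_ltr_powR => //; rewrite ?divr_gt0// nnegrE ?powR_ge0// G_ge0.
Qed.

(** If the weak limit were 0, then [J] and [Gam] would tend to 0, and I = K Gam + Psi J with them,
    against I -> 1. *)
Lemma weak_limit_neq0 K (u_ : nat -> W) u C (lambda : R) :
  (forall j, `|u_ j| <= C) -> weak_cvg u_ u -> (forall j, u_ j != 0) ->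
  I (u_ j) @[j --> \oo] --> (1 : R) -> Psi K (u_ j) @[j --> \oo] --> lambda -> u != 0.
Proof.
move=> uC wu un0 I1 Pl; apply/eqP => u0.
have [cJ _] := weak_bounded_I uC wu; rewrite u0 J0 in cJ.
have cGam := weak_cvg_Gam uC wu; rewrite u0 Gam0 in cGam.
have h1 : I (u_ j) - K * Gam (u_ j) @[j --> \oo] --> (1 - K * 0 : R).
  by apply: (@cvgB _ R^o) => //; apply: cvgM => //; exact: cvg_cst.
have h2 : Psi K (u_ j) * J (u_ j) @[j --> \oo] --> lambda * 0 by exact: cvgM.
have h3 : I (u_ j) - K * Gam (u_ j) @[j --> \oo] --> lambda * 0.
  have -> // : (fun j => I (u_ j) - K * Gam (u_ j)) = (fun j => Psi K (u_ j) * J (u_ j)).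
  by apply/funext => j; rewrite /Psi divfK// gt_eqF// J_gt0.
by have := real_cvg_unique _ h1 h3 => /(_ _)/eqP; rewrite !mulr0 subr0 oner_eq0.
Qed.

(** The terms of [Q] other than [A] converge strongly along weakly convergent sequences. Smallness
    of [Q] on the members of the sequence thus becomes smallness of [A] minus a fixed functional,
    which [weak_span_limit] extends to the weak limit; this is what (A7) asks for. *)
Lemma palais_smale K (lambda : R) (u_ : nat -> W) C : (forall j, `|u_ j| <= C) ->
  (forall j, u_ j != 0) ->
  I (u_ j) @[j --> \oo] --> (1 : R) -> Psi K (u_ j) @[j --> \oo] --> lambda ->
  Q K (u_ j) (u_ j) @[j --> \oo] --> (0 : R) ->
  (forall i, Q K (u_ j) (u_ i) @[j --> \oo] --> (0 : R)) ->
  exists2 e : nat -> nat, {homo e : i j / (i < j)%N} &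
    exists u, [/\ u != 0, u_ (e j) @[j --> \oo] --> u, I u = 1 & Psi K u = lambda].
Proof.
move=> uC un0 I1 Pl Qu Qui.
have [e eh [u wu]] := weakly_convergent_subsequence W_reflexive uC.
have ec := subseq_cvg eh; pose x := u_ \o e.
have xC j : `|x j| <= C by exact: uC.
have xI : I (x j) @[j --> \oo] --> (1 : R) by exact: (cvg_comp _ _ ec I1).
have xP : Psi K (x j) @[j --> \oo] --> lambda by exact: (cvg_comp _ _ ec Pl).
have u0 : u != 0 by apply: (@weak_limit_neq0 K x u C lambda) => // j; exact: un0.
have [cJ cG] := weak_bounded_I xC wu.
have cgam : gam (x j) @[j --> \oo] --> gam u.
  by apply: cvg_gam => //; exact: (pert_g_weak fg_pert).
have cB : B (x j) @[j --> \oo] --> B u by exact: (pair_B_weak AB_scaled).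
pose m_ j := K *: gam (x j) + Psi K (x j) *: B (x j); pose m := K *: gam u + lambda *: B u.
have cm : m_ j @[j --> \oo] --> m.
  by apply: cvgD; [exact: cvgZl_tmp | exact: cvgZ].
have Qm j v : A (x j) v - m v = J (x j) * Q K (x j) v + (m_ j - m) v.
  rewrite Q_app mulVKf ?gt_eqF ?J_gt0//; last exact: un0.
  rewrite subd -[m_ j v]/(K * gam (x j) v + Psi K (x j) * B (x j) v).
  move: (A (x j) v : R) (m v : R) (K * gam (x j) v) (Psi K (x j) * B (x j) v) => a1 a2 a3 a4.
  ring.
have cJQ (y_ : nat -> W) : (forall j, `|y_ j| <= C) -> Q K (x j) (y_ j) @[j --> \oo] --> (0 : R) ->
    A (x j) (y_ j) - m (y_ j) @[j --> \oo] --> (0 : R).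
  move=> yC Qy; under eq_fun do rewrite Qm.
  have h1 : J (x j) * Q K (x j) (y_ j) @[j --> \oo] --> J u * 0 by exact: cvgM.
  have h2 : (m_ j - m) (y_ j) @[j --> \oo] --> (0 : R).
    have C0 : 0 < C + 1 by rewrite ltr_wpDl// (le_trans _ (yC 0%N)).
    apply/cvgrPdist_lt => e1 e10.
    have /cvgrPdist_lt/(_ _ (divr_gt0 e10 C0)) := cm; apply: filterS => j h.
    rewrite sub0r normrN; apply: le_lt_trans (dual_le _ _) _.
    apply: (@le_lt_trans _ _ (`|m_ j - m| * (C + 1))).
      by rewrite ler_wpM2l// (le_trans (yC j))// lerDl.
    by rewrite -ltr_pdivlMr// distrC.
  rewrite mulr0 in h1; rewrite -(addr0 (0 : R)).
  exact: (@cvgD _ R^o).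
have [MA MAP] := A_bounded C.
have A1 i : (A (x j) - m) (x i) @[j --> \oo] --> (0 : R).
  by apply: (cJQ (fun=> x i)) => //; exact: (cvg_comp _ _ ec (Qui (e i))).
have A2 : (A (x j) - m) u @[j --> \oo] --> (0 : R).
  apply: (@weak_span_limit x u (fun j => A (x j) - m) (MA + `|m|)) => // j.
  by apply: le_trans (ler_normB _ _) _; rewrite lerD2r MAP.
have A3 : A (x j) (x j) - m (x j) @[j --> \oo] --> (0 : R).
  by apply: cJQ => //; exact: (cvg_comp _ _ ec Qu).
have A4 : A (x j) (x j - u) @[j --> \oo] --> (0 : R).
  have -> : (fun j => A (x j) (x j - u)) =
      (fun j => ((A (x j) (x j) - m (x j)) - (A (x j) - m) u) + (m (x j) - m u)).
    apply/funext => j; rewrite dualB subd.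
    by move: (A _ _) (A _ _) (m _) (m _) => a1 a2 a3 a4; ring.
  rewrite -(addr0 (0 : R)); apply: (@cvgD _ R^o).
    by rewrite -(subr0 (0 : R)); apply: (@cvgB _ R^o).
  by rewrite -(subrr (m u)); apply: (@cvgB _ R^o); [exact: wu | exact: cvg_cst].
have [e' eh' xu] := pair_A_compact AB_scaled wu A4.
exists (e \o e'); first by move=> i j ij; apply: eh; exact: eh'.
exists u; split => //.
- have h1 : I (x (e' j)) @[j --> \oo] --> I u.
    by apply: (continuous_cvg _ _ xu); exact: (continuous_potential potential_A).
  exact: (real_cvg_unique _ h1 (cvg_comp _ _ (subseq_cvg eh') xI)).
- have h1 : Psi K (x (e' j)) @[j --> \oo] --> Psi K u.
    by apply: (continuous_cvg _ _ xu); exact: continuous_Psi.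
  exact: (real_cvg_unique _ h1 (cvg_comp _ _ (subseq_cvg eh') xP)).
Qed.


Lemma harmonic_cvg (x : nat -> R) (a : R) N :
  (forall n, (N <= n)%N -> `|x n - a| <= n.+1%:R^-1) -> x n @[n --> \oo] --> a.
Proof.
move=> xa; apply/cvgrPdist_lt => e e0.
have /cvgrPdist_lt/(_ _ e0)[M _ MP] := @cvg_harmonic R.
exists (maxn N M) => // n /=; rewrite geq_max => /andP[Nn Mn].
rewrite distrC; apply: le_lt_trans (xa n Nn) _.
by have := MP n Mn; rewrite /= sub0r normrN /harmonic ger0_norm.
Qed.

(* The sequence [u_ j] built below almost annihilates, together with [Q (u_ j)], all the previous
   [u_ i], which yields [Q (u_ j) u -> 0] at the weak limit [u], and all the previous
   almost norming vectors of [Q (u_ i)], which forces [Q u = 0]. *)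
Lemma uniform_descent K (lambda : R) : (forall u, Ms A u -> Psi K u = lambda -> Q K u != 0) ->
  exists D : seq W, exists e : R, [/\ 0 < e, e < 1 &
    forall u, `|I u - 1| <= e -> `|Psi K u - lambda| <= e ->
      (exists2 d, d \in D & e <= `|Q K u d|) \/ e <= `|Q K u u|].
Proof.
move=> noncrit; apply: contrapT => /forallNP H.
(* [n.+2] keeps the tolerance below 1: this is required of [e], and it makes the chosen points
   nonzero. *)
have {H}/choice[pick pickP] (x : seq W * nat) : exists u,
    [/\ `|I u - 1| <= x.2.+2%:R^-1, `|Psi K u - lambda| <= x.2.+2%:R^-1,
       forall d, d \in x.1 -> `|Q K u d| < x.2.+2%:R^-1 & `|Q K u u| < x.2.+2%:R^-1].
  have /forallNP/(_ x.2.+2%:R^-1) h := H x.1.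
  apply: contrapT => /forallNP h'; apply: h; split.
  - by rewrite invr_gt0.
  - by rewrite invf_lt1// ltr1n.
  - move=> u h1 h2; apply: contrapT => /not_orP[h3 h4]; apply: (h' u); split=> //.
      by move=> d dD; rewrite ltNge; apply/negP => h5; apply: h3; exists d.
    by rewrite ltNge; apply/negP.
have /choice[wn wnP] (x : W * nat) : exists w, `|w| <= 1 /\ `|Q K x.1| - x.2.+1%:R^-1 < Q K x.1 w.
  by have [|w w1 w2] := @dual_norming R W (Q K x.1) x.2.+1%:R^-1; [rewrite invr_gt0|exists w].
pose L := fix L n := if n is n'.+1 then
  let u := pick (L n', n') in [:: u, wn (u, n') & L n'] else [::].
pose u_ n := pick (L n, n); pose w_ n := wn (u_ n, n).
have LP i j : (i < j)%N -> u_ i \in L j /\ w_ i \in L j.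
  elim: j => // j IH; rewrite ltnS leq_eqVlt => /predU1P[->|/IH[h1 h2]].
    by rewrite /= !inE !eqxx orbT.
  by rewrite /= !inE h1 h2 !orbT.
have le2 (n : nat) : (n.+2%:R^-1 : R) <= n.+1%:R^-1 by rewrite lef_pV2 ?posrE// ler_nat.
have uI n : `|I (u_ n) - 1| <= n.+1%:R^-1 by have [h _ _ _] := pickP (L n, n); exact: le_trans (le2 n).
have un0 n : u_ n != 0.
  apply/eqP => h; have [h1 _ _ _] := pickP (L n, n); move: h1; rewrite -/(u_ n) h I0 sub0r normrN normr1 /=.
  by apply/negP; rewrite -ltNge invf_lt1// ltr1n.
have [C C0 CP] := I_coercive 2.
have uC n : `|u_ n| <= C.
  apply: CP; have := le_trans (ler_norm _) (uI n).
  have h1 : (n.+1%:R^-1 : R) <= 1 by rewrite invf_le1// ler1n.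
  by move=> /le_trans/(_ h1); rewrite lerBlDr.
have small j d : d \in L j -> `|Q K (u_ j) d - 0| <= j.+1%:R^-1.
  by move=> dL; have [_ _ h _] := pickP (L j, j); rewrite subr0; apply: le_trans (le2 j); apply: ltW; apply: h.
have [||||e eh [u [u0 eu Iu Pu]]] := @palais_smale K lambda u_ C uC un0.
- by apply: (@harmonic_cvg _ _ 0%N) => n _; exact: uI.
- apply: (@harmonic_cvg _ _ 0%N) => n _.
  by have [_ h _ _] := pickP (L n, n); exact: le_trans (le2 n).
- apply: (@harmonic_cvg _ _ 0%N) => n _; rewrite subr0.
  by have [_ _ _ h] := pickP (L n, n); apply: le_trans (le2 n); exact: ltW.
- by move=> i; apply: (@harmonic_cvg _ _ i.+1) => n /LP[h _]; exact: small.
have /negP := noncrit u Iu Pu; apply; rewrite -normr_le0.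
have Qe : Q K (u_ (e j)) @[j --> \oo] --> Q K u by apply: (continuous_cvg _ (@continuous_Q K u u0) eu).
have Qw i : Q K u (w_ i) = 0.
  have h1 : Q K (u_ (e j)) (w_ i) @[j --> \oo] --> (Q K u (w_ i) : R).
    by apply: cvg_dual_app; [exact: Qe | exact: cvg_cst].
  apply: (real_cvg_unique _ h1).
  have h2 : Q K (u_ j) (w_ i) @[j --> \oo] --> (0 : R).
    by apply: (@harmonic_cvg _ _ i.+1) => n /LP[_ h]; exact: small.
  exact: (cvg_comp _ _ (subseq_cvg eh) h2).
have c1 : `|Q K (u_ (e j)) - Q K u| + (e j).+1%:R^-1 @[j --> \oo] --> (0 + 0 : R).
  apply: (@cvgD _ R^o).
    by rewrite -[X in _ --> X](@normr0 _ (dual W)) -(subrr (Q K u)); apply: cvg_norm; apply: cvgB => //; exact: cvg_cst.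
  by exact: (cvg_comp _ _ (subseq_cvg eh) (@cvg_harmonic R)).
rewrite addr0 in c1; have c2 := cvg_norm Qe.
apply: (ler_cvg_to (c2 _) c1); apply: nearW => j.
have [w1 w2] : `|w_ (e j)| <= 1 /\
  `|Q K (u_ (e j))| - (e j).+1%:R^-1 < Q K (u_ (e j)) (w_ (e j)) := wnP (u_ (e j), e j).
rewrite -lerBlDr; apply: le_trans (ltW w2) _.
have -> : Q K (u_ (e j)) (w_ (e j)) = (Q K (u_ (e j)) - Q K u) (w_ (e j)).
  by rewrite subd Qw subr0.
apply: le_trans (ler_norm _) _; apply: le_trans (dual_le _ _) _.
by rewrite ler_piMr.
Qed.


Lemma subseq_harmonic (x : nat -> R) (a : R) (e : nat -> nat) : {homo e : i j / (i < j)%N} ->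
  (forall n, `|x n - a| <= n.+1%:R^-1) -> x (e n) @[n --> \oo] --> a.
Proof.
move=> eh xa; have h := @harmonic_cvg x a 0%N (fun n _ => xa n).
exact: (cvg_comp _ _ (subseq_cvg eh) h).
Qed.

(** * Sublevel sets on [Ms] *)

Lemma Ms_bounded : exists2 C, 0 < C & forall u, Ms A u -> `|u| <= C.
Proof. by have [C C0 CP] := I_coercive 1; exists C => // u Iu; apply: CP; rewrite Iu. Qed.

Lemma Gam_bounded C : exists2 Gm, 0 < Gm & forall u, `|u| <= C -> Gam u <= Gm.
Proof.
have [M MP] := weak_to_strong_bounded (pert_g_weak fg_pert) W_reflexive C.
exists ((`|M * C| + 1) `^ (s / r)); first by rewrite powR_gt0// ltr_wpDl.
move=> u uC; apply: ge0_ler_powR; rewrite ?nnegrE ?G_ge0 ?addr_ge0// ?divr_ge0 ?(ltW s0) ?(ltW r0)//.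
apply: le_trans (potential_le potential_g MP uC) _.
by apply: le_trans (ler_norm _) _; rewrite lerDl.
Qed.

Lemma Psi_Ms K u : Ms A u -> Psi K u = (1 - K * Gam u) / J u.
Proof. by rewrite /Ms /Psi /= => ->. Qed.

Lemma Psi_anti K K' u : Ms A u -> K <= K' -> Psi K' u <= Psi K u.
Proof.
move=> Mu KK; rewrite !Psi_Ms// ler_wpM2r ?invr_ge0 ?J_ge0// lerB//.
by rewrite ler_wpM2r// Gam_ge0.
Qed.

(** On the sublevel set 1 <= K Gam + a J. Along a sequence with J -> 0 the weak limit is 0, so that
    [Gam] tends to 0 as well, a contradiction. *)
Lemma sublevel_J K a : exists2 j0, 0 < j0 & forall u, Ms A u -> Psi K u <= a -> j0 <= J u.
Proof.
apply: contrapT => H.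
have /choice[u_ uP] n : exists u, [/\ Ms A u, Psi K u <= a & J u < n.+1%:R^-1].
  apply: contrapT => /forallNP h; apply: H; exists n.+1%:R^-1; first by rewrite invr_gt0.
  by move=> u Mu Pu; rewrite leNgt; apply/negP => Ju; apply: (h u).
have [C C0 CP] := Ms_bounded.
have uC n : `|u_ n| <= C by apply: CP; have [] := uP n.
have [e eh [u wu]] := weakly_convergent_subsequence W_reflexive uC.
have xC n : `|(u_ \o e) n| <= C by exact: uC.
have [cJ _] := weak_bounded_I xC wu.
have cJ0 : J (u_ (e n)) @[n --> \oo] --> (0 : R).
  apply: (@subseq_harmonic (J \o u_) 0 e eh) => n.
  by rewrite /= subr0 ger0_norm ?J_ge0//; have [_ _ /ltW] := uP n.
have u0 : u = 0.
  apply/eqP; apply: contraT => /J_gt0.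
  by rewrite (real_cvg_unique _ cJ cJ0) ltxx.
have cGam := weak_cvg_Gam xC wu; rewrite u0 Gam0 in cGam.
have c1 : K * Gam (u_ (e n)) + a * J (u_ (e n)) @[n --> \oo] --> (K * 0 + a * 0 : R).
  by apply: (@cvgD _ R^o); apply: cvgM => //; exact: cvg_cst.
rewrite !mulr0 addr0 in c1.
have : (1 : R) <= 0.
  apply: (ler_cvg_to (@cvg_cst R 1 nat \oo _) c1); apply: nearW => n.
  have [Mu Pu _] := uP (e n).
  move: Pu; rewrite Psi_Ms// ler_pdivrMr ?J_gt0 ?Ms_neq0//; lra.
by rewrite ler10.
Qed.

(** The image of the set under [B] is relatively compact and bounded away from 0. The odd functions
    are differences of two bumps, at a point of a finite net of this image and at its antipode. *)
Lemma finite_type_J C j0 : 0 < j0 -> finite_type [set u | `|u| <= C /\ j0 <= J u].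
Proof.
move=> j00; pose X := [set u | `|u| <= C /\ j0 <= J u].
have weakX (u_ : nat -> W) : (forall n, X (u_ n)) ->
    exists2 e : nat -> nat, {homo e : i j / (i < j)%N} & exists2 u, u != 0 & B (u_ (e n)) @[n --> \oo] --> B u.
  move=> uX; have [e eh [u wu]] := weakly_convergent_subsequence W_reflexive (fun n => (uX n).1).
  exists e => //; exists u; last exact: (pair_B_weak AB_scaled).
  have xC n : `|(u_ \o e) n| <= C by exact: (uX _).1.
  have [cJ _] := weak_bounded_I xC wu.
  apply/eqP => u0; rewrite u0 J0 in cJ.
  have : j0 <= 0.
    by apply: (ler_cvg_to (@cvg_cst R j0 nat \oo _) cJ); apply: nearW => n; exact: (uX _).2.
  by rewrite leNgt j00.
have [eps e0 eP] : exists2 eps, 0 < eps & forall u, X u -> eps <= `|B u|.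
  apply: contrapT => H.
  have /choice[u_ uP] n : exists u, X u /\ `|B u| < n.+1%:R^-1.
    apply: contrapT => /forallNP h; apply: H; exists n.+1%:R^-1; first by rewrite invr_gt0.
    by move=> u Xu; rewrite leNgt; apply/negP => Bu; apply: (h u).
  have [e eh [u u0 Bu]] := weakX u_ (fun n => (uP n).1).
  have c0 : `|B (u_ (e n))| @[n --> \oo] --> (0 : R).
    apply: (@subseq_harmonic (fun n => `|B (u_ n)|) 0 e eh) => n.
    by rewrite subr0 normr_id; have [_ /ltW] := uP n.
  have Bu0 : B u = 0.
    have cN : `|B (u_ (e n))| @[n --> \oo] --> `|B u| by exact: cvg_norm.
    exact: normr0_eq0 (real_cvg_unique _ cN c0).
  by have := pair_B_gt0 AB_scaled u0; rewrite Bu0 zerod ltxx.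
have [D DP] : exists D : seq W, forall u, X u -> exists2 d, d \in D & `|B u - B d| < eps / 2.
  apply: contrapT => /forallNP H.
  have /choice[pick pickP] (D : seq W) : exists u, X u /\ forall d, d \in D -> eps / 2 <= `|B u - B d|.
    apply: contrapT => /forallNP h; apply: (H D) => u Xu; apply: contrapT => h'.
    apply: (h u); split=> // d dD; rewrite leNgt; apply/negP => h2; apply: h'; by exists d.
  pose L := fix L n := if n is n'.+1 then pick (L n') :: L n' else [::].
  pose u_ n := pick (L n).
  have LP i j : (i < j)%N -> u_ i \in L j.
    elim: j => // j IH; rewrite ltnS leq_eqVlt => /predU1P[->|/IH h].
      by rewrite /= inE eqxx.
    by rewrite /= inE h orbT.
  have [e eh [u _ Bu]] := weakX u_ (fun n => (pickP (L n)).1).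
  have e4 : 0 < eps / 4 by rewrite divr_gt0.
  have /cvgrPdist_lt/(_ _ e4)[N _ NP] := Bu.
  have := (pickP (L (e N.+1))).2 _ (LP _ _ (eh _ _ (ltnSn N))).
  rewrite -/(u_ (e N.+1)) leNgt => /negP; apply.
  rewrite (_ : B _ - B _ = (B u - B (u_ (e N))) - (B u - B (u_ (e N.+1)))); last first.
    by rewrite opprB [RHS]addrC addrA subrK.
  apply: le_lt_trans (ler_normB _ _) _.
  have h1 := NP N (leqnn N); have h2 := NP N.+1 (leqnSn N); move: h1 h2 => /=.
  set a1 := `|_|; set a2 := `|_|; lra.
pose d_ (i : 'I_(size D)) := B (D`_i).
pose bump (x : dual W) (y : dual W) : R := Num.max 0 (eps / 2 - `|x - y|).
have cbump y : continuous (fun u => bump (B u) y).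
  move=> u; apply: (@continuous_max R W (fun=> 0) (fun u => eps / 2 - `|B u - y|) u); first exact: cvg_cst.
  apply: (@cvgB _ R^o); first exact: cvg_cst.
  by apply: cvg_norm; apply: cvgB; [exact: potential_B.1 | exact: cvg_cst].
exists (size D), (fun i u => bump (B u) (d_ i) - bump (B u) (- d_ i)); split.
- move=> i x; have cb : continuous (fun u => bump (B u) (d_ i) - bump (B u) (- d_ i) : R).
    by move=> u; apply: (@cvgB _ R^o); exact: cbump.
  by apply: (@continuous_comp _ _ _ set_val (fun u => bump (B u) (d_ i) - bump (B u) (- d_ i)));
    [exact: initial_continuous | exact: cb].
- move=> i u _; rewrite odd_B /bump opprB; congr (Num.max 0 (_ - _) - Num.max 0 (_ - _)).
    by rewrite -opprD normrN opprK.
  by rewrite -normrN opprB opprK addrC.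
- move=> u Xu; have [d dD du] := DP u Xu.
  have di : (index d D < size D)%N by rewrite index_mem.
  exists (Ordinal di); rewrite /d_ nth_index//= /bump.
  have Bu := eP u Xu.
  rewrite [X in X - _]max_r; last by rewrite subr_ge0 ltW.
  rewrite [X in _ - X]max_l ?subr0; first by rewrite subr_eq0 gt_eqF.
  rewrite subr_le0 opprK.
  (* Since |B u| >= eps and |B u - B d| < eps/2, the distance of [B u] to the antipodal centre
     exceeds eps/2, and the second bump vanishes. *)
  have : 2 * `|B u| <= `|B u + B d| + `|B u - B d|.
    have <- : `|(B u + B d) + (B u - B d)| = 2 * `|B u|.
      by rewrite addrACA subrr addr0 -mulr2n -scaler_nat normrZ normr_nat.
    exact: ler_normD.
  move: Bu du; set a1 := `|_|; set a2 := `|_|; set a3 := `|_|; lra.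
Qed.

Lemma finite_type_sublevel K a : finite_type [set u | Ms A u /\ Psi K u <= a].
Proof.
have [C _ CP] := Ms_bounded; have [j0 j00 jP] := sublevel_J K a.
apply: finite_typeS (finite_type_J C j00) => u [Mu Pu]; split; first exact: CP.
exact: jP.
Qed.

Lemma sublevel_sym K a : symmetric_set [set u | Ms A u /\ Psi K u <= a].
Proof.
move=> u [Mu Pu]; rewrite /= Psi_even; split => //.
by rewrite /Ms /= (potential_even _ odd_A).
Qed.


(* Steering with bounded coefficients makes a bound on [Q] unnecessary. *)
Definition clip (x : R) := x / (1 + `|x|).

Lemma clip_gt0 (x : R) : 0 < 1 + `|x|. Proof. by rewrite ltr_pwDl. Qed.

Lemma continuous_clip : continuous clip.
Proof.
move=> x; apply: cvgM; first exact: cvg_id.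
apply: cvgV; first by rewrite gt_eqF// clip_gt0.
by apply: (@cvgD _ R^o); [exact: cvg_cst | apply: cvg_norm; exact: cvg_id].
Qed.

Lemma clipN x : clip (- x) = - clip x. Proof. by rewrite /clip normrN mulNr. Qed.

Lemma clip_le1 x : `|clip x| <= 1.
Proof.
rewrite normrM normfV (ger0_norm (ltW (clip_gt0 x))) ler_pdivrMr ?clip_gt0// mul1r.
by rewrite lerDr.
Qed.

Lemma clip_ge0 x : 0 <= clip x * x.
Proof. rewrite /clip mulrAC; apply: divr_ge0; last exact/ltW/clip_gt0.
by rewrite -expr2 sqr_ge0. Qed.

Lemma clip_ge (e x : R) : 0 < e -> e <= `|x| -> e ^+ 2 / (1 + e) <= clip x * x.
Proof.
move=> e0 ex; rewrite /clip [leRHS]mulrAC -[x * x]expr2 -(real_normK (num_real x)).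
have e1 : 0 < 1 + e by rewrite addr_gt0.
rewrite ler_pdivrMr// [leRHS]mulrAC ler_pdivlMr ?clip_gt0//.
have x0 := normr_ge0 x; move: x0 ex; move: `|x| => y y0 ey.
(* The product equals y^2 (1 + e) - e^2 (1 + y), which expresses that y^2 / (1 + y) increases. *)
have h1 : 0 <= (y - e) * (y + e + y * e).
  by rewrite mulr_ge0 ?subr_ge0// !addr_ge0 ?mulr_ge0// ltW.
rewrite -subr_ge0; apply: le_trans h1 _; rewrite le_eqVlt; apply/orP; left; apply/eqP; ring.
Qed.

(** A pseudo-gradient with fixed directions [D]. The last term is there because the scaling need not
    be t u, so that Euler's identity does not force [Q K u u] to vanish, and [uniform_descent] may
    offer nothing else. *)
Definition steer (D : seq W) K u : W :=
  - (\sum_(d <- D) clip (Q K u d) *: d) - clip (Q K u u) *: u.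

Lemma continuous_steer D K u : u != 0 -> {for u, continuous (steer D K)}.
Proof.
move=> u0; have cQu (h : W -> W) : {for u, continuous h} -> {for u, continuous (fun v => clip (Q K v (h v)))}.
  move=> ch; apply: (@continuous_comp W R R (fun v => Q K v (h v)) clip); last exact: continuous_clip.
  by apply: cvg_dual_app; [exact: continuous_Q | exact: ch].
apply: cvgB; last by apply: cvgZ; [apply: cQu | ]; exact: cvg_id.
apply: cvgN; elim: D => [|d D IH].
  by under eq_fun do rewrite big_nil; rewrite big_nil; exact: cvg_cst.
under eq_fun do rewrite big_cons; rewrite big_cons; apply: cvgD => //.
by apply: cvgZr_tmp; apply: (cQu (fun=> d)); exact: cvg_cst.
Qed.

Lemma steer_odd D K u : steer D K (- u) = - steer D K u.
Proof.
rewrite /steer opprD !opprK Q_odd oppd dualN !opprK scalerN opprK; congr (_ + _).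
rewrite -sumrN; apply: eq_bigr => d _.
by rewrite oppd clipN scaleNr opprK.
Qed.

Lemma steer_le D K u : `|steer D K u| <= \sum_(d <- D) `|d| + `|u|.
Proof.
apply: le_trans (ler_normB _ _) _; rewrite normrN; apply: lerD.
  apply: le_trans (ler_norm_sum _ _ _) _; apply: ler_sum => d _.
  by rewrite normrZ ler_piMl// clip_le1.
by rewrite normrZ ler_piMl// clip_le1.
Qed.

Lemma steer_descent D K u e : 0 < e ->
  (exists2 d, d \in D & e <= `|Q K u d|) \/ e <= `|Q K u u| ->
  Q K u (steer D K u) <= - (e ^+ 2 / (1 + e)).
Proof.
move=> e0 h; rewrite /steer dualB dualN dualZ.
have -> : Q K u (\sum_(d <- D) clip (Q K u d) *: d) = \sum_(d <- D) clip (Q K u d) * Q K u d.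
  by elim/big_rec2 : _ => [|d y1 y2 _ <-]; rewrite ?dual0// dualD dualZ.
rewrite lerNr opprB opprK; case: h => [[d dD ed]|eu].
  rewrite (big_rem d dD)/=; apply: ler_wpDl; first exact: clip_ge0.
  apply: ler_wpDr; first by apply: sumr_ge0 => i _; exact: clip_ge0.
  exact: clip_ge.
apply: ler_wpDr; first by apply: sumr_ge0 => i _; exact: clip_ge0.
exact: clip_ge.
Qed.

(** * Minimax levels and their criticality *)

Lemma minimax_lt (S : set W) (P : W -> R) k a : (minimax S P k < a%:E)%E ->
  exists M, [/\ M `<=` S, symmetric_set M, ((k%:R)%:E <= coh_index M)%E & forall u, M u -> P u < a].
Proof.
move=> /ereal_inf_lt[_ [M [MS symM kM] <-] ha]; exists M; split=> // u Mu.
rewrite -lte_fin; apply: le_lt_trans ha; apply: ereal_sup_ubound; by exists u.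
Qed.

Lemma minimax_le (S M : set W) (P : W -> R) k a : M `<=` S -> symmetric_set M ->
  ((k%:R)%:E <= coh_index M)%E -> (forall u, M u -> P u <= a) -> (minimax S P k <= a%:E)%E.
Proof.
move=> MS symM kM Pa; apply: (@le_trans _ _ (ereal_sup [set (P u)%:E | u in M])).
  by apply: ereal_inf_lbound; exists M.
by apply: ge_ereal_sup => _ [u Mu <-]; rewrite lee_fin; exact: Pa.
Qed.

Lemma minimax_eq (S : set W) (P P' : W -> R) k : (forall u, S u -> P u = P' u) ->
  minimax S P k = minimax S P' k.
Proof.
move=> PP; congr ereal_inf; apply/seteqP.
by split=> _ [M [MS symM kM] <-]; exists M => //; congr ereal_sup; apply/seteqP;
  split=> _ [u Mu <-]; exists u => //; rewrite PP//; exact: MS.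
Qed.

Lemma minimax_mono (S : set W) (P : W -> R) k l : (k <= l)%N -> (minimax S P k <= minimax S P l)%E.
Proof.
move=> kl; apply: lee_of_lt_real => a /minimax_lt[M [MS symM lM Pa]].
apply: (minimax_le MS symM) => [|u Mu]; last exact/ltW/Pa.
by apply: le_trans lM; rewrite lee_fin ler_nat.
Qed.

(** The competitor in [S'] is a whole sublevel set, not the image of [M]: it has finite type, so
    that its index can be compared with that of [M] through [h]. *)
Lemma minimax_transfer (S S' : set W) (P P' : W -> R) (h : W -> W) k :
  symmetric_set S' -> (forall u, P' (- u) = P' u) ->
  (forall a, finite_type [set u | S' u /\ P' u <= a]) ->
  (forall u, S u -> {for u, continuous h}) -> (forall u, S u -> h (- u) = - h u) ->
  (forall u, S u -> S' (h u) /\ P' (h u) = P u) ->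
  (minimax S' P' k.+1 <= minimax S P k.+1)%E.
Proof.
move=> symS' evP' fS' ch oh hP; apply: lee_of_lt_real => a /minimax_lt[M [MS symM kM Pa]].
apply: (@minimax_le S' [set u | S' u /\ P' u <= a]) => [u [] // | | |u []//].
  by move=> u [Su Pu]; split; [exact: symS' | rewrite evP'].
apply: (@coh_index_image R W W M _ h) => //.
- move=> x; apply: (@continuous_comp _ _ _ set_val h); first exact: initial_continuous.
  by apply: ch; apply: MS; exact: set_valP.
- by move=> u /MS; exact: oh.
- by move=> u Mu; have [h1 h2] := hP u (MS u Mu); split=> //; rewrite h2 ltW// Pa.
Qed.

(** A set with [Psi K] below lambda + eta would be deformed in [W] below lambda - eta, and [proj]
    carries the result back to [Ms] without changing [Psi K]. The descent estimate is therefore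
    needed on a neighbourhood [S] that allows I to differ from 1. *)
Lemma critical_level K (lambda : R) k : minimax (Ms A) (Psi K) k.+1 = lambda%:E ->
  exists u, [/\ Ms A u, Psi K u = lambda & Q K u = 0].
Proof.
move=> mk; apply: contrapT => /forallNP H.
have [|D [e [e0 e1 De]]] := @uniform_descent K lambda.
  by move=> u Mu Pu; apply/eqP => Qu; exact: (H u).
have [C C0 CP] := I_coercive 2.
pose S := [set u | `|I u - 1| <= e /\ `|Psi K u - lambda| <= e].
pose L := \sum_(d <- D) `|d| + C; pose delta := e ^+ 2 / (1 + e).
have L0 : 0 < L by rewrite ltr_wpDl// sumr_ge0.
have e11 : 0 < 1 + e by rewrite addr_gt0.
have d0 : 0 < delta <= 2.
  rewrite divr_gt0 ?exprn_gt0//= ler_pdivrMr//.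
  have : e ^+ 2 <= 1 by rewrite expr_le1 // ltW.
  by move: e0 => /[swap]; lra.
have [LA LAP] := A_bounded (C + 1).
have LI := potential_lipschitz potential_A LAP.
pose Cd := 2 * L / delta.
have Cd0 : 0 < Cd by have /andP[h _] := d0; rewrite divr_gt0// mulr_gt0.
(* A displacement of at most [rho] changes I by at most [e], [LA] being a Lipschitz constant of I on
   the ball of radius [C + 1]; the bound 1 keeps the points in that ball. *)
pose rho := Num.min 1 (e / (`|LA| + 1)).
have LA0 : 0 < `|LA| + 1 by rewrite ltr_wpDl.
have rho0 : 0 < rho by rewrite lt_min ltr01 divr_gt0.
(* The level has to drop by at most 2 eta, which costs a displacement of at most 2 eta [Cd], hence
   at most [rho]. *)
pose eta := Num.min e (rho / (2 * Cd)).
have eta0 : 0 < eta by rewrite lt_min e0 divr_gt0// mulr_gt0.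
pose Z := [set u | Ms A u /\ Psi K u <= lambda + eta].
have near_rho u0 u : Z u0 -> `|u - u0| <= Cd * Num.max (Psi K u0 - (lambda - eta)) 0 -> `|u - u0| <= rho.
  move=> [_ Pu0] /le_trans; apply.
  apply: (@le_trans _ _ (Cd * (2 * eta))).
    rewrite ler_pM2l// ge_max; apply/andP; split; last by rewrite mulr_ge0// ltW.
    by lra.
  have -> : Cd * (2 * eta) = eta * (2 * Cd) by ring.
  have h : eta <= rho / (2 * Cd) by rewrite ge_min lexx orbT.
  by move: h; rewrite ler_pdivlMr// mulr_gt0.
have near_I u0 u : Z u0 -> `|u - u0| <= rho -> `|I u - 1| <= e.
  move=> [Iu0 _] uu0; have u0C : `|u0| <= C by apply: CP; rewrite Iu0 ler1n.
  have uC : `|u| <= C + 1.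
    rewrite -(subrK u0 u) addrC; apply: le_trans (ler_normD _ _) _; apply: lerD => //.
    by apply: le_trans uu0 _; rewrite ge_min lexx.
  have u0C1 : `|u0| <= C + 1 by apply: le_trans u0C _; rewrite lerDl.
  have := LI _ _ uC u0C1; rewrite Iu0 => /le_trans; apply.
  apply: (@le_trans _ _ ((`|LA| + 1) * rho)).
    apply: ler_pM => //; first exact: le_trans (LAP _ uC).
    by apply: le_trans (ler_norm _) _; rewrite lerDl.
  by rewrite mulrC -ler_pdivlMr// ge_min lexx orbT.
have [|||||||||||h [ch oh h0 hmu _]] := @deformation R W (Psi K) (Q K) (steer D K) S Z (lambda - eta) delta L.
- by move=> u; exact: is_diff_Psi.
- by move=> u; exact: continuous_Q.
- by move=> u; exact: continuous_steer.
- by move=> u; exact: Q_odd.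
- by move=> u; exact: steer_odd.
- by move=> u; exact: Psi_even.
- exact: L0.
- exact: d0.
- move=> u [Iu Pu]; split; first by apply: steer_descent => //; exact: De.
  apply: le_trans (steer_le _ _ _) _; rewrite lerD2l; apply: CP.
  by have := le_trans (ler_norm _) Iu; lra.
- move=> u0 u Zu0 /(near_rho _ _ Zu0)/(near_I _ _ Zu0) Iu; apply/eqP => u00.
  by move: Iu; rewrite u00 I0 sub0r normrN normr1 leNgt e1.
- move=> u0 u Zu0 /(near_rho _ _ Zu0)/(near_I _ _ Zu0) Iu /andP[h1 h2]; split=> //.
  have ee : eta <= e by rewrite ge_min lexx.
  have := Zu0.2; rewrite ler_norml; lra.
have := @minimax_lt (Ms A) (Psi K) k.+1 (lambda + eta); rewrite mk lte_fin ltrDl => /(_ eta0).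
move=> [M [MMs symM kM MP]].
have MZ u : M u -> Z u by move=> Mu; split; [exact: MMs | apply: ltW; exact: MP].
have : (lambda%:E <= (lambda - eta)%:E)%E.
  rewrite -mk; apply: (@minimax_le (Ms A) [set u | Ms A u /\ Psi K u <= lambda - eta]).
  - by move=> u [].
  - exact: sublevel_sym.
  - apply: (@coh_index_image R W W M _ (proj \o h)) => //.
    + exact: finite_type_sublevel.
    + have /(subspace_sigL_continuousP M h) cM := continuous_subspaceW MZ ch.
      move=> x; apply: (@continuous_comp _ W W (fun y : set_type M => h (set_val y)) proj); first exact: cM.
      by apply: continuous_proj; apply: h0; apply: MZ; exact: set_valP.
    + by move=> u Mu /=; rewrite oh ?proj_odd//; exact: MZ.
    + move=> u /MZ Zu /=; split; first by apply: proj_Ms; exact: h0.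
      by rewrite proj_Psi ?hmu ?h0.
  - by move=> u [].
by rewrite lee_fin; lra.
Qed.


(** * Dependence of the levels on [K] *)

Lemma sublevel_Gam a : exists2 g0, 0 < g0 & forall u, Ms A u -> Psi 0 u <= a -> g0 <= Gam u.
Proof.
have [j0 j00 jP] := sublevel_J 0 a.
apply: contrapT => H.
have /choice[u_ uP] n : exists u, [/\ Ms A u, Psi 0 u <= a & Gam u < n.+1%:R^-1].
  apply: contrapT => /forallNP h; apply: H; exists n.+1%:R^-1; first by rewrite invr_gt0.
  by move=> u Mu Pu; rewrite leNgt; apply/negP => Gu; apply: (h u).
have [C C0 CP] := Ms_bounded.
have uC n : `|u_ n| <= C by apply: CP; have [] := uP n.
have [e eh [u wu]] := weakly_convergent_subsequence W_reflexive uC.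
have xC n : `|(u_ \o e) n| <= C by exact: uC.
have cG0 : Gam (u_ (e n)) @[n --> \oo] --> (0 : R).
  apply: (@subseq_harmonic (Gam \o u_) 0 e eh) => n.
  by rewrite /= subr0 ger0_norm ?Gam_ge0//; have [_ _ /ltW] := uP n.
have u0 : u = 0.
  apply/eqP; apply: contraT => /Gam_gt0.
  by rewrite (real_cvg_unique _ (weak_cvg_Gam xC wu) cG0) ltxx.
(* A vanishing weak limit contradicts the lower bound of [J] on the sublevel set. *)
have [cJ _] := weak_bounded_I xC wu; rewrite u0 J0 in cJ.
have : j0 <= 0.
  apply: (ler_cvg_to (@cvg_cst R j0 nat \oo _) cJ); apply: nearW => n.
  by have [Mu Pu _] := uP (e n); exact: jP.
by rewrite leNgt j00.
Qed.

Lemma J_bounded C : exists2 Jm, 0 < Jm & forall u, `|u| <= C -> J u <= Jm.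
Proof.
have [M MP] := weak_to_strong_bounded (pair_B_weak AB_scaled) W_reflexive C.
exists (`|M * C| + 1); first by rewrite ltr_wpDl.
move=> u uC; apply: le_trans (potential_le potential_B MP uC) _.
by apply: le_trans (ler_norm _) _; rewrite lerDl.
Qed.

Lemma Psi_shift K K' u : Ms A u -> Psi K' u = Psi K u - (K' - K) * (Gam u / J u).
Proof. by move=> Mu; rewrite !Psi_Ms// mulrA -mulrBl; congr (_ / _); ring. Qed.

(* [- (Gam u / J u)] is the slope of [K |-> Psi K u]. *)
Lemma slope_lower a : exists2 c0, 0 < c0 &
  forall u, Ms A u -> Psi 0 u <= a -> c0 <= Gam u / J u.
Proof.
have [g0 g00 gP] := sublevel_Gam a; have [C _ CP] := Ms_bounded.
have [Jm Jm0 JP] := J_bounded C.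
exists (g0 / Jm); first by rewrite divr_gt0.
move=> u Mu Pu; apply: ler_pM; rewrite ?invr_ge0 ?(ltW g00) ?(ltW Jm0)//; first exact: gP.
by rewrite lef_pV2 ?posrE ?J_gt0 ?Ms_neq0//; apply: JP; exact: CP.
Qed.

(** Bounds how fast the levels can fall, as needed for their finiteness and Lipschitz continuity;
    [slope_lower] gives strict decrease and divergence. *)
Lemma slope_upper K a : exists2 c1, 0 < c1 &
  forall u, Ms A u -> Psi K u <= a -> Gam u / J u <= c1.
Proof.
have [j0 j00 jP] := sublevel_J K a; have [C _ CP] := Ms_bounded.
have [Gm Gm0 GP] := Gam_bounded C.
exists (Gm / j0); first by rewrite divr_gt0.
move=> u Mu Pu; apply: ler_pM; rewrite ?invr_ge0 ?Gam_ge0 ?J_ge0//; first by apply: GP; exact: CP.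
by rewrite lef_pV2 ?posrE ?J_gt0 ?Ms_neq0//; exact: jP.
Qed.

Lemma Psi0_ge0 u : 0 <= Psi 0 u.
Proof.
rewrite /Psi mul0r subr0 divr_ge0 ?J_ge0//.
by have [->|/I_gt0/ltW//] := eqVneq u 0; rewrite I0.
Qed.

Lemma index_gt0_nonempty (M : set W) k : ((k.+1%:R)%:E <= coh_index M)%E -> M !=set0.
Proof. by move=> /coh_index_geP[]. Qed.

Lemma minimax_to_infty K a : exists n : nat, forall k, (n <= k)%N ->
  (a%:E <= minimax (Ms A) (Psi K) k.+1)%E.
Proof.
have [n nP] := finite_type_index (finite_type_sublevel K a).
exists n => k nk; rewrite leNgt; apply/negP => /minimax_lt[M [MS symM kM Pa]].
apply: (nP M symM) => [u Mu|]; first by split; [exact: MS | exact/ltW/Pa].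
by apply: le_trans kM; rewrite lee_fin ler_nat.
Qed.

Hypothesis W_infinite : infinite_dimensional W.

Lemma independent_sequence : exists b : nat -> W, forall n (a : nat -> R),
  \sum_(i < n) a i *: b i = 0 -> forall i, (i < n)%N -> a i = 0.
Proof.
have /choice[pick pickP] (D : seq W) : exists x, forall a : 'I_(size D) -> R, x != \sum_(i < size D) a i *: D`_i.
  exact: W_infinite.
pose L := fix L n := if n is n'.+1 then rcons (L n') (pick (L n')) else [::].
have sL n : size (L n) = n by elim: n => // n IH; rewrite /= size_rcons IH.
pose b n := pick (L n).
have Lb n i : (i < n)%N -> (L n)`_i = b i.
  elim: n => // n IH; rewrite ltnS leq_eqVlt /= nth_rcons sL => /predU1P[->|h].
    by rewrite ltnn eqxx.
  by rewrite h IH.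
exists b; elim=> // n IH a; rewrite big_ord_recr /= => sum0.
have an0 : a n = 0.
  apply: contrapT => /eqP an0.
  have := pickP (L n) (fun i => - (a i / a n)); rewrite -/(b n) => /eqP; apply.
  have e : a n *: b n = - \sum_(i < n) a i *: b i.
    by apply/eqP; rewrite -addr_eq0 addrC sum0.
  rewrite -[LHS](scalerK an0) e scalerN scaler_sumr -sumrN.
  rewrite [RHS](_ : _ = \sum_(i < n) - (a i / a n) *: b i); last first.
    rewrite -(big_mkord predT (fun i => - (a i / a n) *: (L n)`_i)) sL big_mkord.
    by apply: eq_bigr => i _; rewrite Lb.
  by apply: eq_bigr => i _; rewrite scalerA scaleNr mulrC.
move=> i; rewrite ltnS leq_eqVlt => /predU1P[->//|]; apply: IH.
by move: sum0; rewrite an0 scale0r addr0.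
Qed.

(** Independent vectors embed the l1 sphere oddly into [W] away from 0; by compactness its image
    lies in a sublevel set after projection to [Ms]. *)
Lemma index_sublevel k : exists a : R, ((k.+1%:R)%:E <= coh_index [set u | Ms A u /\ (Psi 0 u <= a)%R])%E.
Proof.
have [b bP] := independent_sequence.
pose V := 'rV[R]_k.+1.
pose phi (x : V) : W := \sum_(i < k.+1) x 0 i *: b i.
have phi0 x : l1_sphere x -> phi x != 0.
  move=> x1; apply/eqP => e.
  have h := bP k.+1 (fun i => x 0 (inord i)).
  have {}h : forall i : 'I_k.+1, x 0 i = 0.
    move=> i; rewrite -(inord_val i); apply: h => //.
    by rewrite -[RHS]e; apply: eq_bigr => j _; rewrite inord_val.
  have /eqP := x1; rewrite /l1 big1 ?(eq_sym 0) ?oner_eq0// => i _.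
  by rewrite h normr0.
have phiN x : phi (- x) = - phi x.
  by rewrite -sumrN; apply: eq_bigr => i _; rewrite mxE scaleNr.
have cphi : continuous phi.
  move=> x; apply: (@continuous_at_sum R V W _ (index_enum 'I_k.+1) (fun i (y : V) => y 0 i *: b i)) => i.
  apply: (@continuous_comp V R W (fun y : V => y 0 i) (fun t => t *: b i)); first exact: coord_continuous.
  by apply: cvgZr_tmp; exact: cvg_id.
have [a aP] : exists a, forall x, l1_sphere x -> Psi 0 (phi x) <= a.
  have [||c _ cP] := @compact_EVT_max V R (Psi 0 \o phi) (@l1_sphere R k) (l1_sphere_nonempty k).
  - exact: l1_sphere_compact.
  - apply: continuous_in_subspaceT => x /set_mem x1.
    by apply: continuous_comp; [exact: cphi | apply: continuous_Psi; exact: phi0].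
  by exists (Psi 0 (phi c)) => x x1; apply: cP; exact: mem_set.
exists a; apply: (@coh_index_image R W ((V : normedModType R) : preTopologicalLmodType R) (@l1_sphere R k) _ (proj \o phi)).
- exact: l1_sphere_sym.
- exact: finite_type_sublevel.
- move=> x; apply: (@continuous_comp _ _ _ set_val (proj \o phi)); first exact: initial_continuous.
  by apply: continuous_comp; [exact: cphi | apply: continuous_proj; exact/phi0/set_valP].
- by move=> x x1; rewrite /= phiN proj_odd.
- move=> x x1; split; first by apply: proj_Ms; exact: phi0.
  by rewrite proj_Psi ?aP ?phi0.
- exact: coh_index_l1_sphere.
Qed.


(** Where [Psi K] is nonpositive the slope is bounded, so that [Psi K] lies at most [K * c1] below
    [Psi 0], which is nonnegative. *)
Lemma Psi_lower K : 0 <= K -> exists b, forall u, Ms A u -> b <= Psi K u.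
Proof.
move=> K0; have [c1 c10 cP] := slope_upper K 0; exists (- (K * c1)) => u Mu.
have [P0|/ltW P0] := leP (Psi K u) 0; last first.
  by apply: le_trans P0; rewrite oppr_le0 mulr_ge0// ltW.
rewrite (Psi_shift 0 K Mu) subr0.
have := Psi0_ge0 u; have := ler_wpM2l K0 (cP u Mu P0); lra.
Qed.

(* Indices are shifted: [mm K k] is the minimax level with index [k.+1]. *)
Definition mm K k : R := fine (minimax (Ms A) (Psi K) k.+1).

Lemma mmE K k : 0 <= K -> minimax (Ms A) (Psi K) k.+1 = (mm K k)%:E.
Proof.
move=> K0; have [a ka] := index_sublevel k.
have h1 : (minimax (Ms A) (Psi K) k.+1 <= a%:E)%E.
  apply: (@minimax_le (Ms A) [set u | Ms A u /\ Psi 0 u <= a]) => [u []// | | // |u [Mu]].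
    exact: sublevel_sym.
  by apply: le_trans; exact: Psi_anti.
have [b bP] := Psi_lower K0.
have h2 : (b%:E <= minimax (Ms A) (Psi K) k.+1)%E.
  rewrite leNgt; apply/negP => /minimax_lt[M [MS _ /index_gt0_nonempty[u Mu] Pa]].
  by have := Pa u Mu; rewrite ltNge bP//; exact: MS.
rewrite /mm; move: h1 h2; by case: (minimax _ _ _).
Qed.

Lemma mm_lt K k a : 0 <= K -> mm K k < a ->
  exists M, [/\ M `<=` Ms A, symmetric_set M, ((k.+1%:R)%:E <= coh_index M)%E &
    forall u, M u -> Psi K u < a].
Proof. by move=> K0 ma; apply: minimax_lt; rewrite mmE// lte_fin. Qed.

Lemma mm_le K k a M : 0 <= K -> M `<=` Ms A -> symmetric_set M ->
  ((k.+1%:R)%:E <= coh_index M)%E -> (forall u, M u -> Psi K u <= a) -> mm K k <= a.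
Proof. by move=> K0 MS symM kM Pa; rewrite -lee_fin -mmE//; exact: minimax_le kM Pa. Qed.

Lemma mm_mono K k l : 0 <= K -> (k <= l)%N -> mm K k <= mm K l.
Proof. by move=> K0 kl; rewrite -lee_fin -!mmE//; exact: minimax_mono. Qed.

(** On a nearly optimal set for [K] the slope is at least [c0], so that passing to [K'] lowers [Psi]
    uniformly by (K' - K) c0, more than the error [e] in optimality. *)
Lemma mm_anti K K' k : 0 <= K -> K < K' -> mm K' k < mm K k.
Proof.
move=> K0 KK; have K'0 : 0 <= K' by apply: le_trans K0 (ltW KK).
have [c1 c10 c1P] := slope_upper K (mm K k + 1).
(* [slope_lower] requires a bound on [Psi 0], which exceeds [Psi K] by at most [K * c1] on the sets
   considered. *)
have [c0 c00 c0P] := slope_lower (mm K k + 1 + K * c1).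
have d0 : 0 < (K' - K) * c0 by rewrite mulr_gt0// subr_gt0.
pose e := Num.min 1 ((K' - K) * c0 / 2).
have e0 : 0 < e by rewrite lt_min ltr01 divr_gt0.
have e1 : e <= 1 by rewrite ge_min lexx.
have e2 : e <= (K' - K) * c0 / 2 by rewrite ge_min lexx orbT.
have [|M [MS symM kM MP]] := @mm_lt K k (mm K k + e) K0; first by rewrite ltrDl.
apply: (@le_lt_trans _ _ (mm K k + e - (K' - K) * c0)); last lra.
apply: (mm_le K'0 MS symM kM) => u Mu; have MsU := MS u Mu.
have Pu := MP u Mu.
have P1 : Psi K u <= mm K k + 1 by apply: le_trans (ltW Pu) _; rewrite lerD2l.
have P2 : Psi 0 u <= mm K k + 1 + K * c1.
  rewrite (Psi_shift K 0 MsU) sub0r mulNr opprK; apply: lerD => //.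
  by apply: ler_wpM2l => //; exact: c1P.
rewrite (Psi_shift K K' MsU) lerB ?(ltW Pu)//.
by apply: ler_wpM2l; [rewrite subr_ge0 ltW | exact: c0P].
Qed.

Lemma mm_anti_le K K' k : 0 <= K -> K <= K' -> mm K' k <= mm K k.
Proof. by move=> K0; rewrite le_eqVlt => /predU1P[->//|/(mm_anti k K0)/ltW]. Qed.

(** As [Psi] decreases in [K], the nearly optimal sets for all parameters up to [K1] lie in one
    sublevel set of [Psi K1], where the slope has a common bound. *)
Lemma mm_lipschitz K1 k : 0 <= K1 -> exists2 L, 0 < L &
  forall K K', 0 <= K -> K <= K' -> K' <= K1 -> mm K k <= mm K' k + (K' - K) * L.
Proof.
move=> K10; have [c1 c10 c1P] := slope_upper K1 (mm 0 k + 1).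
exists c1 => // K K' K0 KK KK1; have K'0 := le_trans K0 KK.
apply/ler_addgt0Pr => e e0; pose e' := Num.min 1 e.
have e'0 : 0 < e' by rewrite lt_min ltr01.
have [|M [MS symM kM MP]] := @mm_lt K' k (mm K' k + e') K'0; first by rewrite ltrDl.
apply: (mm_le K0 MS symM kM) => u Mu; have MsU := MS u Mu.
have Pu := ltW (MP u Mu).
have P1 : Psi K1 u <= mm 0 k + 1.
  apply: le_trans (Psi_anti MsU KK1) _; apply: le_trans Pu _.
  by apply: lerD; [exact: mm_anti_le | rewrite ge_min lexx].
have hs : (K' - K) * (Gam u / J u) <= (K' - K) * c1.
  by apply: ler_wpM2l; [rewrite subr_ge0 | exact: c1P].
have he : e' <= e by rewrite ge_min lexx orbT.
have -> : Psi K u = Psi K' u + (K' - K) * (Gam u / J u).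
  by rewrite (Psi_shift K K' MsU) subrK.
by rewrite addrAC; apply: lerD => //; apply: le_trans Pu _; rewrite lerD2l.
Qed.

(** One sublevel set of [Psi 0] of large index competes for every [K], and on it [Psi K] is at most
    b - K c0. *)
Lemma mm_to_ninfty k a : exists2 K0, 0 <= K0 & forall K, K0 <= K -> mm K k <= a.
Proof.
have [b kb] := index_sublevel k; have [c0 c00 c0P] := slope_lower b.
exists (Num.max 0 ((b - a) / c0)); first by rewrite le_max lexx.
move=> K; rewrite ge_max => /andP[K0]; rewrite ler_pdivrMr// => h.
apply: (mm_le K0 _ _ kb) => [u []// | |u [MsU P0]]; first exact: sublevel_sym.
rewrite (Psi_shift 0 K MsU) subr0.
have := ler_wpM2l K0 (c0P u MsU P0); lra.
Qed.

Lemma mm_to_infty K a : 0 <= K -> exists n : nat, forall k, (n <= k)%N -> a <= mm K k.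
Proof.
move=> K0; have [n nP] := minimax_to_infty K a; exists n => k /nP.
by rewrite mmE// lee_fin.
Qed.

Lemma mm_critical K k : 0 <= K -> exists u, [/\ Ms A u, Psi K u = mm K k & Q K u = 0].
Proof. by move=> K0; apply: (@critical_level K _ k); exact: mmE. Qed.


(** * Return to the Nehari set and the original functionals *)

Hypothesis F_eq0 : forall u, u != 0 -> potential f u = 0.

Local Notation lambda_fun := (lambda_fun A B f g).
Local Notation Phi := (Phi A B f g).
Local Notation nehari := (nehari sc A B f g).

Lemma F0 u : potential f u = 0.
Proof.
have [->|/F_eq0//] := eqVneq u 0; apply: potential0.
by have [] := pert_f fg_pert.
Qed.

Lemma lambda_funE c u : lambda_fun c u = (I u - G u - c) / J u.
Proof. by rewrite /Defs.lambda_fun F0 subr0. Qed.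

Lemma PhiE (lambda : R) u : Phi lambda u = I u - lambda * J u - G u.
Proof. by rewrite /Defs.Phi F0 subr0. Qed.

Lemma is_diff_Phi (lambda : R) u :
  is_diff u (Phi lambda : W -> R^o) (A u - lambda *: B u - g u : dual W).
Proof.
have -> : (Phi lambda : W -> R^o) = (fun v => I v - lambda * J v - G v).
  by apply/funext => v; rewrite PhiE.
apply: is_diff_sub; last exact: is_diff_potential potential_g u.
apply: is_diff_sub; first exact: is_diff_potential potential_A u.
by apply: is_diff_scale; exact: is_diff_potential potential_B u.
Qed.

Lemma is_diff_lambda_fun c u : u != 0 -> is_diff u (lambda_fun c : W -> R^o)
  ((J u)^-1 *: (A u - g u - lambda_fun c u *: B u) : dual W).
Proof.
move=> u0; rewrite lambda_funE.
have -> : (lambda_fun c : W -> R^o) = (fun v => (I v - G v - c) / J v).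
  by apply/funext => v; rewrite lambda_funE.
apply: (@is_diff_quotient R W (fun v => I v - G v - c) J (A u - g u) (B u)).
- by rewrite gt_eqF// J_gt0.
- rewrite -[A u - g u]subr0.
  apply: (@is_diff_sub _ _ (fun v => I v - G v) (fun=> c) (A u - g u) 0).
  apply: is_diff_sub; first exact: is_diff_potential potential_A u.
  exact: is_diff_potential potential_g u.
- exact: is_diff_potential potential_B u.
Qed.

(** The zero x of c s - (r - s) x, the factor that decides the sign of the derivative along a fibre,
    where x is the value of G. *)
Definition kap c := c * (s / (r - s)).

Let rs0 : 0 < r - s. Proof. by rewrite subr_gt0 s_lt_r. Qed.

Lemma kap_gt0 c : 0 < c -> 0 < kap c.
Proof. by move=> c0; rewrite !mulr_gt0// invr_gt0. Qed.

Definition Kc_exp : R := 1 - s / r.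
Definition Kc_factor : R := r / (r - s) * (s / (r - s)) `^ (- (s / r)).

(* [Psi (Kc c)] agrees with [lambda_fun c] where [G = kap c]. *)
Definition Kc c := Kc_factor * c `^ Kc_exp.

Lemma Kc_kap c : 0 < c -> Kc c * kap c `^ (s / r) = kap c + c.
Proof.
move=> c0; rewrite /Kc /Kc_factor /Kc_exp /kap (powRM _ (ltW c0) (ltW (divr_gt0 s0 rs0))).
have h1 : (s / (r - s)) `^ (- (s / r)) * (s / (r - s)) `^ (s / r) = 1.
  by rewrite -powRD ?addNr ?powRr0// (gt_eqF (divr_gt0 s0 rs0)) implybT.
have h2 : c `^ (1 - s / r) * c `^ (s / r) = c.
  by rewrite -powRD ?subrK ?powRr1 ?(ltW c0)// (gt_eqF c0) implybT.
transitivity (r / (r - s) * ((s / (r - s)) `^ (- (s / r)) * (s / (r - s)) `^ (s / r)) *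
  (c `^ (1 - s / r) * c `^ (s / r))); first by ring.
rewrite h1 h2 mulr1; field; exact: lt0r_neq0.
Qed.

(** Equality of slopes in the tangency. Where G = [kap c] it turns [Kc c] times [gam] into [g], so
    that a critical point of [Psi] solves the original equation. *)
Lemma Kc_slope c : 0 < c -> Kc c * (s / r * kap c `^ (s / r - 1)) = 1.
Proof.
move=> c0; have k0 := kap_gt0 c0.
have -> : kap c `^ (s / r - 1) = kap c `^ (s / r) / kap c.
  by rewrite powRB ?powRr1 ?(ltW k0)// (gt_eqF k0) implybT.
transitivity (s / r * (Kc c * kap c `^ (s / r)) / kap c); first by ring.
rewrite Kc_kap// /kap; field.
by rewrite !gt_eqF.
Qed.

Lemma Kc_factor_gt0 : 0 < Kc_factor.
Proof. by rewrite !mulr_gt0 ?powR_gt0 ?invr_gt0 ?divr_gt0. Qed.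

Lemma Kc_gt0 c : 0 < c -> 0 < Kc c.
Proof. by move=> c0; rewrite mulr_gt0 ?Kc_factor_gt0 ?powR_gt0. Qed.

Lemma is_derive_fiber u t c : Ms A u -> 0 < t ->
  is_derive t (1 : R) (fun t' : R => lambda_fun c (sc u t') : R^o)
    ((J u)^-1 * t `^ (- s - 1) * (c * s - (r - s) * G (sc u t))).
Proof.
move=> Mu t0; have Ju := J_gt0 (Ms_neq0 Mu).
(* The functional along the fibre with the factor t^s cancelled; the two agree only for positive
   arguments, hence near [t]. *)
pose psi t' : R := (J u)^-1 * (1 - G u * t' `^ (r - s) - c * t' `^ (- s)).
have e x : 0 < x -> lambda_fun c (sc u x) = psi x.
  move=> x0; rewrite lambda_funE I_sc ?J_sc ?G_sc ?(ltW x0)// Mu mulr1 /psi.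
  have -> : x `^ (r - s) = x `^ r / x `^ s by rewrite powRB// (gt_eqF x0) implybT.
  rewrite powRN; have : x `^ s != 0 by rewrite gt_eqF// powR_gt0.
  move: (x `^ s) (x `^ r) (J u) Ju (G u) => y1 y2 y3 y30 y4 y10.
  by field; rewrite y10 gt_eqF.
have h1 : \near t, (psi t : R^o) = lambda_fun c (sc u t).
  near=> x; rewrite e//; near: x; exact: lt_nbhsr.
apply: (near_eq_is_derive h1).
have d1 := is_derive1_powR (r - s) t0; have d2 := is_derive1_powR (- s) t0.
have d3 : is_derive t 1 ((J u)^-1 *: ((cst 1 : R -> R^o) - G u *: (fun x : R => x `^ (r - s) : R^o) - c *: (fun x : R => x `^ (- s) : R^o)))
   ((J u)^-1 *: (0 - G u *: ((r - s) * t `^ (r - s - 1)) - c *: (- s * t `^ (- s - 1)))).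
  by apply: is_deriveZ; apply: is_deriveB.
apply: (is_derive_eq d3).
rewrite G_sc ?(ltW t0)// /GRing.scale /=.
have -> : t `^ (r - s - 1) = t `^ (- s - 1) * t `^ r.
  by rewrite -powRD ?(gt_eqF t0) ?implybT//; congr (_ `^ _); ring.
ring.
Unshelve. all: by end_near. Qed.

Lemma nehariE c v : 0 < c -> nehari c v <-> v != 0 /\ G v = kap c.
Proof.
move=> c0; have kE x : c * s - (r - s) * x = 0 <-> x = kap c.
  rewrite /kap; split=> [/eqP|->]; last by field; exact: lt0r_neq0.
  by rewrite subr_eq0 => /eqP e; apply: (mulfI (lt0r_neq0 rs0)); rewrite -e; field; exact: lt0r_neq0.
split=> [[u [t [Mu t0 dt ->]]]|[v0 Gv]].
  split; first by rewrite sc_neq0// Ms_neq0.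
  apply/kE; have [_ dt0] := dt; have [_ ] := is_derive_fiber c Mu t0; rewrite dt0 => /esym/eqP.
  by rewrite !mulf_eq0 invr_eq0 gt_eqF ?J_gt0 ?Ms_neq0// powR_eq0 gt_eqF//= => /eqP.
have t0 : 0 < I v `^ s^-1 by rewrite powR_gt0// I_gt0.
have e : v = sc (proj v) (I v `^ s^-1).
  rewrite /proj (scalingM sc_scaling) ?powR_ge0// -powRD; last by rewrite (gt_eqF (I_gt0 v0)) implybT.
  by rewrite addNr powRr0 (scaling1 sc_scaling).
exists (proj v), (I v `^ s^-1); split => //; first exact: proj_Ms.
apply: (is_derive_eq (is_derive_fiber c (proj_Ms v0) t0)).
by rewrite -e (kE _).2// mulr0.
Qed.


Definition nproj c u : W := sc u ((kap c / G u) `^ r^-1).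

Lemma nproj_nehari c u : 0 < c -> u != 0 -> nproj c u != 0 /\ G (nproj c u) = kap c.
Proof.
move=> c0 u0; have Gu := G_gt0 u0; have k0 := kap_gt0 c0.
have x0 : 0 < kap c / G u by rewrite divr_gt0.
split; first by rewrite sc_neq0// powR_gt0.
rewrite /nproj G_sc ?powR_ge0// -powRrM mulVf ?gt_eqF// powRr1 ?(ltW x0)//.
by rewrite divfK// gt_eqF.
Qed.

Lemma nproj_odd c u : nproj c (- u) = - nproj c u.
Proof. by rewrite /nproj (potential_even _ odd_g) scN// powR_ge0. Qed.

Lemma continuous_nproj c u : 0 < c -> u != 0 -> {for u, continuous (nproj c)}.
Proof.
move=> c0 u0; have Gu := G_gt0 u0; apply: continuous_sc; first exact: cvg_id.
- apply: (@continuous_comp _ _ _ (fun v => kap c / G v) (fun y => y `^ r^-1)).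
    apply: cvgM; first exact: cvg_cst.
    by apply: cvgV; [rewrite gt_eqF | exact: (continuous_potential potential_g)].
  by apply: powR_continuous; rewrite divr_gt0 ?kap_gt0.
- by move=> v; exact: powR_ge0.
Qed.

Lemma nehari_Psi c v : 0 < c -> nehari c v -> lambda_fun c v = Psi (Kc c) v.
Proof.
move=> c0 /(nehariE v c0)[v0 Gv]; rewrite lambda_funE /Psi /Gam Gv Kc_kap//.
by congr (_ / _); ring.
Qed.

Lemma lambda_ckE c k : 0 < c -> lambda_ck sc A B f g c k.+1 = (mm (Kc c) k)%:E.
Proof.
move=> c0; rewrite /lambda_ck (@minimax_eq _ _ (Psi (Kc c))); last by move=> u; exact: nehari_Psi.
rewrite -(mmE k (ltW (Kc_gt0 c0))); apply/eqP; rewrite eq_le; apply/andP; split.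
  apply: (@minimax_transfer (Ms A) (nehari c) _ _ (nproj c)).
  - move=> u /(nehariE u c0)[u0 Gu]; apply/(nehariE _ c0).
    by rewrite oppr_eq0 (potential_even _ odd_g).
  - exact: Psi_even.
  - move=> a; apply: (@finite_type_preimage _ _ _ [set u | Ms A u /\ Psi (Kc c) u <= a] proj).
    + move=> u [/(nehariE u c0)[u0 _] Pu]; split; first exact: proj_Ms.
      by rewrite proj_Psi.
    + move=> x; apply: (@continuous_comp _ _ _ set_val proj); first exact: initial_continuous.
      by apply: continuous_proj; have [/(nehariE _ c0)[]] := set_valP x.
    + by move=> u _; exact: proj_odd.
    + exact: finite_type_sublevel.
  - by move=> u /Ms_neq0; exact: continuous_nproj.
  - by move=> u _; exact: nproj_odd.
  - move=> u /Ms_neq0 u0; split; first by apply/(nehariE _ c0); exact: nproj_nehari.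
    by rewrite Psi_sc// powR_gt0// divr_gt0 ?kap_gt0 ?G_gt0.
apply: (@minimax_transfer (nehari c) (Ms A) _ _ proj).
- by move=> u Mu; rewrite /Ms /= (potential_even _ odd_A).
- exact: Psi_even.
- by move=> a; exact: finite_type_sublevel.
- by move=> u /(nehariE u c0)[u0 _]; exact: continuous_proj.
- by move=> u _; exact: proj_odd.
- move=> u /(nehariE u c0)[u0 _]; split; first exact: proj_Ms.
  exact: proj_Psi.
Qed.

Lemma lambda_kE k : lambda_k A B k.+1 = (mm 0 k)%:E.
Proof.
rewrite /lambda_k (@minimax_eq _ _ (Psi 0)) ?mmE// => u Mu.
by rewrite Psi_Ms// mul0r subr0 mul1r.
Qed.

(** The critical point found on [Ms] is rescaled until G = [kap c]; this respects criticality by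
    [Q_sc]. *)
Lemma critical_nehari c k : 0 < c -> exists v, [/\ v != 0,
  A v - mm (Kc c) k *: B v - g v = 0 & lambda_fun c v = mm (Kc c) k].
Proof.
move=> c0; have [u [Mu Pu Qu]] := mm_critical k (ltW (Kc_gt0 c0)).
have u0 := Ms_neq0 Mu; have [v0 Gv] := nproj_nehari c0 u0.
have t0 : 0 < (kap c / G u) `^ r^-1 by rewrite powR_gt0// divr_gt0 ?kap_gt0 ?G_gt0.
have Pv : Psi (Kc c) (nproj c u) = mm (Kc c) k by rewrite Psi_sc.
exists (nproj c u); split => //; last first.
  by rewrite nehari_Psi//; apply/(nehariE _ c0).
(* Every test vector is itself the rescaling of a vector, because scaling by a positive factor is
   invertible. *)
have Qv w : Q (Kc c) (nproj c u) w = 0.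
  rewrite -(scaling1 sc_scaling w) -(mulVf (lt0r_neq0 t0)).
  by rewrite -(scalingM sc_scaling) ?invr_ge0 ?(ltW t0)// Q_sc// Qu.
apply/val_inj/funext => w /=; have := Qv w; rewrite Q_app Pv => /eqP.
rewrite mulf_eq0 invr_eq0 gt_eqF ?J_gt0//= => /eqP.
have -> : Kc c * gam (nproj c u) w = g (nproj c u) w.
  by rewrite /gam Gv scaled mulrA Kc_slope// mul1r.
move=> h; rewrite -[RHS]/(0 : R) -h.
by rewrite [LHS](_ : _ = A (nproj c u) w - mm (Kc c) k * B (nproj c u) w - g (nproj c u) w)// addrAC.
Qed.

Lemma critical_Phi c k : 0 < c -> exists v, [/\ v != 0,
  critical_point (Phi (mm (Kc c) k) : W -> R^o) v, Phi (mm (Kc c) k) v = c,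
  critical_point (lambda_fun c : W -> R^o) v & lambda_fun c v = mm (Kc c) k].
Proof.
move=> c0; have [v [v0 Av lv]] := critical_nehari k c0; exists v; split => //.
- by apply/(is_diff_zero_critical (is_diff_Phi _ v)).
- move: lv; rewrite lambda_funE PhiE => <-; rewrite divfK ?gt_eqF ?J_gt0//; ring.
- apply/(is_diff_zero_critical (is_diff_lambda_fun c v0)).
  by rewrite lv addrAC Av scaler0.
Qed.

(** (H3) with coefficients 1, lambda, 0, 1 reads s (I - lambda J) = r G at a critical point, so that
    s Phi = (r - s) G. *)
Lemma critical_value_gt0 (lambda : R) u : u != 0 -> critical_point (Phi lambda : W -> R^o) u ->
  0 < Phi lambda u.
Proof.
move=> u0 /(is_diff_zero_critical (is_diff_Phi lambda u)) Au.
have := pert_identity fg_pert (alpha := 1) (beta := lambda) (gamma := 0) (delta := 1) (u := u).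
rewrite !scale1r scale0r addr0 => /(_ _)/wrap[].
  by apply/eqP; rewrite -subr_eq0 opprD addrA Au.
rewrite F0 !mulr0 addr0 !mulr1 PhiE => h.
have Gu := G_gt0 u0; have rs := s_lt_r.
have e : s * (I u - lambda * J u - G u) = (r - s) * G u.
  by rewrite !mulrBr h; ring.
by rewrite -(pmulr_rgt0 _ s0) e mulr_gt0.
Qed.


(** * The levels as functions of [c], and critical points for given [lambda] *)

Lemma mm_dist K1 k : 0 <= K1 -> exists2 L, 0 < L &
  forall K K', 0 <= K <= K1 -> 0 <= K' <= K1 -> `|mm K k - mm K' k| <= `|K - K'| * L.
Proof.
move=> K10; have [L L0 LP] := mm_lipschitz k K10; exists L => //.
suff h K K' : 0 <= K -> K <= K' -> K' <= K1 -> `|mm K k - mm K' k| <= `|K - K'| * L.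
  move=> K K' /andP[h1 h2] /andP[h3 h4]; have [KK|/ltW KK] := leP K K'; first exact: h.
  by rewrite distrC (distrC K); exact: h.
move=> h1 h2 h3; rewrite ger0_norm ?subr_ge0 ?mm_anti_le// distrC ger0_norm ?subr_ge0//.
by rewrite lerBlDl; exact: LP.
Qed.

Lemma cvg_mm (T : Type) (F : set_system T) (FF : Filter F) (h : T -> R) K k : 0 <= K ->
  (\forall x \near F, 0 <= h x) -> h @ F --> K -> mm (h x) k @[x --> F] --> mm K k.
Proof.
move=> K0 h0 hK; have [|L L0 LP] := @mm_dist (K + 1) k; first by rewrite addr_ge0.
apply/cvgrPdist_lt => e e0.
have d0 : 0 < Num.min 1 (e / L) by rewrite lt_min ltr01 divr_gt0.
near=> x.
have hx : `|K - h x| < Num.min 1 (e / L) by near: x; move/cvgrPdist_lt : hK; apply.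
move: hx; rewrite lt_min => /andP[hx1 hx2].
apply: le_lt_trans (LP K (h x) _ _) _.
- by rewrite K0 lerDl ler01.
- apply/andP; split; first by near: x.
  by move: hx1; rewrite ltr_norml; lra.
- by rewrite -ltr_pdivlMr.
Unshelve. all: by end_near. Qed.

Lemma Kc_exp_gt0 : 0 < Kc_exp.
Proof. by rewrite subr_gt0 ltr_pdivrMr// mul1r s_lt_r. Qed.

Lemma Kc_lt c d : 0 < c -> c < d -> Kc c < Kc d.
Proof.
move=> c0 cd; rewrite /Kc ltr_pM2l ?Kc_factor_gt0//.
by apply: gt0_ltr_powR; rewrite ?Kc_exp_gt0 ?nnegrE ?(ltW c0)// ltW// (lt_trans c0).
Qed.

Lemma Kc_surj K : 0 < K -> exists2 c, 0 < c & Kc c = K.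
Proof.
move=> K0; have x0 : 0 < K / Kc_factor by rewrite divr_gt0 ?Kc_factor_gt0.
exists ((K / Kc_factor) `^ Kc_exp^-1); first by rewrite powR_gt0.
rewrite /Kc -powRrM mulVf ?gt_eqF ?Kc_exp_gt0// powRr1 ?(ltW x0)//.
by rewrite mulrC divfK// gt_eqF ?Kc_factor_gt0.
Qed.

Lemma continuous_Kc c : 0 < c -> {for c, continuous Kc}.
Proof. by move=> c0; apply: cvgM; [exact: cvg_cst | exact: powR_continuous]. Qed.

Lemma Kc_cvg0 : Kc c @[c --> 0^'+] --> (0 : R).
Proof.
have h : Kc_factor * (c `^ Kc_exp) @[c --> 0^'+] --> Kc_factor * 0.
  by apply: cvgM; [exact: cvg_cst | exact: powR_cvg0 Kc_exp_gt0].
by rewrite mulr0 in h.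
Qed.

Local Notation lam := (lambda_ck sc A B f g).

Lemma lam_mono c k l : 0 < c -> (1 <= k <= l)%N -> (lam c k <= lam c l)%E.
Proof.
case: k l => [|k] [|l] //= c0 kl; rewrite !lambda_ckE// lee_fin; apply: mm_mono => //.
exact/ltW/Kc_gt0.
Qed.

Lemma lam_to_infty c : 0 < c -> lam c k @[k --> \oo] --> +oo%E.
Proof.
move=> c0; apply/cvgeyPge => a; have [n nP] := mm_to_infty a (ltW (Kc_gt0 c0)).
exists n.+1 => // -[|k] //= nk; rewrite lambda_ckE// lee_fin; exact: nP.
Qed.

Lemma lam_continuous k : {within [set c | 0 < c], continuous (fun c => fine (lam c k.+1))}.
Proof.
apply/subspace_continuousP => c /= c0.
have e : fine (lam c k.+1) = mm (Kc c) k by rewrite lambda_ckE.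
rewrite -[X in _ --> X]/(fine (lam c k.+1)) e.
have h1 : mm (Kc d) k @[d --> c] --> mm (Kc c) k.
  apply: cvg_mm; first exact/ltW/Kc_gt0; last exact: continuous_Kc.
  by near=> d; apply/ltW/Kc_gt0; near: d; exact: lt_nbhsr.
have h2 : mm (Kc d) k @[d --> within [set c | 0 < c] (nbhs c)] --> mm (Kc c) k.
  by apply: cvg_trans h1; apply: cvg_fmap2; exact: cvg_within.
have h3 : \forall d \near within [set c | 0 < c] (nbhs c), mm (Kc d) k = fine (lam d k.+1).
  by rewrite near_withinE; near=> d => d0; rewrite (lambda_ckE k (d0 : 0 < d)); reflexivity.
exact: cvg_trans (near_eq_cvg h3) h2.
Unshelve. all: by end_near. Qed.

Lemma lam_decreasing k c d : 0 < c -> c < d -> (lam d k.+1 < lam c k.+1)%E.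
Proof.
move=> c0 cd; rewrite !lambda_ckE ?(lt_trans c0 cd)// lte_fin.
by apply: mm_anti; [exact/ltW/Kc_gt0 | exact: Kc_lt].
Qed.

Lemma lam_cvg0 k : lam c k.+1 @[c --> 0^'+] --> lambda_k A B k.+1.
Proof.
rewrite lambda_kE.
have h1 : mm (Kc d) k @[d --> 0^'+] --> mm 0 k.
  apply: cvg_mm => //; last exact: Kc_cvg0.
  by near=> d; apply/ltW/Kc_gt0; near: d; exact: nbhs_right_gt.
apply: cvg_EFin.
  by near=> d; rewrite lambda_ckE//; near: d; exact: nbhs_right_gt.
apply: cvg_trans h1; apply: near_eq_cvg; near=> d; rewrite /= lambda_ckE//.
Unshelve. all: by end_near. Qed.

Lemma lam_to_ninfty k : lam c k.+1 @[c --> +oo] --> -oo%E.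
Proof.
apply/cvgeNyPle => a; have [K0 K00 K0P] := mm_to_ninfty k a.
have [c0 c00 Kc0] := @Kc_surj (K0 + 1) (ltr_wpDl K00 ltr01).
near=> c; have c0c : c0 < c by near: c; apply: nbhs_pinfty_gt; exact: num_real.
rewrite lambda_ckE ?(lt_trans c00)// lee_fin; apply: K0P.
by apply: le_trans (ltW (Kc_lt c00 c0c)); rewrite Kc0 lerDl.
Unshelve. all: by end_near. Qed.

Lemma level_exists (lambda : R) k : lambda < mm 0 k -> exists2 c, 0 < c & mm (Kc c) k = lambda.
Proof.
move=> l0; have [K0 K00 K0P] := mm_to_ninfty k lambda.
have h0 := K0P K0 (lexx _).
have [||K] := @IVT R (mm^~ k) 0 K0 lambda K00.
- apply/subspace_continuousP => K; rewrite /= in_itv /= => /andP[K1 K2].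
  apply: cvg_mm => //; last exact: cvg_within.
  by rewrite near_withinE; near=> x; rewrite /= in_itv /= => /andP[].
- by rewrite ge_min le_max h0 (ltW l0) orbT.
rewrite in_itv /= => /andP[K1 K2] e.
(* [Kc] takes positive values only; the root K = 0 is ruled out by the strict inequality at 0. *)
have {}K1 : 0 < K.
  by rewrite lt_neqAle K1 andbT; apply/eqP => K_eq; move: e l0; rewrite -K_eq => ->; rewrite ltxx.
by have [c c0 cK] := Kc_surj K1; exists c => //; rewrite cK.
Unshelve. all: by end_near. Qed.

(** Since [Phi lambda] is bounded above on balls, critical values tending to infinity force the
    norms to do so. *)
Lemma Phi_bounded (lambda : R) a : exists M, forall u, `|u| <= a -> Phi lambda u <= M.
Proof.
have [MA MAP] := A_bounded a; have [Jm Jm0 JP] := J_bounded a.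
exists (MA * a + `|lambda| * Jm) => u ua; rewrite PhiE.
have hI : I u <= MA * a by exact: (potential_le potential_A MAP).
have hJ : - (lambda * J u) <= `|lambda| * Jm.
  rewrite -mulNr; apply: (@le_trans _ _ (`|lambda| * J u)).
    by rewrite ler_wpM2r ?J_ge0// -normrN ler_norm.
  by rewrite ler_wpM2l// JP.
have := G_ge0 u; lra.
Qed.

Lemma critical_sequence (lambda : R) : exists v : nat -> W,
  [/\ forall k, v k != 0 /\ critical_point (Phi lambda : W -> R^o) (v k),
      forall k l, (k <= l)%N -> Phi lambda (v k) <= Phi lambda (v l),
      Phi lambda (v k) @[k --> \oo] --> +oo &
      `|v k| @[k --> \oo] --> +oo].
Proof.
(* The indices start at [n], where the level at K = 0 exceeds [lambda], so that [level_exists]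
   applies. *)
have [n nP] := mm_to_infty (lambda + 1) (lexx 0).
have /choice[c cP] k : exists c, 0 < c /\ mm (Kc c) (n + k) = lambda.
  have [|c c0 cl] := @level_exists lambda (n + k); last by exists c.
  by apply: lt_le_trans (nP _ (leq_addr _ _)); rewrite ltrDl.
have /choice[v vP] k : exists v, [/\ v != 0, critical_point (Phi lambda : W -> R^o) v & Phi lambda v = c k].
  have [c0 cl] := cP k; have [v] := critical_Phi (n + k) c0.
  by rewrite cl => -[v0 h1 h2 _ _]; exists v.
have PhiV k : Phi lambda (v k) = c k by have [] := vP k.
(* The level decreases in c and equals [lambda] at [c k]; if it still exceeds [lambda] at [a], then
   [a] is at most [c k]. *)
have c_ge a k : 0 < a -> lambda < mm (Kc a) (n + k) -> a <= c k.
  move=> a0 la; have [c0 cl] := cP k; rewrite leNgt; apply/negP => /(Kc_lt c0) h.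
  by have := mm_anti (n + k) (ltW (Kc_gt0 c0)) h; rewrite cl ltNge ltW.
have cy a : \forall k \near \oo, a <= c k.
  have a1 : 0 < `|a| + 1 by rewrite ltr_wpDl.
  have [n' n'P] := mm_to_infty (lambda + 1) (ltW (Kc_gt0 a1)).
  exists n' => // k /= n'k; apply: le_trans (c_ge (`|a| + 1) k a1 _).
    by apply: le_trans (ler_norm a) _; rewrite lerDl.
  apply: lt_le_trans (n'P _ (leq_trans n'k (leq_addl _ _))).
  by rewrite ltrDl.
exists v; split.
- by move=> k; have [] := vP k.
- move=> k l kl; rewrite !PhiV; have [ck0 ckl] := cP k; have [cl0 cll] := cP l.
  rewrite leNgt; apply/negP => /(Kc_lt cl0) h.
  have := mm_anti (n + k) (ltW (Kc_gt0 cl0)) h; rewrite ckl ltNge -[X in _ <= X]cll => /negP; apply.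
  by apply: mm_mono; [exact/ltW/Kc_gt0 | rewrite leq_add2l].
- by apply/cvgryPge => a; have := cy a; apply: filterS => k; rewrite PhiV.
- apply/cvgryPge => a; have [M MP] := Phi_bounded lambda a.
  have := cy (M + 1); apply: filterS => k h; rewrite leNgt; apply/negP => /ltW/MP.
  by rewrite PhiV; lra.
Qed.

End framework.

Theorem theorem2p21 (R : realType) (W : completeNormedModType R)
    (sc : W -> R -> W) (q s r : R) (A B f g : W -> dual W)
    (W_reflexive : reflexive_space W)
    (W_infinite : infinite_dimensional W)
    (sc_scaling : scaling sc s)
    (AB_scaled : scaled_pair sc s A B)
    (fg_pert : perturbations sc q s r A B f g)
    (F_eq0 : forall u, u != 0 -> potential f u = 0)
    (G_gt0 : forall u, u != 0 -> 0 < potential g u)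
    (h_neq0 : forall c u, nehari sc A B f g c u -> h_op q s r f g u != 0) :
  let Iplus : set R := [set c | 0 < c] in
  let lam := lambda_ck sc A B f g in
  [/\ forall c, Iplus c ->
        [/\ forall k l : nat, (1 <= k <= l)%N -> (lam c k <= lam c l)%E,
            lam c k @[k --> \oo] --> +oo%E &
            forall k, (1 <= k)%N ->
              (exists2 u, u != 0 & critical_point (lambda_fun A B f g c) u /\
                                   (lambda_fun A B f g c u)%:E = lam c k) /\
              (exists2 u, u != 0 &
                 critical_point (Phi A B f g (fine (lam c k))) u /\
                 Phi A B f g (fine (lam c k)) u = c)],
      forall k, (1 <= k)%N ->
        [/\ forall c, Iplus c -> lam c k \is a fin_num,
            {within Iplus, continuous (fun c => fine (lam c k))},
            forall c d, Iplus c -> Iplus d -> c < d -> (lam d k < lam c k)%E,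
            lam c k @[c --> 0^'+] --> lambda_k A B k &
            lam c k @[c --> +oo] --> -oo%E] &
      forall lambda : R,
        (exists v : nat -> W,
          [/\ forall k, v k != 0 /\ critical_point (Phi A B f g lambda) (v k),
              forall k l, (k <= l)%N ->
                Phi A B f g lambda (v k) <= Phi A B f g lambda (v l),
              Phi A B f g lambda (v k) @[k --> \oo] --> +oo &
              `|v k| @[k --> \oo] --> +oo]) /\
        ~ (exists u, [/\ u != 0, critical_point (Phi A B f g lambda) u &
                         ~ Iplus (Phi A B f g lambda u)])].

Proof.
move=> Iplus lam.
have lE := lambda_ckE W_reflexive sc_scaling AB_scaled fg_pert G_gt0 W_infinite F_eq0.
split.
- move=> c c0; split.
  + by move=> k l; exact: (lam_mono W_reflexive sc_scaling AB_scaled fg_pert G_gt0 W_infinite F_eq0 c0).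
  + exact: (lam_to_infty W_reflexive sc_scaling AB_scaled fg_pert G_gt0 W_infinite F_eq0 c0).
  + case=> // k _; rewrite /lam (lE c k c0)/=.
    have [v [v0 h1 h2 h3 h4]] := critical_Phi W_reflexive sc_scaling AB_scaled fg_pert G_gt0 W_infinite F_eq0 k c0.
    by split; exists v => //; split => //; rewrite h4.
- case=> // k _; split.
  + by move=> c c0; rewrite /lam (lE c k c0).
  + apply: (lam_continuous W_reflexive sc_scaling AB_scaled fg_pert G_gt0 W_infinite F_eq0).
  + by move=> c d c0 _; exact: (lam_decreasing W_reflexive sc_scaling AB_scaled fg_pert G_gt0 W_infinite F_eq0 k c0).
  + apply: (lam_cvg0 W_reflexive sc_scaling AB_scaled fg_pert G_gt0 W_infinite F_eq0).
  + apply: (lam_to_ninfty W_reflexive sc_scaling AB_scaled fg_pert G_gt0 W_infinite F_eq0).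
- move=> lambda; split; first apply: (critical_sequence W_reflexive sc_scaling AB_scaled fg_pert G_gt0 W_infinite F_eq0).
  by move=> [u [u0 cu]]; apply; apply: (critical_value_gt0 sc_scaling AB_scaled fg_pert G_gt0 F_eq0 u0 cu).
Qed.
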